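(* Let $\mu=\rho\mathcal L^n$ be a probability measure on $\mathbb R^n$ with $\rho\in C_c^\infty(\mathbb R^n)$ ($\mathcal L^n$ Lebesgue measure), and let $\varphi,\psi\in C_c^\infty(\{\rho>0\})$ with $\Lambda>0$. Then $$\mathsf{Sec}_\mu(\nabla\varphi,\nabla\psi)=\frac3\Lambda\cdot\inf\Big\{\int_{\mathbb R^n}\big|\nabla^2\psi\,\nabla\varphi-\nabla\eta\big|^2d\mu:\ \eta\in C_c^\infty(\mathbb R^n)\Big\}.$$
   Context: $W_2$ is the Kantorovich-Wasserstein metric on the space $\mathscr P_2(\mathbb R^n)$ of probability measures with finite second moment. For a vector field $V\in L^2(\mu)$ put $\exp_\mu(V)=(\mathrm{Id}+V)_*\mu$. For $V,W\in L^2(\mu)$ gradient fields, $\Lambda=\int|V|^2d\mu\int|W|^2d\mu-\big(\int\langle V,W\rangle d\mu\big)^2$ (here $V=\nabla\varphi$, $W=\nabla\psi$). The sectional curvature of $(\mathscr P_2(\mathbb R^n),W_2)$ at $\mu$ is defined (when $\Lambda>0$) by $\mathsf{Sec}_\mu(V,W)=L$ iff $$\frac{3}{\Lambda s_j^2t_j^2}\Big[\int|s_jV-t_jW|^2d\mu-W_2^2\big(\exp_\mu(s_jV),\exp_\mu(t_jW)\big)\Big]\to L$$ for every sequence in $(0,\infty)^2$ with $s_j,t_j\to0$ and $\sup_j(s_j/t_j+t_j/s_j)<\infty$. $\nabla^2\psi\,\nabla\varphi$ is the Hessian of $\psi$ applied to $\nabla\varphi$. *)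

(* Defs.v *)
From HB Require Import structures.
From mathcomp Require Import all_boot all_order all_algebra.
From mathcomp Require Import all_classical all_reals all_analysis.
From mathcomp Require Import measurable_realfun.

Set Implicit Arguments.
Unset Strict Implicit.
Unset Printing Implicit Defensive.

Import Order.TTheory GRing.Theory Num.Theory.
Import numFieldNormedType.Exports.

Local Open Scope classical_set_scope.
Local Open Scope ring_scope.

(* R^n is the type 'rV[R]_n of row vectors, equipped with its Borel
   sigma-algebra. The library norm `|x| on matrices is the sup norm, so the
   Euclidean structure is given by dotv and sqnorm below. *)

Section borel_rV.
Context {R : realType} {n : nat}.

Definition borel_rV : set (set 'rV[R]_n) := <<s open >>.

HB.instance Definition _ :=
  @isMeasurable.Build (sigma_display (@open 'rV[R]_n)) 'rV[R]_n
    borel_rV (@sigma_algebra0 _ setT open) (@sigma_algebraC _ open)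
    (@sigma_algebra_bigcup _ setT open).

Lemma open_measurable_rV (U : set 'rV[R]_n) : open U -> measurable U.
Proof. by move=> oU; exact: sub_sigma_algebra. Qed.

Let rV_of_rat (q : 'rV[rat]_n) : 'rV[R]_n := map_mx ratr q.

Let open_bigcup_ball (U : set 'rV[R]_n) : open U ->
  U = \bigcup_(qk in [set qk : 'rV[rat]_n * nat |
        ball (rV_of_rat qk.1) qk.2.+1%:R^-1 `<=` U])
      ball (rV_of_rat qk.1) qk.2.+1%:R^-1.
Proof.
move=> oU; apply/seteqP; split => [x Ux|x [qk qkU]]; last exact: qkU.
have /nbhs_ballP[e /= e0 xeU] : nbhs x U by exact: open_nbhs_nbhs.
pose k := Num.truncn (2 / e).
have k0 : 0 < k.+1%:R^-1 :> R by rewrite invr_gt0 ltr0n.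
have ke : k.+1%:R^-1 < e / 2.
  rewrite -[e / 2]invrK ltf_pV2 ?posrE ?invr_gt0 ?divr_gt0 ?ltr0n//.
  rewrite invf_div.
  have e2 : 0 <= 2 / e by rewrite divr_ge0// ltW.
  by have /andP[] := truncn_itv e2.
have qP (j : 'I_n) : exists q : rat, `|ratr q - x ord0 j| < k.+1%:R^-1.
  have [q] := @rat_in_itvoo R (x ord0 j - k.+1%:R^-1) (x ord0 j + k.+1%:R^-1)
    ltac:(by rewrite ltrBlDr -addrA ltrDl addr_gt0).
  by rewrite in_itv /= => q_in; exists q; rewrite ltr_distl.
pose q := \row_j projT1 (cid (qP j)) : 'rV[rat]_n.
have qE j : `|ratr (q ord0 j) - x ord0 j| < k.+1%:R^-1.
  by rewrite mxE; exact: projT2 (cid (qP j)).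
have qx : ball (rV_of_rat q) k.+1%:R^-1 x.
  split => // i j; rewrite ord1 mxE -ball_normE; exact: qE.
exists (q, k) => //= y qy; apply: xeU; rewrite -[e]divr1.
have -> : e / 1 = e / 2 + e / 2 by rewrite divr1 -splitr.
apply: ball_triangle (le_ball (ltW ke) qy).
by apply/ball_sym/(le_ball (ltW ke)).
Qed.

Lemma measurable_fun_rV d (T : measurableType d) (f : T -> 'rV[R]_n) :
  (forall i, measurable_fun setT (fun x => f x ord0 i)) ->
  measurable_fun setT f.
Proof.
move=> mf; apply: (@measurability _ _ _ _ _ _ (@open 'rV[R]_n)) => //.
move=> _ [U oU <-]; rewrite setTI (open_bigcup_ball oU) bigcup_mkcond.
rewrite preimage_bigcup; apply: countable_bigcupT_measurable => [|[q k]].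
  exact: countableP.
case: ifPn => _; last by rewrite preimage_set0.
rewrite [X in measurable X](_ : _ = \bigcap_(j in [set: 'I_n])
    ((fun x => f x ord0 j) @^-1` ball (rV_of_rat q ord0 j) k.+1%:R^-1)).
  apply: fin_bigcap_measurable => [|j _]; first exact: finite_finset.
  rewrite -[X in measurable X]setTI; apply: mf => //.
  by apply: open_measurable; exact: ball_open.
apply/seteqP; split => [x [_ qx] j _|x qx]; first exact: qx.
by split => [|i j]; [rewrite invr_gt0 ltr0n|rewrite ord1; exact: qx].
Qed.

Lemma measurable_coord (i : 'I_n) :
  measurable_fun setT (fun v : 'rV[R]_n => v ord0 i).
Proof.
apply: (measurability _ (RGenOpens.measurableE R)).
move=> _ [_ [a [b ->] <-]]; rewrite setTI; apply: open_measurable_rV.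
apply: open_comp; last exact: interval_open.
by move=> v _; exact: coord_continuous.
Qed.

End borel_rV.

Section lebesgue_rV.
Context {R : realType}.

Definition cons_rV n (p : measurableTypeR R * 'rV[R]_n) : 'rV[R]_n.+1 := row_mx (p.1 : R)%:M p.2.

Definition uncons_rV n (v : 'rV[R]_n.+1) : measurableTypeR R * 'rV[R]_n :=
  (v ord0 ord0, \row_i v ord0 (lift ord0 i)).

Lemma cons_rV0 n (p : measurableTypeR R * 'rV[R]_n) : cons_rV p ord0 ord0 = p.1.
Proof.
rewrite /cons_rV (_ : ord0 = lshift n (ord0 : 'I_1)); last exact/val_inj.
by rewrite (row_mxEl (p.1 : R)%:M) mxE eqxx mulr1n.
Qed.

Lemma cons_rVS n (p : measurableTypeR R * 'rV[R]_n) i :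
  cons_rV p ord0 (lift ord0 i) = p.2 ord0 i.
Proof.
rewrite /cons_rV (_ : lift ord0 i = rshift 1 i); last exact/val_inj.
by rewrite (row_mxEr (p.1 : R)%:M).
Qed.

Lemma cons_rVK n : cancel (@cons_rV n) (@uncons_rV n).
Proof.
move=> [x v]; rewrite /uncons_rV cons_rV0; congr pair.
by apply/rowP => i; rewrite mxE cons_rVS.
Qed.

Lemma measurable_cons_rV n : measurable_fun setT (@cons_rV n).
Proof.
apply: measurable_fun_rV => i; case: (unliftP ord0 i) => [j|] ->.
  under eq_fun do rewrite cons_rVS.
  exact: (measurableT_comp (measurable_coord j)).
under eq_fun do rewrite cons_rV0.
exact: (@measurable_fst _ _ (measurableTypeR R) 'rV[R]_n).
Qed.

Lemma measurable_uncons_rV n : measurable_fun setT (@uncons_rV n).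
Proof.
apply: measurable_fun_pair; first exact: measurable_coord.
apply: measurable_fun_rV => i; under eq_fun do rewrite mxE.
exact: measurable_coord.
Qed.

Section lebesgue_rV_succ.
Variables (n : nat) (m : {sigma_finite_measure set 'rV[R]_n -> \bar R}).

Definition lebesgue_rV_succ : set 'rV[R]_n.+1 -> \bar R :=
  pushforward (@lebesgue_measure R \x m)%E (@cons_rV n).

Let lebesgue_rV_succ0 : lebesgue_rV_succ set0 = 0%E.
Proof. by rewrite /lebesgue_rV_succ /pushforward preimage_set0 measure0. Qed.

Let lebesgue_rV_succ_ge0 A : (0 <= lebesgue_rV_succ A)%E.
Proof. exact: (measure_ge0 (@lebesgue_measure R \x m)%E). Qed.

Let lebesgue_rV_succ_sigma_additive : semi_sigma_additive lebesgue_rV_succ.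
Proof.
move=> F mF tF mUF; rewrite /lebesgue_rV_succ /pushforward preimage_bigcup.
have mpre A : measurable A -> measurable (@cons_rV n @^-1` A).
  by move=> mA; rewrite -[X in measurable X]setTI; exact: measurable_cons_rV.
apply: measure_semi_sigma_additive.
- by move=> k; exact: mpre.
- apply/trivIsetP => /= i j _ _ ij; rewrite -preimage_setI.
  by move/trivIsetP : tF => /(_ _ _ _ _ ij) ->//; rewrite preimage_set0.
- by rewrite -preimage_bigcup; exact: mpre.
Qed.

HB.instance Definition _ := isMeasure.Build _ _ _ lebesgue_rV_succ
  lebesgue_rV_succ0 lebesgue_rV_succ_ge0 lebesgue_rV_succ_sigma_additive.

Let sigma_finite_lebesgue_rV_succ : sigma_finite setT lebesgue_rV_succ.
Proof.
have [F UF mF] : sigma_finite setT (@lebesgue_measure R \x m)%E.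
  have /sigma_finiteP[F [TF ndF Foo]] := sigma_finiteT (@lebesgue_measure R).
  have /sigma_finiteP[G [TG ndG Goo]] := sigma_finiteT m.
  exists (fun k => F k `*` G k).
    rewrite -setXTT TF TG; apply/seteqP; split => [[x y]|[x y] [k _ [? ?]]].
      move=> [/= [i _ Fix] [k _ Gky]]; exists (maxn i k) => //; split.
        by move: x Fix; exact/subsetPset/ndF/leq_maxl.
      by move: y Gky; exact/subsetPset/ndG/leq_maxr.
    by split; exists k.
  move=> k; have [? ?] := Foo k; have [? ?] := Goo k.
  split; first exact: measurableX.
  by rewrite product_measure1E// lte_mul_pinfty// ge0_fin_numE.
have FE k : @cons_rV n @^-1` (@uncons_rV n @^-1` F k) = F k.
  by apply/seteqP; split => x; rewrite /= cons_rVK.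
exists (fun k => @uncons_rV n @^-1` F k).
  by rewrite -preimage_bigcup -UF preimage_setT.
move=> k; have [mFk Fkoo] := mF k; split.
  by rewrite -[X in measurable X]setTI; exact: measurable_uncons_rV.
by rewrite /lebesgue_rV_succ /pushforward FE.
Qed.

HB.instance Definition _ := Measure_isSigmaFinite.Build _ _ _
  lebesgue_rV_succ sigma_finite_lebesgue_rV_succ.

End lebesgue_rV_succ.

(* The n-dimensional Lebesgue measure, as the n-fold product of the
   one-dimensional one: see lebesgue_rV_box. *)
Fixpoint lebesgue_rV n : {sigma_finite_measure set 'rV[R]_n -> \bar R} :=
  if n is k.+1 then lebesgue_rV_succ (lebesgue_rV k)
  else @dirac _ 'rV[R]_0 0 R.

Lemma lebesgue_rV_box n (a b : 'I_n -> R) : (forall i, a i <= b i) ->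
  lebesgue_rV n [set x | forall i, a i <= x ord0 i <= b i] =
  (\prod_i (b i - a i))%:E.
Proof.
elim: n a b => [|n IH] a b ab.
  rewrite big_ord0 /= diracE mem_set// => -[].
  by [].
pose B : set 'rV[R]_n :=
  [set x | forall i, a (lift ord0 i) <= x ord0 i <= b (lift ord0 i)].
have mB : measurable B.
  rewrite [X in measurable X](_ : _ = \bigcap_(i in [set: 'I_n])
    ((fun v : 'rV[R]_n => v ord0 i) @^-1`
      `[a (lift ord0 i), b (lift ord0 i)])).
    apply: fin_bigcap_measurable => [|i _]; first exact: finite_finset.
    by rewrite -[X in measurable X]setTI; apply: measurable_coord.
  apply/seteqP; split => [x xab i _|x xab i].
    by rewrite /= in_itv; exact: xab.
  by have := xab i Logic.I; rewrite /= in_itv.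
have preB : @cons_rV n @^-1` [set x | forall i, a i <= x ord0 i <= b i] =
    (`[a ord0, b ord0] : set (measurableTypeR R)) `*` B.
  apply/seteqP; split => [[x v] /= xab|[x v] /= [xab vab] i].
    split; first by have := xab ord0; rewrite cons_rV0 in_itv.
    by move=> i; have := xab (lift ord0 i); rewrite cons_rVS.
  by case: (unliftP ord0 i) => [j|] ->; [rewrite cons_rVS; exact: vab|
    rewrite cons_rV0; move: xab; rewrite in_itv].
rewrite /= /lebesgue_rV_succ /pushforward preB product_measure1E//=.
rewrite IH => [|i]; last exact: ab.
rewrite lebesgue_measure_itv/= lte_fin big_ord_recl EFinM.
have := ab ord0; rewrite le_eqVlt => /predU1P[->|->//].
by rewrite ltxx subrr !mul0e.
Qed.

End lebesgue_rV.

Section smooth_functions.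
Context {R : realType} {n : nat}.
Implicit Types (f : 'rV[R]_n -> R) (x : 'rV[R]_n).

Definition partial (i : 'I_n) f : 'rV[R]_n -> R :=
  fun x => 'D_(delta_mx ord0 i) f x.

Fixpoint is_Ck (k : nat) f : Prop :=
  continuous f /\
  if k is k'.+1 then
    forall i, (forall x, derivable f x (delta_mx ord0 i)) /\
              is_Ck k' (partial i f)
  else True.

Definition smooth f : Prop := forall k, is_Ck k f.

Definition supp f : set 'rV[R]_n := closure [set x | f x != 0].

(* C_c^oo(U) for an open set U; its elements are identified with their
   extension by zero to the whole space. *)
Definition Ccoo (U : set 'rV[R]_n) : set ('rV[R]_n -> R) :=
  [set f | [/\ smooth f, compact (supp f) & supp f `<=` U]].

Definition grad f x : 'rV[R]_n := \row_i partial i f x.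

Definition hessian f x : 'M[R]_n := \matrix_(i, j) partial i (partial j f) x.

(* The Hessian of f at x applied to the vector v, transposed since vectors are
   rows. *)
Definition hessian_app f x (v : 'rV[R]_n) : 'rV[R]_n :=
  (hessian f x *m v^T)^T.

Definition dotv (u v : 'rV[R]_n) : R := \sum_i u ord0 i * v ord0 i.

Definition sqnorm (v : 'rV[R]_n) : R := dotv v v.

End smooth_functions.

Section wasserstein.
Context {R : realType} {n : nat}.
Local Notation Rn := 'rV[R]_n.
Implicit Types (mu : probability Rn R) (V W : Rn -> Rn).

Definition has_density mu (rho : Rn -> R) : Prop :=
  forall A, measurable A -> mu A = (\int[lebesgue_rV n]_(x in A) (rho x)%:E)%E.

Definition finite_second_moment mu : Prop :=
  (\int[mu]_x (sqnorm x)%:E < +oo)%E.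

Definition L2_field mu V : Prop :=
  measurable_fun setT V /\ (\int[mu]_x (sqnorm (V x))%:E < +oo)%E.

(* mu and nu are plain set functions so that the definitions apply directly to
   exp_map mu V, whose probability-measure structure depends on the
   measurability of V. *)
Definition coupling (mu nu : set Rn -> \bar R) :
    set (probability (Rn * Rn)%type R) :=
  [set pi | forall A, measurable A ->
    pi (A `*` setT) = mu A /\ pi (setT `*` A) = nu A].

Definition wasserstein2 (mu nu : set Rn -> \bar R) : \bar R :=
  sqrte (ereal_inf
    [set (\int[pi]_z (sqnorm (z.1 - z.2))%:E)%E | pi in coupling mu nu]).

Definition exp_map mu V : set Rn -> \bar R := pushforward mu (fun x => x + V x).

Definition Lambda mu V W : R :=
  (\int[mu]_x sqnorm (V x)) * (\int[mu]_x sqnorm (W x))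
  - (\int[mu]_x dotv (V x) (W x)) ^+ 2.

Definition sec_quotient mu V W (s t : R) : R :=
  3 / (Lambda mu V W * s ^+ 2 * t ^+ 2) *
  (\int[mu]_x sqnorm (s *: V x - t *: W x)
   - fine (wasserstein2 (exp_map mu (fun x => s *: V x))
                        (exp_map mu (fun x => t *: W x))) ^+ 2).

(* Sec_mu(V, W) = L; the first four clauses say that Sec_mu(V, W) makes sense. *)
Definition is_Sec mu V W (L : R) : Prop :=
  [/\ finite_second_moment mu, L2_field mu V, L2_field mu W,
      0 < Lambda mu V W &
      forall s t : R^nat,
        (forall j, 0 < s j) -> (forall j, 0 < t j) ->
        s @ \oo --> (0 : R) -> t @ \oo --> (0 : R) ->
        has_ubound (range (fun j => s j / t j + t j / s j)) ->
        sec_quotient mu V W (s j) (t j) @[j --> \oo] --> L].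

End wasserstein.

(* Main.v *)
Require Import Defs.
From HB Require Import structures.
From mathcomp Require Import all_boot all_order all_algebra.
From mathcomp Require Import all_classical all_reals all_analysis.
From mathcomp Require Import ring lra measurable_realfun.

(* With eps = st, S = id + s grad phi and T = id + t grad psi, couplings of
   exp_mu(s grad phi) and exp_mu(t grad psi) are images under S x T of
   self-couplings gamma of mu, and Taylor expansion gives, up to a relative
   error O(s + t) on the first term,
     cost(gamma) = int |s grad phi - t grad psi|^2 dmu
                   + int |y - x|^2 dgamma - 2 eps int <F(x), y - x> dgamma
   with F = hess psi (grad phi). So the curvature is governed by the supremum of
   2 eps int <F(x), y - x> dgamma - int |y - x|^2 dgamma over self-couplings.

   Upper bound: F may be replaced by F - grad eta because gradients have almost
   no correlation with the displacement of a self-coupling; then use Young's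
   inequality.

   Lower bound: mu-divergence-free fields can be realized by self-couplings.
   Instead of solving an ODE, take a smooth partition of unity theta_i of mesh
   delta and let Z = F - grad eta be the residual of the projection of F on the
   span of the grad(theta_i theta_j). Then
   B_ij = int theta_i <Z, grad theta_j> dmu is antisymmetric with vanishing row
   sums, so that |B_ij| + B_ij are the rates of a jump chain for which the masses
   p_i = int theta_i dmu are stationary. Its law M at time eps, spread out as
   sum_ij M_ij / (p_i p_j) theta_i(x) theta_j(y) mu(dx) mu(dy), is an exact
   self-coupling with drift eps Z; the diffusive part of the chain has energy
   O(delta) and vanishes in the limit delta -> 0 with eps fixed. *)

Set Implicit Arguments.
Unset Strict Implicit.
Unset Printing Implicit Defensive.

Import Order.TTheory GRing.Theory Num.Theory.
Import numFieldNormedType.Exports.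

Local Open Scope classical_set_scope.
Local Open Scope ring_scope.

(** * Jump chains with an antisymmetric drift *)

(** The lower bound needs two sharp constants at once: a correlation with F of eps times the
    integral of |Z|^2, and a squared displacement of only eps^2 times it, so that 2 - 1 leaves
    exactly one copy. A jump chain endangers the second one, because it also diffuses. Three choices
    remedy this. Since the cells reproduce affine functions, each coordinate drifts exactly with
    that coordinate of Z, and the squared speeds add up to the integral of |Z|^2. The mean squared
    displacement obeys a recursion driven by its own square root, so it grows quadratically in time,
    not linearly. The remaining cross energy between an observable and its evolution is split by
    Young's inequality with weight [kappa]: one part is absorbed by the dissipation of the chain and
    costs [kappa] times a bounded quantity in total; the other is [kappa^-1] times the energy of a
    Lipschitz function, which is O(delta). This dictates the order of choice: the error [r], then
    [kappa], then [delta]. As Z changes with delta, all constants must be controlled by F alone,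
    which Pythagoras permits. *)

Section jump_chain.
Variables (R : realFieldType) (I : finType) (p : I -> R) (B : I -> I -> R).
Hypothesis p_ge0 : forall i, 0 <= p i.
Hypothesis B_anti : forall i j, B i j = - B j i.
Hypothesis B_row : forall i, \sum_j B i j = 0.
Hypothesis B_p0 : forall i j, p i = 0 -> B i j = 0.

(** Twice the positive part of [B]: the mass flowing from i to j per unit time. Its symmetric part
    [|B|] acts as diffusion, its antisymmetric part [B] as drift. *)
Let J i j : R := `|B i j| + B i j.
Definition chain_dot (f g : I -> R) : R := \sum_i p i * (f i * g i).
Definition chain_energy (f g : I -> R) : R :=
  \sum_i \sum_j `|B i j| * ((f i - f j) * (g i - g j)).
Definition chain_drift (f g : I -> R) : R := \sum_i \sum_j B i j * (f i * g j).
Local Notation "<< f , g >>" := (chain_dot f g).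
Local Notation E := chain_energy.
Local Notation A := chain_drift.

(** Explicit Euler step for the backward equation with rates [J i j / p i]; iterating it replaces
    the exponential of the generator. Where [p i = 0] the inverse is 0 and the step leaves [u i]
    unchanged. *)
Definition chain_step (h : R) (u : I -> R) : I -> R :=
  fun i => u i + h * (\sum_j J i j * (u j - u i)) / p i.

Let J_ge0 i j : 0 <= J i j.
Proof. by rewrite /J; have := ler_norm (- B i j); rewrite normrN; lra. Qed.

Let J_p0 i j : p i = 0 -> J i j = 0.
Proof. by move=> p0; rewrite /J B_p0// normr0 addr0. Qed.

Let normB i j : `|B i j| = `|B j i|.
Proof. by rewrite B_anti normrN. Qed.

Let sum_swap (F : I -> I -> R) : \sum_i \sum_j F i j = \sum_i \sum_j F j i.
Proof. by rewrite exchange_big. Qed.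

Lemma chain_driftC f g : A f g = - A g f.
Proof.
rewrite /chain_drift sum_swap -sumrN; apply: eq_bigr => i _.
rewrite -sumrN; apply: eq_bigr => j _; rewrite B_anti; ring.
Qed.

Lemma chain_drift_diag f : A f f = 0.
Proof. by have := chain_driftC f f; lra. Qed.

Lemma chain_driftBr f g1 g2 :
  A f (fun i => g1 i - g2 i) = A f g1 - A f g2.
Proof.
rewrite /chain_drift -sumrB; apply: eq_bigr => i _.
by rewrite -sumrB; apply: eq_bigr => j _; ring.
Qed.

Let stepE h u i : p i * chain_step h u i =
  p i * u i + h * \sum_j J i j * (u j - u i).
Proof.
rewrite /chain_step; have [p0|p0] := eqVneq (p i) 0.
  rewrite p0 !mul0r add0r big1 ?mulr0// => j _; rewrite J_p0// mul0r//.
by field.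
Qed.

(** Summation by parts: symmetrizing the [|B|] part in i and j gives the Dirichlet form with the
    factor 1/2, and in the [B] part the terms with [u i] drop because the rows sum to 0. *)
Let flux_split g u : \sum_i \sum_j g i * (J i j * (u j - u i)) =
  - (1/2) * E g u + A g u.
Proof.
rewrite /E /A.
have H1 : \sum_i \sum_j `|B i j| * (g i * (u j - u i)) =
   - (1/2) * \sum_i \sum_j `|B i j| * ((g i - g j) * (u i - u j)).
  set S := LHS.
  have SE : S = \sum_i \sum_j `|B i j| * (g j * (u i - u j)).
    rewrite /S sum_swap; apply: eq_bigr => i _; apply: eq_bigr => j _.
    by rewrite normB.
  have : S + S = - \sum_i \sum_j `|B i j| * ((g i - g j) * (u i - u j)).
    rewrite {2}SE /S -big_split -sumrN; apply: eq_bigr => i _.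
    rewrite -big_split -sumrN; apply: eq_bigr => j _ /=; ring.
  lra.
have H2 : \sum_i \sum_j B i j * (g i * u j) =
    \sum_i \sum_j B i j * (g i * (u j - u i)).
  apply: eq_bigr => i _; transitivity
    (\sum_j B i j * (g i * u j) - (\sum_j B i j) * (g i * u i)).
    by rewrite B_row mul0r subr0.
  by rewrite mulr_suml -sumrB; apply: eq_bigr => j _; ring.
rewrite -H1 H2 -big_split; apply: eq_bigr => i _.
by rewrite -big_split; apply: eq_bigr => j _ /=; rewrite /J; ring.
Qed.

Let step_dot h g u : << g, chain_step h u >> - << g, u >> =
  h * (- (1/2) * E g u + A g u).
Proof.
rewrite -flux_split /chain_dot -sumrB mulr_sumr; apply: eq_bigr => i _.
rewrite (_ : p i * (g i * chain_step h u i) =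
   g i * (p i * chain_step h u i)); last by ring.
rewrite stepE mulrDr mulr_sumr.
rewrite (_ : g i * (p i * u i) = p i * (g i * u i)); last by ring.
rewrite addrAC subrr add0r !mulr_sumr; apply: eq_bigr => j _; ring.
Qed.

(** The [B] part of [J] is odd under exchange of i and j, whereas the squared difference is even. *)
Let energyE u : \sum_i \sum_j J i j * (u j - u i) ^+ 2 = E u u.
Proof.
transitivity (E u u + \sum_i \sum_j B i j * (u j - u i) ^+ 2).
  rewrite /E -big_split; apply: eq_bigr => i _.
  by rewrite -big_split; apply: eq_bigr => j _ /=; rewrite /J; ring.
rewrite -[RHS]addr0; congr (_ + _); set S := LHS.
have : S = - S.
  rewrite {1}/S sum_swap -sumrN; apply: eq_bigr => i _.
  rewrite -sumrN; apply: eq_bigr => j _; rewrite B_anti; ring.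
lra.
Qed.

(** Lagrange's identity: the defect is half the double sum of [w i * w j * (x i - x j) ^+ 2]. *)
Lemma sqr_sum_le (w x : I -> R) : (forall i, 0 <= w i) ->
  (\sum_i w i * x i) ^+ 2 <= (\sum_i w i) * (\sum_i w i * x i ^+ 2).
Proof.
move=> w0.
have : 0 <= \sum_i \sum_j w i * w j * (x i - x j) ^+ 2.
  apply: sumr_ge0 => i _; apply: sumr_ge0 => j _;
  by rewrite mulr_ge0 ?sqr_ge0 ?mulr_ge0.
suff -> : \sum_i \sum_j w i * w j * (x i - x j) ^+ 2 =
   ((\sum_i w i) * (\sum_i w i * x i ^+ 2) - (\sum_i w i * x i) ^+ 2) * 2 by lra.
have -> : ((\sum_i w i) * (\sum_i w i * x i ^+ 2) - (\sum_i w i * x i) ^+ 2) * 2 =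
  \sum_i \sum_j (w i * (w j * x j ^+ 2)) + \sum_i \sum_j (w j * (w i * x i ^+ 2))
  - 2 * \sum_i \sum_j ((w i * x i) * (w j * x j)).
  rewrite -(sum_swap (fun i j => w i * (w j * x j ^+ 2))).
  rewrite expr2 !big_distrlr /=; ring.
rewrite mulr_sumr -big_split -sumrB; apply: eq_bigr => i _ /=.
rewrite mulr_sumr -big_split -sumrB; apply: eq_bigr => j _ /=; ring.
Qed.

(** * Euler steps: dissipation, pair law, displacement and correlation *)

Section time_step.
Variable h : R.
Hypothesis h_ge0 : 0 <= h.
Hypothesis h_small : forall i, 2 * h * (\sum_j J i j) <= p i.

(** In the expansion of the square the term linear in [h] is [- h * E u u]; Cauchy-Schwarz and
    [h_small] show that the term quadratic in [h] gives back at most half of it. *)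
Lemma chain_step_dissip u :
  << chain_step h u, chain_step h u >> <= << u, u >> - h / 2 * E u u.
Proof.
pose S i := \sum_j J i j * (u j - u i).
pose Q i := \sum_j J i j * (u j - u i) ^+ 2.
have SQ i : S i ^+ 2 <= (\sum_j J i j) * Q i by apply: sqr_sum_le => j.
have Q0 i : 0 <= Q i by apply: sumr_ge0 => j _; rewrite mulr_ge0 ?sqr_ge0.
have le1 i : p i * (chain_step h u i * chain_step h u i) <=
   p i * (u i * u i) + 2 * h * (u i * S i) + h / 2 * Q i.
  have [p0|p0] := eqVneq (p i) 0.
    rewrite p0 !mul0r add0r (_ : S i = 0).
      by rewrite !mulr0 add0r mulr_ge0// divr_ge0.
    by rewrite /S big1 // => j _; rewrite J_p0 // mul0r.
  have pp : 0 < p i by rewrite lt_neqAle eq_sym p0 p_ge0.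
  rewrite -(ler_pM2l pp).
  have -> : p i * (p i * (chain_step h u i * chain_step h u i)) =
    (p i * chain_step h u i) ^+ 2 by ring.
  rewrite stepE -/(S i).
  have H1 : h * h * S i ^+ 2 <= h * h * ((\sum_j J i j) * Q i).
    by apply: ler_wpM2l; rewrite ?mulr_ge0.
  have H2 : h / 2 * Q i * (2 * h * \sum_j J i j) <= h / 2 * Q i * p i.
    by apply: ler_wpM2l; rewrite ?mulr_ge0 ?divr_ge0.
  nra.
apply: le_trans (ler_sum _ (fun i _ => le1 i)) _.
rewrite !big_split/= -!mulr_sumr energyE.
have -> : \sum_i u i * S i = - (1/2) * E u u + A u u.
  rewrite -flux_split; apply: eq_bigr => i _; by rewrite mulr_sumr.
rewrite chain_drift_diag /chain_dot; lra.
Qed.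

Let step_ge0 u : (forall i, 0 <= u i) -> forall i, 0 <= chain_step h u i.
Proof.
move=> u0 i; have [p0|p0] := eqVneq (p i) 0.
  by rewrite /chain_step p0 invr0 mulr0 addr0.
have pp : 0 < p i by rewrite lt_neqAle eq_sym p0 p_ge0.
rewrite -(pmulr_rge0 _ pp) stepE.
have -> : \sum_j J i j * (u j - u i) = \sum_j J i j * u j - (\sum_j J i j) * u i.
  by rewrite mulr_suml -sumrB; apply: eq_bigr => j _; ring.
have H1 : 0 <= h * (\sum_j J i j * u j).
  by rewrite mulr_ge0// sumr_ge0// => j _; rewrite mulr_ge0.
have H2 : h * (\sum_j J i j) * u i <= p i * u i.
  apply: ler_wpM2r => //; apply: le_trans (h_small i).
  have : 0 <= h * (\sum_j J i j) by rewrite mulr_ge0// sumr_ge0.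
  lra.
lra.
Qed.

Let step_lin (c : I -> R) (v : I -> I -> R) :
  chain_step h (fun k => \sum_j c j * v j k) =
  (fun k => \sum_j c j * chain_step h (v j) k).
Proof.
apply/funext => k; rewrite /chain_step.
under [RHS]eq_bigr do rewrite mulrDr.
rewrite big_split /=; congr (_ + _).
under [RHS]eq_bigr => j _ do rewrite (mulrA (c j)) (mulrCA (c j)) -!mulrA.
rewrite -mulr_sumr -!mulrA; congr (_ * _).
under [RHS]eq_bigr do rewrite mulrA.
rewrite -mulr_suml; congr (_ * _).
under [RHS]eq_bigr do rewrite mulr_sumr.
rewrite exchange_big; apply: eq_bigr => l _ /=.
rewrite -sumrB mulr_sumr; apply: eq_bigr => j _; ring.
Qed.

Let iter_lin k (c : I -> R) (v : I -> I -> R) :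
  iter k (chain_step h) (fun l => \sum_j c j * v j l) =
  (fun l => \sum_j c j * iter k (chain_step h) (v j) l).
Proof. by elim: k => //= k ->; rewrite step_lin. Qed.

Let step_cst c : chain_step h (fun=> c) = fun=> c.
Proof.
apply/funext => i; rewrite /chain_step big1 ?mulr0 ?mul0r ?addr0//.
by move=> j _; rewrite subrr mulr0.
Qed.

Let step_stationary u : \sum_i p i * chain_step h u i = \sum_i p i * u i.
Proof.
have := step_dot h (fun=> 1) u; rewrite /chain_dot.
have -> : E (fun=> 1) u = 0.
  by rewrite /E big1// => i _; rewrite big1// => j _; rewrite subrr mul0r mulr0.
have -> : A (fun=> 1) u = 0.
  rewrite chain_driftC /A big1 ?oppr0// => i _.
  transitivity ((\sum_j B i j) * u i); last by rewrite B_row mul0r.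
  by rewrite mulr_suml; apply: eq_bigr => j _; ring.
under eq_bigr do rewrite mul1r.
under [X in _ - X]eq_bigr do rewrite mul1r.
lra.
Qed.

(** [M i j] is the stationary probability of starting in i and being in j after k steps, that is,
    [p i] times the transition probability. The column sums express the stationarity of [p]. *)
Lemma chain_kernel k : exists M : I -> I -> R,
  [/\ forall i j, 0 <= M i j, forall i, \sum_j M i j = p i,
      forall j, \sum_i M i j = p j &
      forall f i, \sum_j M i j * f j = p i * iter k (chain_step h) f i].
Proof.
pose delta j : I -> R := fun l => (j == l)%:R.
have deltaE (f : I -> R) : f = fun l => \sum_j f j * delta j l.
  apply/funext => l; rewrite (bigD1 l)//= big1 /delta ?eqxx ?mulr1 ?addr0//.
  by move=> j /negPf ->; rewrite mulr0.
exists (fun i j => p i * iter k (chain_step h) (delta j) i); split.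
- move=> i j; rewrite mulr_ge0//; elim: k i => [|k IH] i /=; first exact: ler0n.
  exact: step_ge0.
- move=> i; rewrite -mulr_sumr -[RHS]mulr1; congr (_ * _).
  have : iter k (chain_step h) (fun=> 1) i = 1.
    suff -> : iter k (chain_step h) (fun=> 1) = fun=> 1 by [].
    by elim: k => //= k ->; rewrite step_cst.
  rewrite {1}(deltaE (fun=> 1)) iter_lin => H1.
  by rewrite -[RHS]H1; apply: eq_bigr => j _; rewrite mul1r.
- move=> j; elim: k => [|k IH] /=; last by rewrite step_stationary.
  rewrite (bigD1 j)//= big1 /delta ?eqxx ?mulr1 ?addr0//.
  by move=> i /negPf; rewrite eq_sym => ->; rewrite mulr0.
- move=> f i; rewrite {2}(deltaE f) iter_lin mulr_sumr.
  by apply: eq_bigr => j _; ring.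
Qed.

Variables (f : I -> R) (a r kappa e : R).
Hypotheses (a_ge0 : 0 <= a) (r_ge0 : 0 <= r) (kappa_gt0 : 0 < kappa).
Hypothesis drift_f : forall v, A v f ^+ 2 <= a ^+ 2 * << v, v >>.
Let u k := iter k (chain_step h) f.
Let w k i := u k i - f i.

Let energy_le g v : E g v <= kappa * E v v + kappa^-1 * E g g.
Proof.
rewrite /E !mulr_sumr -big_split; apply: ler_sum => i _ /=.
rewrite !mulr_sumr -big_split; apply: ler_sum => j _ /=.
set x := g i - g j; set y := v i - v j.
have -> : kappa * (`|B i j| * (y * y)) + kappa^-1 * (`|B i j| * (x * x)) =
  `|B i j| * (kappa * (y * y) + kappa^-1 * (x * x)) by ring.
apply: ler_wpM2l => //.
have k0 : kappa^-1 > 0 by rewrite invr_gt0.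
have H : 0 <= kappa^-1 * (x - kappa * y) ^+ 2 by rewrite mulr_ge0 ?sqr_ge0 ?ltW.
have H' : kappa^-1 * (x - kappa * y) ^+ 2 =
   kappa^-1 * (x * x) - 2 * (x * y) + kappa * (y * y).
  by field; rewrite gt_eqF.
have H2 : 0 <= kappa^-1 * (x + kappa * y) ^+ 2 by rewrite mulr_ge0 ?sqr_ge0 ?ltW.
have H2' : kappa^-1 * (x + kappa * y) ^+ 2 =
   kappa^-1 * (x * x) + 2 * (x * y) + kappa * (y * y).
  by field; rewrite gt_eqF.
lra.
Qed.

Let energy_ge0 v : 0 <= E v v.
Proof.
by apply: sumr_ge0 => i _; apply: sumr_ge0 => j _; rewrite mulr_ge0// -expr2 sqr_ge0.
Qed.

Let dot_ge0 v : 0 <= << v, v >>.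
Proof. by apply: sumr_ge0 => i _; rewrite mulr_ge0// -expr2 sqr_ge0. Qed.

Let iter_contr k : << u k, u k >> <= << f, f >>.
Proof.
elim: k => [//|k IH]; apply: le_trans (chain_step_dissip _) _.
have : 0 <= h / 2 * E (u k) (u k) by rewrite mulr_ge0// divr_ge0.
rewrite /u in IH *; lra.
Qed.

Let dotBB v1 v2 : << fun i => v1 i - v2 i, fun i => v1 i - v2 i >> =
  << v1, v1 >> - 2 * << v2, v1 >> + << v2, v2 >>.
Proof.
rewrite /chain_dot mulr_sumr -sumrB -big_split; apply: eq_bigr => i _ /=; ring.
Qed.

(** The mean squared displacement of [f] under the pair law of [chain_kernel]: both marginals are
    [p], so the two squares contribute [<< f, f >>] each. By contraction it also dominates the
    square norm of [w k]. *)
Let D k := 2 * (<< f, f >> - << f, u k >>).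

Let w_le k : << w k, w k >> <= D k.
Proof. by rewrite /w dotBB /D; have := iter_contr k; lra. Qed.

Let drift_w g b k q : 0 <= b -> 0 <= q ->
  (forall v, A v g ^+ 2 <= b ^+ 2 * << v, v >>) -> D k <= q ^+ 2 ->
  `|A (w k) g| <= b * q.
Proof.
move=> b0 q0 bg Dq; rewrite -(@ler_pXn2r _ 2)// ?nnegrE ?mulr_ge0//.
rewrite -normrX ger0_norm ?sqr_ge0//.
apply: le_trans (bg _) _; rewrite exprMn; apply: ler_wpM2l; rewrite ?sqr_ge0//.
exact: le_trans (w_le _) Dq.
Qed.

Variables (N : nat).
Hypothesis r_large : 2 * kappa * << f, f >> + kappa^-1 * (h * N%:R) * E f f <= r ^+ 2.
Let q k := r + a * (h * k%:R).

Let q_ge0 k : 0 <= q k.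
Proof. by rewrite addr_ge0 ?mulr_ge0. Qed.

Let kh_le k : (k <= N)%N -> h * k%:R <= h * N%:R.
Proof. by move=> kN; rewrite ler_wpM2l// ler_nat. Qed.

Let q_le k : (k <= N)%N -> q k <= q N.
Proof. by move=> kN; rewrite lerD2l ler_wpM2l// kh_le. Qed.

(** [D] grows by [h * E f (u k) + 2 * h * A (w k) f] in one step. The energy is paid by the
    dissipation, up to [kappa^-1 * h * E f f]. The drift acts on the displacement only, since
    [A f f = 0]; it is at most [a * q k], and [2 * h * a * q k] fits into
    [q k.+1 ^+ 2 - q k ^+ 2]. *)
Let D_bound k : (k <= N)%N -> D k <= 2 * kappa * (<< f, f >> - << u k, u k >>)
  + kappa^-1 * (h * k%:R) * E f f + (q k ^+ 2 - r ^+ 2).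
Proof.
elim: k => [_|k IH kN].
  by rewrite /D /u /q /= !mulr0 !(mulr0, addr0, subrr, mul0r).
have {}IH := IH (ltnW kN).
have Dq : D k <= q k ^+ 2.
  have H1 : 2 * kappa * << u k, u k >> >= 0 by rewrite !mulr_ge0// ltW.
  have H2 : kappa^-1 * (h * k%:R) * E f f <= kappa^-1 * (h * N%:R) * E f f.
    rewrite ler_wpM2r// ler_wpM2l// ?invr_ge0 ?(ltW kappa_gt0)//.
    exact/kh_le/ltnW.
  have H3 := r_large; lra.
have HA := drift_w a_ge0 (q_ge0 k) drift_f Dq.
have := ler_norm (A (w k) f) => HA1.
have dis := chain_step_dissip (u k).
have := step_dot h f (u k).
have -> : A f (u k) = - A (w k) f.
  rewrite -chain_driftC chain_driftBr chain_drift_diag; lra.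
rewrite -/(u k.+1) => Hs.
have HE : E f (u k) <= kappa * E (u k) (u k) + kappa^-1 * E f f by exact: energy_le.
have HE' : h * E f (u k) <= h * (kappa * E (u k) (u k) + kappa^-1 * E f f).
  by rewrite ler_wpM2l.
have HA' : h * A (w k) f <= h * (a * q k) by rewrite ler_wpM2l//; lra.
have qS : q k.+1 = q k + a * h by rewrite /q -natr1; ring.
have dis' : kappa * << u k.+1, u k.+1 >> <=
   kappa * (<< u k, u k >> - h / 2 * E (u k) (u k)) by rewrite ler_wpM2l// ltW.
have sq : 0 <= (a * h) ^+ 2 by rewrite sqr_ge0.
rewrite qS -natr1.
have DS : D k.+1 = D k - 2 * (<< f, u k.+1 >> - << f, u k >>) by rewrite /D; ring.
rewrite DS Hs; nra.
Qed.

Let D_le k : (k <= N)%N -> D k <= q k ^+ 2.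
Proof.
move=> kN; have := D_bound kN.
have H1 : 2 * kappa * << u k, u k >> >= 0 by rewrite !mulr_ge0// ltW.
have H2 : kappa^-1 * (h * k%:R) * E f f <= kappa^-1 * (h * N%:R) * E f f.
  by rewrite ler_wpM2r// ler_wpM2l// ?invr_ge0 ?(ltW kappa_gt0)// kh_le.
have H3 := r_large; lra.
Qed.

Lemma chain_displacement :
  2 * (<< f, f >> - << f, iter N (chain_step h) f >>) <=
  (r + a * (h * N%:R)) ^+ 2.
Proof. exact: D_le. Qed.

(** [<< g, u k >>] grows by [h * A g f], up to [h * A (w k) g] and half of [h * E g (u k)]. The
    first error is controlled by the displacement bound, hence is of second order in time up to [r];
    the second is absorbed by the dissipation as before. *)
Lemma chain_correlation g b : 0 <= b ->
  (forall v, A v g ^+ 2 <= b ^+ 2 * << v, v >>) ->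
  2 * kappa * << f, f >> + kappa^-1 * (h * N%:R) * E g g <= r ^+ 2 ->
  `|<< g, iter N (chain_step h) f >> - << g, f >> - h * N%:R * A g f| <=
  r ^+ 2 + h * N%:R * (b * (r + a * (h * N%:R))).
Proof.
move=> b0 bg rg.
suff H k : (k <= N)%N -> `|<< g, u k >> - << g, f >> - h * k%:R * A g f| <=
  kappa * (<< f, f >> - << u k, u k >>) + kappa^-1 * (h * k%:R) * E g g +
   h * k%:R * (b * q N).
  apply: le_trans (H N (leqnn N)) _; rewrite -/(q N).
  have H1 : kappa * << u N, u N >> >= 0 by rewrite !mulr_ge0// ltW.
  have H2 : kappa * << f, f >> >= 0 by rewrite !mulr_ge0// ltW.
  lra.
elim: k => [_|k IH kN].
  by rewrite /u /= !(mulr0,mul0r,subrr,addr0) normr0.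
have {}IH := IH (ltnW kN).
have HA := drift_w b0 (q_ge0 k) bg (D_le (ltnW kN)).
have {}HA : `|A (w k) g| <= b * q N.
  by apply: le_trans HA _; rewrite ler_wpM2l// q_le// ltnW.
have := step_dot h g (u k); rewrite -/(u k.+1) => Hs.
have gu : A g (u k) = A g f - A (w k) g.
  by rewrite (chain_driftC (w k)) opprK chain_driftBr; ring.
have HE1 : E g (u k) <= kappa * E (u k) (u k) + kappa^-1 * E g g by exact: energy_le.
have HE2 : - E g (u k) <= kappa * E (u k) (u k) + kappa^-1 * E g g.
  have := energy_le (fun i => - g i) (u k).
  have -> : E (fun i => - g i) (u k) = - E g (u k).
    rewrite /E -sumrN; apply: eq_bigr => i _.
    rewrite -sumrN; apply: eq_bigr => j _; ring.
  have -> : E (fun i => - g i) (fun i => - g i) = E g g.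
    by rewrite /E; apply: eq_bigr => i _; apply: eq_bigr => j _; ring.
  by [].
have dis := chain_step_dissip (u k).
have dis' : kappa * << u k.+1, u k.+1 >> <=
   kappa * (<< u k, u k >> - h / 2 * E (u k) (u k)) by rewrite ler_wpM2l// ltW.
have Egg : 0 <= kappa^-1 * E g g by rewrite mulr_ge0 ?energy_ge0// invr_ge0 ltW.
have hEgg : 0 <= h * (kappa^-1 * E g g) by rewrite mulr_ge0.
have HE1' : h * E g (u k) <= h * (kappa * E (u k) (u k) + kappa^-1 * E g g).
  by rewrite ler_wpM2l.
have HE2' : h * - E g (u k) <= h * (kappa * E (u k) (u k) + kappa^-1 * E g g).
  by rewrite ler_wpM2l.
have /ler_normlP[HA1 HA2] : `|h * A (w k) g| <= h * (b * q N).
  by rewrite normrM ger0_norm// ler_wpM2l.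
move: IH => /ler_normlP[IH1 IH2].
have -> : << g, u k.+1 >> = << g, u k >> + h * (- (1/2) * E g (u k) + A g (u k)).
  by rewrite -Hs; ring.
rewrite gu -[k.+1%:R]natr1; apply/ler_normlP; split; lra.
Qed.

End time_step.

End jump_chain.

(** * Smooth functions of one variable *)

Section one_variable.
Context {R : realType}.
Implicit Types (f g : R -> R) (x y : R).

Fixpoint Ck1 (k : nat) g : Prop :=
  if k is k'.+1 then
    exists2 g', forall x, is_derive x 1 g (g' x) & Ck1 k' g'
  else continuous g.

Lemma is_derive_continuous g g' : (forall x, is_derive x 1 g (g' x)) -> continuous g.
Proof.
move=> dg x; apply: differentiable_continuous; apply/derivable1_diffP.
by have [] := dg x.
Qed.

Lemma Ck1_continuous k g : Ck1 k g -> continuous g.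
Proof. by case: k => [//|k [g' dg _]]; exact: is_derive_continuous dg. Qed.

Lemma Ck1S k g : Ck1 k.+1 g -> Ck1 k g.
Proof.
elim: k g => [|k IH] g; first exact: Ck1_continuous.
by move=> [g' dg g'k]; exists g' => //; exact: IH.
Qed.

Lemma Ck1_cst k (c : R) : Ck1 k (fun=> c).
Proof.
elim: k c => [|k IH] c; first exact: cst_continuous.
by exists (fun=> 0) => // x; exact: is_derive_cst.
Qed.

Lemma Ck1D k f g : Ck1 k f -> Ck1 k g -> Ck1 k (fun x => f x + g x).
Proof.
elim: k f g => [|k IH] f g.
  by move=> cf cg x; apply: continuousD; [exact: cf|exact: cg].
move=> [f' df f'k] [g' dg g'k]; exists (fun x => f' x + g' x); last exact: IH.
by move=> x; exact: is_deriveD.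
Qed.

Lemma Ck1M k f g : Ck1 k f -> Ck1 k g -> Ck1 k (fun x => f x * g x).
Proof.
elim: k f g => [|k IH] f g.
  by move=> cf cg x; apply: continuousM; [exact: cf|exact: cg].
move=> fk gk; have := Ck1S fk; have := Ck1S gk.
move: fk gk => [f' df f'k] [g' dg g'k] gk fk.
exists (fun x => f x * g' x + g x * f' x); last by apply: Ck1D; exact: IH.
by move=> x; exact: is_deriveM.
Qed.

Lemma is_derive_affine g g' (a b : R) : (forall x, is_derive x 1 g (g' x)) ->
  forall x, is_derive x 1 (fun x => g (a * x + b)) (a * g' (a * x + b)).
Proof.
move=> dg x.
have daff : is_derive x 1 (fun x : R => a * x + b) a.
  have := @is_deriveD R R R (a \*: id) (cst b) x 1 _ _
    (@is_deriveZ R R R id a x 1 _ (is_derive_id x 1)) (is_derive_cst b x 1).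
  by rewrite addr0 scaler1.
have := @is_derive1_comp R g (fun x => a * x + b) x _ _ (dg _) daff.
by rewrite mulrC.
Qed.

Lemma Ck1_affine k g a b : Ck1 k g -> Ck1 k (fun x => g (a * x + b)).
Proof.
elim: k g => [|k IH] g.
  move=> cg x; apply: (@continuous_comp _ _ _ (fun x => a * x + b) g); last exact: cg.
  apply: continuousD; last exact: cst_continuous.
  by apply: continuousM; [exact: cst_continuous|exact: cvg_id].
move=> [g' dg g'k]; exists (fun x => a * g' (a * x + b)).
  exact: is_derive_affine.
by apply: Ck1M; [exact: Ck1_cst|exact: IH].
Qed.

(** The exponent [m] makes the family stable under differentiation up to linear combinations, so
    that smoothness follows by one induction for all members. *)
Definition flat m x : R := if 0 < x then x ^- m * expR (- x^-1) else 0.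

Lemma flat_ge0 m x : 0 <= flat m x.
Proof. by rewrite /flat; case: ifP => // x0; rewrite mulr_ge0 ?expR_ge0// invr_ge0 exprn_ge0// ltW. Qed.

(** Compare [expR x^-1] with the term of degree [m.+2] in its power series. The quadratic bound
    yields the derivative 0 at the gluing point. *)
Lemma flat_le_sqr m x : `|flat m x| <= (m.+2)`!%:R * x ^+ 2.
Proof.
rewrite ger0_norm ?flat_ge0// /flat; case: ifPn => [x0|_]; last first.
  by rewrite mulr_ge0 ?sqr_ge0.
have y0 : 0 <= x^-1 by rewrite invr_ge0 ltW.
have := expR_ge1Dxn m.+1 y0; set F := (m.+2)`!%:R => H.
have F0 : 0 < F :> R by rewrite ltr0n fact_gt0.
have He : x ^- m.+2 / F <= expR x^-1.
  by apply: le_trans H; rewrite -exprVn lerDr.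
rewrite expRN ler_pdivrMr ?expR_gt0//.
have -> : x ^- m = F * x ^+ 2 * (x ^- m.+2 / F).
  by rewrite -!exprVn !exprSr; field; rewrite !gt_eqF.
by rewrite ler_wpM2l// mulr_ge0 ?sqr_ge0 ?ltW.
Qed.

Lemma is_derive_sqr_bound g (C : R) : (forall x, `|g x| <= C * x ^+ 2) -> is_derive 0 (1:R) g 0.
Proof.
move=> gC.
have g0 : g 0 = 0 by apply/eqP; rewrite -normr_le0; have := gC 0; rewrite expr0n mulr0.
have C0 : 0 <= C by have := gC 1; rewrite expr1n mulr1; exact: le_trans.
suff H : h^-1 *: ((g \o shift 0) (h *: (1 : R)) - g 0) @[h --> 0^'] --> (0 : R).
  by apply: DeriveDef; [apply/cvg_ex; exists 0|exact/cvg_lim].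
apply/cvgr0Pnorm_lt => e e0; near=> h.
have h0 : h != 0 by near: h; exact: nbhs_dnbhs_neq.
rewrite g0 subr0 /= addr0 [h *: 1]mulr1 [_ *: _]/GRing.scale/= normrM normfV.
rewrite mulrC ltr_pdivrMr ?normr_gt0//; apply: le_lt_trans (gC _) _.
rewrite -real_normK ?num_real// expr2 mulrA ltr_pM2r ?normr_gt0//.
have C1 : 0 < C + 1 by rewrite ltr_wpDl.
apply: (@le_lt_trans _ _ ((C + 1) * `|h|)); first by rewrite ler_wpM2r// lerDl.
rewrite -ltr_pdivlMl// mulrC; near: h; apply: dnbhs0_lt.
by rewrite divr_gt0// ltr_wpDl.
Unshelve. all: by end_near. Qed.

Lemma is_derive_flat m x : is_derive x 1 (flat m) (flat m.+2 x - m%:R * flat m.+1 x).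
Proof.
have [x0|x0|->] := ltgtP x 0.
- apply: (@near_eq_is_derive _ _ _ (fun=> 0)).
  + near=> y; rewrite /flat ifN// -leNgt; near: y.
    by apply: filterS (lt_nbhsl x0) => y /ltW.
  + have := @is_derive_cst R R R 0 x 1.
    by rewrite /flat !ifN ?mulr0 ?subr0// -leNgt ltW.
- apply: (@near_eq_is_derive _ _ _ (fun y => y ^- m * expR (- y^-1))).
  + near=> y; rewrite /flat ifT//; near: y; exact: lt_nbhsr.
  + have xn0 : x != 0 by rewrite gt_eqF.
    have dV : is_derive x 1 (fun y : R => - y^-1) (x ^- 2).
      have := @is_deriveN R R R (fun y => y^-1) x 1 _
        (@is_deriveV R id x 1 1 xn0 (is_derive_id x 1)).
      by rewrite /= scaler1 opprK.
    have dE : is_derive x 1 (fun y : R => expR (- y^-1)) (x ^- 2 * expR (- x^-1)).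
      have := @is_derive1_comp R expR (fun y : R => - y^-1) x _ _
        (is_derive_expR _) dV.
      by rewrite mulrC.
    have dX : is_derive x 1 (fun y : R => y ^- m) (- m%:R * x ^- m.+1).
      have := @is_deriveV R (fun y => y ^+ m) x _ 1 (expf_neq0 m xn0)
        (DeriveDef (@exprn_derivable R m x 1) (exp_derive m x 1)).
      move/is_derive_eq; apply.
      rewrite /GRing.scale /= mulr1; case: m => [|m]; first by rewrite !mulr0n; ring.
      by rewrite /= !exprS; field; rewrite expf_neq0.
    have := @is_deriveM R R (fun y => y ^- m) (fun y => expR (- y^-1))
      x 1 _ _ dX dE.
    move/is_derive_eq; apply.
    by rewrite /flat x0 /GRing.scale/= -!exprVn !exprSr; ring.
- have := is_derive_sqr_bound (flat_le_sqr m).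
  by rewrite /flat ltxx mulr0 subr0.
Unshelve. all: by end_near. Qed.

Lemma Ck1_flat k m : Ck1 k (flat m).
Proof.
elim: k m => [|k IH] m; first exact: is_derive_continuous (is_derive_flat m).
exists (fun x => flat m.+2 x - m%:R * flat m.+1 x); first exact: is_derive_flat.
apply: Ck1D => //.
have -> : (fun x => - (m%:R * flat m.+1 x)) = (fun x => - m%:R * flat m.+1 x).
  by apply/funext => x; rewrite mulNr.
by apply: Ck1M => //; exact: Ck1_cst.
Qed.

Lemma antiderivative_from0 g : continuous g -> (forall x, x <= 0 -> g x = 0) ->
  exists2 G, forall x, is_derive x 1 G (g x) & forall x, x <= 0 -> G x = 0.
Proof.
(* Integrating from -1 changes nothing, as [g] vanishes up to 0, but makes 0 an interior point,
   where the fundamental theorem gives a two-sided derivative. *)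
move=> cg g0; pose G x := \int[lebesgue_measure]_(t in `[-1, x]) g t : R.
have G0 x : x <= 0 -> G x = 0.
  move=> x0; rewrite /G; under eq_Rintegral => t.
    rewrite inE /= in_itv /= => /andP[_ tx]; rewrite g0; last exact: le_trans x0.
    over.
  by rewrite Rintegral_cst// mul0r.
exists G => // x; have [x0|x0] := ltP x 0.
  apply: (@near_eq_is_derive _ _ _ (fun=> 0)).
    near=> y; rewrite G0//; near: y.
    by apply: filterS (lt_nbhsl x0) => y /ltW.
  by have := @is_derive_cst R R R 0 x 1; rewrite g0// ltW.
have [] := @continuous_FTC1_closed R g (-1) x (x + 1).
- by rewrite ltrDl.
- apply: continuous_compact_integrable; first exact: segment_compact.
  exact: continuous_subspaceT.
- by rewrite (lt_le_trans _ x0)// ltrN10.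
- exact: cg.
- by move=> dG; rewrite derive1E => <-; exact: DeriveDef.
Unshelve. all: by end_near. Qed.

Lemma derive_ge0_mono g g' : (forall x, is_derive x 1 g (g' x)) ->
  (forall x, 0 <= g' x) -> {homo g : x y / x <= y}.
Proof.
move=> dg g'0 x y; rewrite le_eqVlt => /predU1P[->//|xy].
have [c _ gE] := MVT xy (fun z _ => dg z)
  (continuous_subspaceT (is_derive_continuous dg)).
by rewrite -subr_ge0 gE mulr_ge0// subr_ge0 ltW.
Qed.

Lemma derive_eq0_cst g g' (a b : R) : (forall x, is_derive x 1 g (g' x)) ->
  a <= b -> (forall x, a < x < b -> g' x = 0) -> g b = g a.
Proof.
move=> dg; rewrite le_eqVlt => /predU1P[->//|xy] g'0.
have [c + gE] := MVT xy (fun z _ => dg z)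
  (continuous_subspaceT (is_derive_continuous dg)).
by rewrite in_itv /= => /g'0 gc; apply/eqP; rewrite -subr_eq0 gE gc mul0r.
Qed.

(* A smooth convex function with slope 0 before 0 and slope 1 after 1: its
   second differences form a smooth partition of unity which reproduces affine
   functions. *)
Lemma smooth_ramp : exists (tau sigma : R -> R) (m : R),
  [/\ forall k, Ck1 k tau, forall x, is_derive x 1 tau (sigma x),
      {homo sigma : x y / x <= y} &
      [/\ forall x, x <= 0 -> tau x = 0, forall x, x <= 0 -> sigma x = 0,
      forall x, 1 <= x -> tau x = x - m & forall x, 1 <= x -> sigma x = 1]].
Proof.
(* A bump living on (0, 1): [sigma] is its normalized primitive and [tau] the primitive of
   [sigma]. *)
pose b x := flat 0 x * flat 0 (-1 * x + 1).
have bk k : Ck1 k b.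
  by apply: Ck1M; [exact: Ck1_flat|apply: Ck1_affine; exact: Ck1_flat].
have b_ge0 x : 0 <= b x by rewrite mulr_ge0// flat_ge0.
have b0 x : x <= 0 -> b x = 0 by move=> x0; rewrite /b /flat ltNge x0 mul0r.
have b1 x : 1 <= x -> b x = 0.
  move=> x1; rewrite /b /flat; have -> : (0 < -1 * x + 1) = false by lra.
  by rewrite mulr0.
have [s ds s0] := antiderivative_from0 (bk 0%N) b0.
have s_mono := derive_ge0_mono ds b_ge0.
have s1 x : 1 <= x -> s x = s 1.
  by move=> x1; apply: (derive_eq0_cst ds x1) => y /andP[/ltW /b1].
have c_gt0 : 0 < s 1.
  have [c + sE] := MVT (@ltr01 R) (fun z _ => ds z)
    (continuous_subspaceT (is_derive_continuous ds)).
  rewrite in_itv /= => /andP[c0 c1].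
  have -> : s 1 = b c by rewrite -[s 1]subr0 -[X in _ - X](s0 0)// sE subr0 mulr1.
  rewrite /b /flat c0 ifT; last lra.
  by rewrite !expr0 !invr1 !mul1r mulr_gt0// expR_gt0.
pose sigma x := (s 1)^-1 * s x.
have dsigma x : is_derive x 1 sigma ((s 1)^-1 * b x).
  exact: (@is_deriveZ _ _ _ _ (s 1)^-1).
have sigma0 x : x <= 0 -> sigma x = 0 by move=> x0; rewrite /sigma (s0 x)// mulr0.
have sigma1 x : 1 <= x -> sigma x = 1.
  by move=> x1; rewrite /sigma (s1 x)// mulVf// gt_eqF.
have [tau dtau tau0] := antiderivative_from0 (is_derive_continuous dsigma) sigma0.
exists tau, sigma, (1 - tau 1); split=> //.
- case=> [|[|k]]; first exact: is_derive_continuous dtau.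
    by exists sigma => //; exact: is_derive_continuous dsigma.
  exists sigma => //; exists (fun x => (s 1)^-1 * b x) => //.
  by apply: Ck1M => //; exact: Ck1_cst.
- by move=> x y xy; rewrite /sigma ler_wpM2l ?invr_ge0 ?s_mono// ltW.
- split => // x x1.
  have d x' : is_derive x' 1 (fun x => tau x - x) (sigma x' - 1).
    by apply: is_deriveB; exact: is_derive_id.
  have := derive_eq0_cst d x1 => /(_ _)/= H; suff : tau x - x = tau 1 - 1 by lra.
  by apply: H => y /andP[/ltW y1 _]; rewrite sigma1// subrr.
Qed.

End one_variable.

(** * Smooth functions on R^n *)

Section smooth_closure.
Context {R : realType} {n : nat}.
Implicit Types (f g : 'rV[R]_n -> R) (x y u v : 'rV[R]_n).

Lemma derive_line f x v : 'D_1 (fun h : R => f (h *: v + x)) 0 = 'D_v f x.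
Proof.
rewrite /derive; set g1 := fun h => h^-1 *: _; set g2 := fun h => h^-1 *: _.
suff -> : g1 = g2 by [].
by rewrite funeqE /g1 /g2 => h /=; rewrite addr0 scale0r add0r [_%:A]mulr1.
Qed.

Lemma is_derive_line f x v (df : R) :
  is_derive (0 : R) 1 (fun h : R => f (h *: v + x)) df -> is_derive x v f df.
Proof.
by case=> d <-; rewrite (derive_line f x v); apply: DeriveDef => //; exact/derivable1P.
Qed.

Lemma derivable_line f x v (t : R) : derivable f (t *: v + x) v ->
  is_derive t 1 (fun h : R => f (h *: v + x)) ('D_v f (t *: v + x)).
Proof.
move=> /derivable1P d.
have shiftE : (fun h : R => f (h *: v + x)) =
    (fun h : R => f (h *: v + (t *: v + x))) \o (fun h => 1 * h + (- t)).
  by apply/funext => h /=; rewrite addrA -scalerDl mul1r subrK.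
have tE : (1 : R) * t + - t = 0 by rewrite mul1r subrr.
have d0 : is_derive (1 * t + - t) 1 (fun h : R => f (h *: v + (t *: v + x)))
    ('D_v f (t *: v + x)).
  by rewrite tE -derive_line; exact: derivableP.
have da : is_derive t 1 (fun h : R => 1 * h + - t) 1.
  have := @is_deriveD R R R (1 \*: id) (cst (- t)) t 1 _ _
    (@is_deriveZ R R R id 1 t 1 _ (is_derive_id t 1)) (is_derive_cst (- t) t 1).
  by rewrite addr0 scaler1.
rewrite shiftE -['D_v f _]mulr1.
exact: (@is_derive1_comp R _ (fun h : R => 1 * h + (- t)) t _ _ d0 da).
Qed.

Lemma is_Ck_continuous k f : is_Ck k f -> continuous f.
Proof. by case: k => [|k] []. Qed.

Lemma is_CkS k f : is_Ck k.+1 f -> is_Ck k f.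
Proof.
elim: k f => [|k IH] f [cf df]; first by split.
by split=> // i; have [? ?] := df i; split => //; exact: IH.
Qed.

Lemma is_Ck_partial k f i : is_Ck k.+1 f -> is_Ck k (partial i f).
Proof. by case=> _ /(_ i)[]. Qed.

Lemma is_Ck_is_derive k f i x : is_Ck k.+1 f ->
  is_derive x (delta_mx ord0 i) f (partial i f x).
Proof. by case=> _ /(_ i)[/(_ x) ? _]; exact: derivableP. Qed.

Lemma is_Ck_intro k f (df : 'I_n -> 'rV[R]_n -> R) : continuous f ->
  (forall i x, is_derive x (delta_mx ord0 i) f (df i x)) ->
  (forall i, is_Ck k (df i)) -> is_Ck k.+1 f.
Proof.
move=> cf dfE dfk; split => // i; split; first by move=> x; have [] := dfE i x.
suff -> : partial i f = df i by [].
by apply/funext => x; have [_] := dfE i x.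
Qed.

Lemma is_Ck_cst k (c : R) : is_Ck k (fun _ : 'rV[R]_n => c).
Proof.
elim: k c => [|k IH] c; first by split => //; exact: cst_continuous.
apply: (is_Ck_intro (df := fun _ _ => 0)) => //; first exact: cst_continuous.
Qed.

Lemma is_CkD k f g : is_Ck k f -> is_Ck k g -> is_Ck k (fun x => f x + g x).
Proof.
have cD f1 f2 : continuous f1 -> continuous f2 ->
    continuous (fun x : 'rV[R]_n => f1 x + f2 x : R).
  by move=> c1 c2 x; apply: continuousD; [exact: c1|exact: c2].
elim: k f g => [|k IH] f g fk gk.
  by split => //; apply: cD; apply: is_Ck_continuous; eassumption.
apply: (is_Ck_intro (df := fun i x => partial i f x + partial i g x)).
- by apply: cD; apply: is_Ck_continuous; eassumption.
- by move=> i x; apply: is_deriveD; apply: is_Ck_is_derive; eassumption.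
- by move=> i; apply: IH; exact: is_Ck_partial.
Qed.

Lemma is_CkM k f g : is_Ck k f -> is_Ck k g -> is_Ck k (fun x => f x * g x).
Proof.
have cM f1 f2 : continuous f1 -> continuous f2 ->
    continuous (fun x : 'rV[R]_n => f1 x * f2 x : R).
  by move=> c1 c2 x; apply: continuousM; [exact: c1|exact: c2].
elim: k f g => [|k IH] f g fk gk.
  by split => //; apply: cM; apply: is_Ck_continuous; eassumption.
apply: (is_Ck_intro (df := fun i x => f x * partial i g x + g x * partial i f x)).
- by apply: cM; apply: is_Ck_continuous; eassumption.
- by move=> i x; apply: is_deriveM; apply: is_Ck_is_derive; eassumption.
- by move=> i; apply: is_CkD; apply: IH;
    [exact: is_CkS|exact: is_Ck_partial|exact: is_CkS|exact: is_Ck_partial].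
Qed.

Lemma smooth_cst (c : R) : smooth (fun _ : 'rV[R]_n => c).
Proof. by move=> k; exact: is_Ck_cst. Qed.

Lemma smoothD f g : smooth f -> smooth g -> smooth (fun x => f x + g x).
Proof. by move=> fs gs k; exact: is_CkD. Qed.

Lemma smoothM f g : smooth f -> smooth g -> smooth (fun x => f x * g x).
Proof. by move=> fs gs k; exact: is_CkM. Qed.

Lemma smooth_partial f i : smooth f -> smooth (partial i f).
Proof. by move=> fs k; exact/is_Ck_partial/fs. Qed.

Lemma smooth_continuous f : smooth f -> continuous f.
Proof. by move=> fs; exact: is_Ck_continuous (fs 0%N). Qed.

Lemma smooth_is_derive f i x : smooth f ->
  is_derive x (delta_mx ord0 i) f (partial i f x).
Proof. by move=> fs; exact: is_Ck_is_derive (fs 1%N). Qed.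

Lemma partialE f i x (df : R) : is_derive x (delta_mx ord0 i) f df ->
  partial i f x = df.
Proof. by case. Qed.

Lemma partialD f g i x : smooth f -> smooth g ->
  partial i (fun x => f x + g x) x = partial i f x + partial i g x.
Proof.
by move=> fs gs; apply: partialE; apply: is_deriveD; exact: smooth_is_derive.
Qed.

Lemma partialM f g i x : smooth f -> smooth g ->
  partial i (fun x => f x * g x) x = f x * partial i g x + g x * partial i f x.
Proof.
by move=> fs gs; apply: partialE; apply: is_deriveM; exact: smooth_is_derive.
Qed.

Lemma partial_cst (c : R) i x : partial i (fun=> c) x = 0.
Proof. by apply: partialE; exact: is_derive_cst. Qed.

Lemma partialZ (c : R) f i x : smooth f ->
  partial i (fun x => c * f x) x = c * partial i f x.
Proof.
move=> fs; rewrite partialM ?partial_cst ?mulr0 ?addr0//.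
exact: smooth_cst.
Qed.

Lemma smooth_sum (I : Type) (r : seq I) (F : I -> 'rV[R]_n -> R) :
  (forall i, smooth (F i)) -> smooth (fun x => \sum_(i <- r) F i x).
Proof.
move=> Fs; elim: r => [|a r IH].
  by under eq_fun do rewrite big_nil; exact: smooth_cst.
by under eq_fun do rewrite big_cons; exact: smoothD.
Qed.

Lemma partial_sum (I : Type) (r : seq I) (F : I -> 'rV[R]_n -> R) i x :
  (forall i, smooth (F i)) ->
  partial i (fun x => \sum_(j <- r) F j x) x = \sum_(j <- r) partial i (F j) x.
Proof.
move=> Fs; elim: r => [|a r IH].
  by under eq_fun do rewrite big_nil; rewrite partial_cst big_nil.
under eq_fun do rewrite big_cons; rewrite partialD// ?IH ?big_cons//.
exact: smooth_sum.
Qed.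

Lemma smooth_prod (I : Type) (r : seq I) (F : I -> 'rV[R]_n -> R) :
  (forall i, smooth (F i)) -> smooth (fun x => \prod_(i <- r) F i x).
Proof.
move=> Fs; elim: r => [|a r IH].
  by under eq_fun do rewrite big_nil; exact: smooth_cst.
by under eq_fun do rewrite big_cons; exact: smoothM.
Qed.

Lemma is_derive_coord (g : R -> R) (dg : R) (d i : 'I_n) x :
  is_derive (x ord0 d) 1 g dg ->
  is_derive x (delta_mx ord0 i) (fun x => g (x ord0 d)) (dg * (i == d)%:R).
Proof.
move=> gd; apply: is_derive_line.
have -> : (fun h : R => g ((h *: delta_mx ord0 i + x) ord0 d)) =
   g \o (fun h => (i == d)%:R * h + x ord0 d).
  by apply/funext => h /=; rewrite !mxE eqxx/= eq_sym mulrC.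
have d1 : is_derive ((i == d)%:R * 0 + x ord0 d) 1 g dg by rewrite mulr0 add0r.
apply: (@is_derive1_comp R g (fun h => (i == d)%:R * h + x ord0 d) 0 _ _ d1).
have := @is_deriveD R R R ((i == d)%:R \*: id) (cst (x ord0 d)) 0 1 _ _
  (@is_deriveZ R R R id (i == d)%:R 0 1 _ (is_derive_id (0 : R) (1 : R)))
  (is_derive_cst (x ord0 d) (0 : R) (1 : R)).
by rewrite addr0 scaler1.
Qed.

Lemma is_Ck_coord k (g : R -> R) (d : 'I_n) : Ck1 k g ->
  is_Ck k (fun x : 'rV[R]_n => g (x ord0 d)).
Proof.
have cc (g1 : R -> R) : continuous g1 ->
    continuous (fun x : 'rV[R]_n => g1 (x ord0 d)).
  move=> cg x.
  apply: (@continuous_comp _ _ _ (fun x : 'rV[R]_n => x ord0 d) g1).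
    exact: coord_continuous.
  exact: cg.
elim: k g => [|k IH] g gk; first by split => //; exact: cc.
have cg := Ck1_continuous gk.
move: gk => [g' dg g'k].
apply: (is_Ck_intro (df := fun i x => g' (x ord0 d) * (i == d)%:R)).
- exact: cc.
- by move=> i x; exact: is_derive_coord.
- by move=> i; apply: is_CkM; [exact: IH|exact: is_Ck_cst].
Qed.

End smooth_closure.

(** * Compact supports, Lipschitz and Taylor bounds *)

Section compact_support.
Context {R : realType} {n : nat}.
Implicit Types (f g : 'rV[R]_n -> R) (x y u v : 'rV[R]_n).

Lemma notin_supp f x : ~ supp f x -> \near x, f x = 0.
Proof.
move=> fx; have : open (~` supp f) by apply: closed_openC; exact: closed_closure.
rewrite openE => /(_ x fx); apply: filterS => y fy.
by apply/eqP/negPn/negP => fy0; apply: fy; exact: subset_closure.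
Qed.

Lemma supp_sub f (K : set 'rV[R]_n) : closed K ->
  (forall x, ~ K x -> f x = 0) -> supp f `<=` K.
Proof.
move=> cK fK; apply: (subset_trans (B := closure K)).
  by apply: closureS => x /= fx0; apply/not_notP => /fK /eqP; rewrite (negbTE fx0).
by have := iffLR (closure_id K) cK => {1}<-.
Qed.

Lemma partial_notin_supp f i x : ~ supp f x -> partial i f x = 0.
Proof.
move=> /notin_supp fx; apply: partialE.
have H := is_derive_cst (0 : R) x (delta_mx ord0 i).
by apply: near_eq_is_derive H; apply: filterS fx.
Qed.

Lemma Ccoo_partial U f i : Ccoo U f -> Ccoo U (partial i f).
Proof.
move=> [fs fc fU].
have sub : supp (partial i f) `<=` supp f.
  by apply: supp_sub; [exact: closed_closure|exact: partial_notin_supp].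
split; [exact: smooth_partial| |exact: subset_trans sub fU].
by apply: subclosed_compact fc sub; exact: closed_closure.
Qed.

Lemma Ccoo_smooth U f : Ccoo U f -> smooth f.
Proof. by case. Qed.

Lemma Ccoo_setT U f : Ccoo U f -> Ccoo setT f.
Proof. by case. Qed.

Lemma smooth_Ccoo f (K : set 'rV[R]_n) : smooth f -> compact K -> closed K ->
  (forall x, ~ K x -> f x = 0) -> Ccoo setT f.
Proof.
move=> fs cK clK fK; split => //.
by apply: subclosed_compact cK (supp_sub clK fK); exact: closed_closure.
Qed.

Lemma Ccoo_eq0 f x : ~ supp f x -> f x = 0.
Proof.
by move=> fx; apply/eqP/negPn/negP => fx0; apply: fx; exact: subset_closure.
Qed.

Lemma CcooD f g : Ccoo setT f -> Ccoo setT g -> Ccoo setT (fun x => f x + g x).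
Proof.
move=> [fs fc _] [gs gc _]; apply: (@smooth_Ccoo _ (supp f `|` supp g)).
- exact: smoothD.
- exact: compactU.
- by apply: closedU; exact: closed_closure.
- by move=> x /not_orP[fx gx]; rewrite !Ccoo_eq0// addr0.
Qed.

Lemma CcooMl f g : smooth f -> Ccoo setT g -> Ccoo setT (fun x => f x * g x).
Proof.
move=> fs [gs gc _]; apply: (@smooth_Ccoo _ (supp g)) => //.
- exact: smoothM.
- exact: closed_closure.
- by move=> x gx; rewrite (Ccoo_eq0 gx) mulr0.
Qed.

Lemma Ccoo0 : Ccoo setT (fun _ : 'rV[R]_n => 0).
Proof.
apply: (@smooth_Ccoo _ set0).
- exact: smooth_cst.
- exact: compact0.
- exact: closed0.
- by [].
Qed.

Lemma Ccoo_bounded U f : Ccoo U f -> exists2 M, 0 <= M & forall x, `|f x| <= M.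
Proof.
move=> [fs fc _].
have [[x0 sx0]|f0] := pselect (supp f !=set0); last first.
  exists 0 => // x; rewrite Ccoo_eq0 ?normr0// => sx; apply: f0; by exists x.
have cf : continuous (fun x => `|f x|).
  move=> x; apply: (@continuous_comp _ _ _ f Num.norm); last exact: norm_continuous.
  exact: smooth_continuous.
have [c _ fle] := @compact_EVT_max _ _ (fun x => `|f x|) (supp f) (ex_intro _ x0 sx0) fc
  (continuous_subspaceT cf).
exists `|f c| => // x; have [sx|sx] := pselect (supp f x).
  by apply: fle; rewrite inE.
by rewrite (Ccoo_eq0 sx) normr0.
Qed.

Definition l1norm v : R := \sum_i `|v ord0 i|.

Lemma l1norm_ge0 v : 0 <= l1norm v.
Proof. exact: sumr_ge0. Qed.

Lemma sqr_l1norm_le v : l1norm v ^+ 2 <= n%:R * sqnorm v.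
Proof.
have H i j : `|v ord0 i| * `|v ord0 j| <=
    2^-1 * (v ord0 i * v ord0 i) + 2^-1 * (v ord0 j * v ord0 j).
  have := sqr_ge0 (`|v ord0 i| - `|v ord0 j|).
  rewrite sqrrB !real_normK ?num_real// !expr2; lra.
rewrite expr2 /l1norm big_distrlr /=.
apply: (le_trans (ler_sum _ (fun i _ => ler_sum _ (fun j _ => H i j)))).
under eq_bigr do rewrite big_split /= sumr_const card_ord -mulr_sumr.
rewrite big_split /= sumr_const card_ord sumrMnl -!mulr_sumr.
set S := \sum_i _; rewrite /sqnorm /dotv -/S -mulr_natr; lra.
Qed.

Lemma dotv_le_l1norm u v (C : R) : (forall i, `|u ord0 i| <= C) ->
  `|dotv u v| <= C * l1norm v.
Proof.
move=> uC; rewrite /dotv /l1norm mulr_sumr; apply: le_trans (ler_norm_sum _ _ _) _.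
by apply: ler_sum => i _; rewrite normrM ler_wpM2r.
Qed.

Definition mix_rV (k : nat) x y : 'rV[R]_n :=
  \row_i if (i < k)%N then y ord0 i else x ord0 i.

(* Moving one coordinate at a time from x to y and applying the mean value
   theorem to each move. *)
Lemma coordinatewise_mvt f x y : smooth f ->
  exists2 xi : 'I_n -> 'rV[R]_n, forall i, l1norm (xi i - x) <= l1norm (y - x) &
  f y - f x = \sum_i partial i f (xi i) * (y - x) ord0 i.
Proof.
move=> fs.
have step (k : 'I_n) : exists z, l1norm (z - x) <= l1norm (y - x) /\
   f (mix_rV k.+1 x y) - f (mix_rV k x y) = partial k f z * (y - x) ord0 k.
  pose v : 'rV[R]_n := delta_mx ord0 k.
  pose b := (y - x) ord0 k; pose z0 := mix_rV k x y.
  have mixS : mix_rV k.+1 x y = b *: v + z0.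
    apply/rowP => i; rewrite !mxE eqxx /= ltnS leq_eqVlt.
    have [->|ik] := eqVneq i k; first by rewrite eqxx/= ltnn mulr1 /b !mxE subrK.
    by rewrite val_eqE (negbTE ik)/= mulr0 add0r.
  have dg (t : R) : is_derive t 1 (fun h : R => f (h *: v + z0)) (partial k f (t *: v + z0)).
    by apply: derivable_line; have [] := smooth_is_derive k (t *: v + z0) fs.
  have zle t : `|t| <= `|b| -> l1norm (t *: v + z0 - x) <= l1norm (y - x).
    move=> tb; apply: ler_sum => i _; rewrite !mxE eqxx /=.
    have [->|ik] := eqVneq i k; first by rewrite mulr1 ltnn addrK (le_trans tb)// /b !mxE.
    by rewrite mulr0 add0r; case: ifP => // _; rewrite subrr normr0.
  have cg := continuous_subspaceT (is_derive_continuous dg).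
  have [b0|b0|b0] := ltgtP b 0.
  - have [c + cE] := MVT b0 (fun z _ => dg z) (cg _).
    rewrite in_itv /= => /andP[bc c0]; exists (c *: v + z0); split.
      by apply: zle; rewrite !ltr0_norm// lerN2 ltW.
    rewrite mixS -/z0 -[X in _ - f X]add0r -[X in _ - f (X + _)](scale0r v).
    by apply/eqP; rewrite -[X in X == _]opprB cE -/b; apply/eqP; ring.
  - have [c + cE] := MVT b0 (fun z _ => dg z) (cg _).
    rewrite in_itv /= => /andP[bc c0]; exists (c *: v + z0); split.
      by apply: zle; rewrite !gtr0_norm// ltW.
    rewrite mixS -/z0 -[X in _ - f X]add0r -[X in _ - f (X + _)](scale0r v).
    by rewrite cE -/b; ring.
  - exists x; split; first by rewrite subrr /l1norm big1 ?l1norm_ge0// => i _; rewrite mxE normr0.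
    by rewrite mixS -/z0 -/b b0 scale0r add0r subrr mulr0.
have [xi xiP] := choice step.
exists xi; first by move=> i; have [] := xiP i.
have -> : \sum_i partial i f (xi i) * (y - x) ord0 i =
   \sum_(i < n) (f (mix_rV i.+1 x y) - f (mix_rV i x y)).
  by apply: eq_bigr => i _; have [_ ->] := xiP i.
rewrite -(big_mkord xpredT (fun i => f (mix_rV i.+1 x y) - f (mix_rV i x y))).
rewrite telescope_sumr//; congr (f _ - f _); apply/rowP => i; rewrite mxE//.
by rewrite ltn_ord.
Qed.

Lemma Ccoo_grad_bounded U f : Ccoo U f ->
  exists2 C, 0 <= C & forall i x, `|partial i f x| <= C.
Proof.
move=> fU.
have H i : exists C, 0 <= C /\ forall x, `|partial i f x| <= C.
  by have [C ? ?] := Ccoo_bounded (Ccoo_partial i fU); exists C.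
have [c cP] := choice H.
exists (\sum_i c i); first by apply: sumr_ge0 => i _; have [] := cP i.
move=> i x; have [_ /(_ x) H1] := cP i; apply: le_trans H1 _.
rewrite (bigD1 i)//= lerDl; apply: sumr_ge0 => j _; by have [] := cP j.
Qed.

Lemma Ccoo_lipschitz U f : Ccoo U f ->
  exists2 C, 0 <= C & forall x y, `|f y - f x| <= C * l1norm (y - x).
Proof.
move=> fU; have [C C0 fC] := Ccoo_grad_bounded fU; exists C => // x y.
have [xi _ ->] := coordinatewise_mvt x y (Ccoo_smooth fU).
apply: le_trans (ler_norm_sum _ _ _) _; rewrite /l1norm mulr_sumr.
by apply: ler_sum => i _; rewrite normrM ler_wpM2r.
Qed.

Lemma Ccoo_grad_lipschitz U f : Ccoo U f ->
  exists2 C, 0 <= C & forall i x y,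
    `|partial i f y - partial i f x| <= C * l1norm (y - x).
Proof.
move=> fU.
have H i : exists C, 0 <= C /\
   forall x y, `|partial i f y - partial i f x| <= C * l1norm (y - x).
  by have [C ? ?] := Ccoo_lipschitz (Ccoo_partial i fU); exists C.
have [c cP] := choice H.
exists (\sum_i c i); first by apply: sumr_ge0 => i _; have [] := cP i.
move=> i x y; have [_ /(_ x y) H1] := cP i; apply: le_trans H1 _.
apply: ler_wpM2r; first exact: l1norm_ge0.
rewrite (bigD1 i)//= lerDl; apply: sumr_ge0 => j _; by have [] := cP j.
Qed.

(** The mean value points stay within [l1norm (y - x)] of [x], so moving the derivatives back to [x]
    costs a second factor [l1norm (y - x)]; the factor [n] is that of [sqr_l1norm_le]. *)
Lemma Ccoo_taylor U f : Ccoo U f -> exists2 C, 0 <= C & forall x y,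
  `|f y - f x - dotv (grad f x) (y - x)| <= C * sqnorm (y - x).
Proof.
move=> fU; have [C C0 fC] := Ccoo_grad_lipschitz fU.
exists (C * n%:R) => [|x y]; first by rewrite mulr_ge0.
have [xi xiP ->] := coordinatewise_mvt x y (Ccoo_smooth fU).
rewrite /dotv -sumrB -mulrA.
apply: le_trans (ler_wpM2l C0 (sqr_l1norm_le _)).
apply: le_trans (ler_norm_sum _ _ _) _; rewrite expr2 mulrA {2}/l1norm mulr_sumr.
apply: ler_sum => i _; rewrite [grad _ _ _ _]mxE -mulrBl normrM; apply: ler_wpM2r => //.
by apply: le_trans (fC _ _ _) _; apply: ler_wpM2l.
Qed.

End compact_support.

(** * Integration of essentially bounded functions *)

Section essentially_bounded.
Context d (T : measurableType d) (R : realType) (P : probability T R).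
Implicit Types (f g : T -> R).

(** Positions are bounded only almost everywhere under a compactly supported law. The class is
    closed under sums and products, so every polynomial integrand below is integrable. *)
Definition essb f := measurable_fun setT f /\
  exists M, {ae P, forall x, `|f x| <= M}.

Lemma essb_integrable f : essb f -> P.-integrable setT (EFin \o f).
Proof.
move=> [mf [M fM]]; apply/integrableP; split; first exact/measurable_EFinP.
apply: (@le_lt_trans _ _ (\int[P]_x `|M|%:E)%E).
  apply: ae_ge0_le_integral => //.
  - by do 2 apply: measurableT_comp => //.
  - by apply: filterS fM => x fM _; rewrite lee_fin (le_trans fM)// ler_norm.
by rewrite integral_cst//= probability_setT mule1 ltry.
Qed.

Lemma essb_ae f : measurable_fun setT f -> forall M,
  {ae P, forall x, `|f x| <= M} -> essb f.
Proof. by move=> mf M fM; split => //; exists M. Qed.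

Lemma essb_cst (c : R) : essb (fun=> c).
Proof. by apply: (@essb_ae _ _ `|c|); [exact: measurable_cst|exact: aeW]. Qed.

Lemma essbD f g : essb f -> essb g -> essb (fun x => f x + g x).
Proof.
move=> [mf [M fM]] [mg [N gN]]; apply: (@essb_ae _ _ (M + N)).
  exact: measurable_funD.
by apply: filterS2 fM gN => x fM gN; apply: le_trans (ler_normD _ _) _; exact: lerD.
Qed.

Lemma essbM f g : essb f -> essb g -> essb (fun x => f x * g x).
Proof.
move=> [mf [M fM]] [mg [N gN]]; apply: (@essb_ae _ _ (M * N)).
  exact: measurable_funM.
by apply: filterS2 fM gN => x fM gN; rewrite normrM ler_pM.
Qed.

Lemma essbZ c f : essb f -> essb (fun x => c * f x).
Proof. by move=> ef; apply: essbM => //; exact: essb_cst. Qed.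

Lemma essbN f : essb f -> essb (fun x => - f x).
Proof.
move=> /(essbZ (-1)); suff -> : (fun x => -1 * f x) = (fun x => - f x) by [].
by apply/funext => x; rewrite mulN1r.
Qed.

Lemma essbB f g : essb f -> essb g -> essb (fun x => f x - g x).
Proof. by move=> ef eg; apply: essbD => //; exact: essbN. Qed.

Lemma essb_sum (I : Type) (r : seq I) (F : I -> T -> R) :
  (forall i, essb (F i)) -> essb (fun x => \sum_(i <- r) F i x).
Proof.
move=> FE; elim: r => [|a r IH].
  by under eq_fun do rewrite big_nil; exact: essb_cst.
by under eq_fun do rewrite big_cons; exact: essbD.
Qed.

Lemma RintD f g : essb f -> essb g ->
  \int[P]_x (f x + g x) = \int[P]_x f x + \int[P]_x g x.
Proof. by move=> ef eg; rewrite RintegralD//; exact: essb_integrable. Qed.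

Lemma RintB f g : essb f -> essb g ->
  \int[P]_x (f x - g x) = \int[P]_x f x - \int[P]_x g x.
Proof. by move=> ef eg; rewrite RintegralB//; exact: essb_integrable. Qed.

Lemma RintZ c f : essb f -> \int[P]_x (c * f x) = c * \int[P]_x f x.
Proof. by move=> ef; rewrite RintegralZl//; exact: essb_integrable. Qed.

Lemma Rint_cst c : \int[P]_x c = c.
Proof.
by rewrite Rintegral_cst//= probability_setT mulr1.
Qed.

Lemma Rint_sum (I : Type) (r : seq I) (F : I -> T -> R) :
  (forall i, essb (F i)) ->
  \int[P]_x (\sum_(i <- r) F i x) = \sum_(i <- r) \int[P]_x F i x.
Proof.
move=> FE; elim: r => [|a r IH].
  under [LHS]eq_Rintegral do rewrite big_nil.
  by rewrite Rint_cst big_nil.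
under [LHS]eq_Rintegral do rewrite big_cons.
by rewrite RintD// ?IH ?big_cons//; exact: essb_sum.
Qed.

Lemma Rint_ae_eq f g : measurable_fun setT f -> measurable_fun setT g ->
  {ae P, forall x, f x = g x} -> \int[P]_x f x = \int[P]_x g x.
Proof.
move=> mf mg fg; congr fine; apply: ae_eq_integral => //; try exact/measurable_EFinP.
by apply: filterS fg => x -> _.
Qed.

Lemma Rint_ge0_ae f : essb f -> {ae P, forall x, 0 <= f x} -> 0 <= \int[P]_x f x.
Proof.
move=> [mf _] f0; rewrite (@Rint_ae_eq f (fun x => `|f x|))//.
- exact: Rintegral_ge0.
- exact: measurableT_comp.
- by apply: filterS f0 => x f0; rewrite ger0_norm.
Qed.

Lemma le_Rint_ae f g : essb f -> essb g -> {ae P, forall x, f x <= g x} ->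
  \int[P]_x f x <= \int[P]_x g x.
Proof.
move=> ef eg fg; rewrite -subr_ge0 -RintB//; apply: Rint_ge0_ae; first exact: essbB.
by apply: filterS fg => x; rewrite subr_ge0.
Qed.

Lemma le_Rint f g : essb f -> essb g -> (forall x, f x <= g x) ->
  \int[P]_x f x <= \int[P]_x g x.
Proof. by move=> ef eg fg; apply: le_Rint_ae => //; exact: aeW. Qed.

Lemma essb_EFin f : essb f -> (\int[P]_x (f x)%:E)%E = (\int[P]_x f x)%:E.
Proof.
by move=> ef; rewrite fineK//; exact: integrable_fin_num (essb_integrable ef).
Qed.

Lemma Rint_cauchy_schwarz f g : essb f -> essb g ->
  (\int[P]_x (f x * g x)) ^+ 2 <= \int[P]_x (f x ^+ 2) * \int[P]_x (g x ^+ 2).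
Proof.
move=> ef eg; set a := \int[P]_x (f x ^+ 2); set b := \int[P]_x (g x ^+ 2).
set c := \int[P]_x (f x * g x).
have quad s t : 0 <= s ^+ 2 * a + 2 * s * t * c + t ^+ 2 * b.
  have -> : s ^+ 2 * a + 2 * s * t * c + t ^+ 2 * b =
      \int[P]_x ((s * f x + t * g x) ^+ 2).
    have E1 : (fun x => (s * f x + t * g x) ^+ 2) = fun x =>
       (s ^+ 2 * (f x * f x) + (2 * s * t) * (f x * g x)) + t ^+ 2 * (g x * g x).
      by apply/funext => x; ring.
    rewrite E1 RintD; [|by apply: essbD; apply: essbZ; exact: essbM|
       by apply: essbZ; exact: essbM].
    rewrite RintD; [|by apply: essbZ; exact: essbM..].
    rewrite !RintZ; [|exact: essbM..].
    by [].
  by apply: Rintegral_ge0 => x _; exact: sqr_ge0.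
have a0 : 0 <= a by apply: Rintegral_ge0 => x _; exact: sqr_ge0.
have b0 : 0 <= b by apply: Rintegral_ge0 => x _; exact: sqr_ge0.
have [b00|bn0] := eqVneq b 0.
  (* With [b = 0] this choice turns the form into [- c ^+ 2 * (a + 2)], which forces [c = 0]. *)
  have := quad c (- (a + 1)); rewrite b00 => q.
  rewrite mulr0; have ca : 0 <= c ^+ 2 * a by rewrite mulr_ge0 ?sqr_ge0.
  lra.
have bp : 0 < b by rewrite lt_neqAle eq_sym bn0.
(* Here the form equals [b * (a * b - c ^+ 2)]. *)
have := quad b (- c) => q; rewrite -(ler_pM2l bp); nra.
Qed.

End essentially_bounded.

(** * Integrals under image measures *)

Section transfer.
Context d d' (T : measurableType d) (T' : measurableType d') (R : realType).

(* The two probabilities are related by h as in a push-forward, without P'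
   being syntactically one. *)
Definition transports (P : probability T R) (P' : set T' -> \bar R) (h : T -> T') :=
  measurable_fun setT h /\ forall A, measurable A -> P (h @^-1` A) = P' A.

Lemma transports_ge0 (P : probability T R) (P' : probability T' R) h (f : T' -> \bar R) :
  transports P P' h -> measurable_fun setT f -> (forall x, (0 <= f x)%E) ->
  (\int[P']_x f x = \int[P]_x f (h x))%E.
Proof.
move=> [mh PP'] mf f0.
rewrite -[RHS](@ge0_integral_pushforward _ _ _ _ _ h mh P setT f)//.
by apply: eq_measure_integral => A mA _; rewrite /= -PP'.
Qed.

Variables (P : probability T R) (P' : probability T' R) (h : T -> T').
Hypothesis PP' : transports P P' h.

Lemma transports_ae (Q : T' -> Prop) :
  {ae P', forall y, Q y} -> {ae P, forall x, Q (h x)}.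
Proof.
move=> [N [mN N0 QN]]; exists (h @^-1` N); split.
- by have [mh _] := PP'; rewrite -[X in measurable X]setTI; exact: mh.
- by have [_ ->] := PP'.
- by move=> x /= Qx; exact: QN.
Qed.

Lemma transports_essb (f : T' -> R) : essb P' f -> essb P (f \o h).
Proof.
move=> [mf [M fM]]; split; first by have [mh _] := PP'; exact: measurableT_comp.
by exists M; exact: (@transports_ae (fun y => `|f y| <= M)).
Qed.

Lemma transports_Rint (f : T' -> R) : essb P' f ->
  \int[P]_x f (h x) = \int[P']_y f y.
Proof.
move=> ef; have [mh PE] := PP'; have eh := transports_essb ef.
have mf : measurable_fun setT (EFin \o f) by apply/measurable_EFinP; case: ef.
have eqm : forall g, (\int[P']_y g y = \int[pushforward P h]_y g y)%E.
  by move=> g; apply: eq_measure_integral => A mA _; rewrite /= -PE.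
rewrite /Rintegral eqm.
rewrite (@integral_pushforward _ _ _ _ _ h mh P setT (EFin \o f))//.
by rewrite preimage_setT; exact: essb_integrable.
Qed.

End transfer.

Section borel_rV_functions.
Context {R : realType} {n : nat}.

Lemma continuous_measurable_rV (f : 'rV[R]_n -> R) :
  continuous f -> measurable_fun setT f.
Proof.
move=> cf; apply: (measurability _ (RGenOpens.measurableE R)).
move=> _ [_ [a [b ->] <-]]; rewrite setTI; apply: open_measurable_rV.
by apply: open_comp; [move=> x _; exact: cf|exact: interval_open].
Qed.

Lemma continuous_measurable_rV_rV (f : 'rV[R]_n -> 'rV[R]_n) :
  continuous f -> measurable_fun setT f.
Proof.
move=> cf; apply: measurable_fun_rV => i; apply: continuous_measurable_rV => x.
apply: (@continuous_comp _ _ _ f (fun v : 'rV[R]_n => v ord0 i)); first exact: cf.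
exact: coord_continuous.
Qed.

End borel_rV_functions.

(** * Self-couplings and the expansion of the cost *)

Section dotv_theory.
Context {R : realType} {n : nat}.
Implicit Types (u v w x y : 'rV[R]_n).

Lemma dotvC u v : dotv u v = dotv v u.
Proof. by apply: eq_bigr => i _; rewrite mulrC. Qed.

Lemma dotvDl u v w : dotv (u + v) w = dotv u w + dotv v w.
Proof. by rewrite /dotv -big_split; apply: eq_bigr => i _ /=; rewrite mxE mulrDl. Qed.

Lemma dotvZl c u w : dotv (c *: u) w = c * dotv u w.
Proof. by rewrite /dotv mulr_sumr; apply: eq_bigr => i _ /=; rewrite mxE mulrA. Qed.

Lemma dotvNl u w : dotv (- u) w = - dotv u w.
Proof. by rewrite -scaleN1r dotvZl mulN1r. Qed.

Lemma dotvBl u v w : dotv (u - v) w = dotv u w - dotv v w.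
Proof. by rewrite dotvDl dotvNl. Qed.

Lemma dotvBr u v w : dotv w (u - v) = dotv w u - dotv w v.
Proof. by rewrite dotvC dotvBl !(dotvC w). Qed.

Lemma dotvDr u v w : dotv w (u + v) = dotv w u + dotv w v.
Proof. by rewrite dotvC dotvDl !(dotvC w). Qed.

Lemma dotvZr c u w : dotv w (c *: u) = c * dotv w u.
Proof. by rewrite dotvC dotvZl dotvC. Qed.

Lemma dotvNr u w : dotv w (- u) = - dotv w u.
Proof. by rewrite dotvC dotvNl dotvC. Qed.

Lemma sqnorm_ge0 v : 0 <= sqnorm v.
Proof. by apply: sumr_ge0 => i _; rewrite -expr2 sqr_ge0. Qed.

Lemma sqnormN v : sqnorm (- v) = sqnorm v.
Proof. by rewrite /sqnorm dotvNl dotvNr opprK. Qed.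

Lemma sqnormD u v : sqnorm (u + v) = sqnorm u + 2 * dotv u v + sqnorm v.
Proof. by rewrite /sqnorm dotvDl !dotvDr (dotvC v u); ring. Qed.

Lemma dotv_young u v (eps c : R) : 0 < c ->
  2 * eps * dotv u v <= eps ^+ 2 / c * sqnorm u + c * sqnorm v.
Proof.
move=> c0.
have : 0 <= c^-1 * sqnorm (eps *: u - c *: v).
  by rewrite mulr_ge0 ?sqnorm_ge0// invr_ge0 ltW.
have -> : sqnorm (eps *: u - c *: v) =
   eps ^+ 2 * sqnorm u - 2 * eps * c * dotv u v + c ^+ 2 * sqnorm v.
  by rewrite /sqnorm dotvBl !dotvBr !dotvZl !dotvZr (dotvC v u); ring.
have -> : c^-1 * (eps ^+ 2 * sqnorm u - 2 * eps * c * dotv u v + c ^+ 2 * sqnorm v) =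
   eps ^+ 2 / c * sqnorm u + c * sqnorm v - 2 * eps * dotv u v.
  by field; rewrite gt_eqF.
by rewrite subr_ge0.
Qed.

Lemma sqnorm_pair_displacement x y u v w (s t : R) :
  sqnorm (x + s *: u - (y + t *: w)) =
  sqnorm (y - x) + sqnorm (s *: u) + sqnorm (t *: w) - 2 * (s * t) * dotv u v
  - 2 * (s * t) * dotv u (w - v) - 2 * s * dotv u (y - x) - 2 * t * dotv w (x - y).
Proof.
have -> : x + s *: u - (y + t *: w) = s *: u - t *: w - (y - x).
  by apply/rowP => i; rewrite !mxE; ring.
have -> : x - y = - (y - x) by rewrite opprB.
move: (y - x) => z; rewrite /sqnorm dotvNr.
rewrite !(dotvBl, dotvBr) !(dotvZl, dotvZr) (dotvC w u) (dotvC z u) (dotvC z w).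
ring.
Qed.

Lemma dotv_hessian_app (psi : 'rV[R]_n -> R) x u v :
  dotv (hessian_app psi x u) v = \sum_j u ord0 j * dotv (grad (partial j psi) x) v.
Proof.
rewrite /dotv; under [RHS]eq_bigr do rewrite mulr_sumr.
rewrite exchange_big; apply: eq_bigr => i _ /=.
rewrite /hessian_app mxE mxE mulr_suml; apply: eq_bigr => j _.
by rewrite !mxE; ring.
Qed.

End dotv_theory.

Section essentially_bounded_fields.
Context d (T : measurableType d) (R : realType) (P : probability T R) (n : nat).
Implicit Types (f g : T -> 'rV[R]_n).

Definition essbv f := forall i, essb P (fun x => f x ord0 i).

Lemma essbvB f g : essbv f -> essbv g -> essbv (fun x => f x - g x).
Proof.
move=> ef eg i; under eq_fun do rewrite !mxE; exact: essbB.
Qed.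

Lemma essbvZ c f : essbv f -> essbv (fun x => c *: f x).
Proof. by move=> ef i; under eq_fun do rewrite !mxE; exact: essbZ. Qed.

Lemma essb_dotv f g : essbv f -> essbv g -> essb P (fun x => dotv (f x) (g x)).
Proof. by move=> ef eg; apply: essb_sum => i; exact: essbM. Qed.

Lemma essb_sqnorm f : essbv f -> essb P (fun x => sqnorm (f x)).
Proof. by move=> ef; exact: essb_dotv. Qed.

End essentially_bounded_fields.

Section compactly_supported_fields.
Context {R : realType} {n : nat} (P : probability 'rV[R]_n R).

Lemma Ccoo_essb U f : Ccoo U f -> essb P f.
Proof.
move=> fU; have [M _ fM] := Ccoo_bounded fU.
apply: (@essb_ae _ _ _ _ _ _ M); last exact: aeW.
apply: continuous_measurable_rV; apply: smooth_continuous; exact: Ccoo_smooth fU.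
Qed.

Lemma grad_essbv U f : Ccoo U f -> essbv P (grad f).
Proof.
move=> fU i; under eq_fun do rewrite mxE.
exact: Ccoo_essb (Ccoo_partial i fU).
Qed.

Lemma hessian_app_grad_Ccoo U V (phi psi : 'rV[R]_n -> R) i : Ccoo U phi -> Ccoo V psi ->
  Ccoo setT (fun x => hessian_app psi x (grad phi x) ord0 i).
Proof.
move=> phiU psiV.
have -> : (fun x => hessian_app psi x (grad phi x) ord0 i) =
    fun x => \sum_j partial i (partial j psi) x * partial j phi x.
  apply/funext => x; rewrite /hessian_app mxE mxE.
  by apply: eq_bigr => j _; rewrite !mxE mulrC.
elim: (index_enum _) => [|j r IH].
  by under eq_fun do rewrite big_nil; exact: Ccoo0.
under eq_fun do rewrite big_cons; apply: CcooD => //.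
apply: CcooMl; last exact: Ccoo_setT (Ccoo_partial j phiU).
by do 2 apply: smooth_partial; exact: Ccoo_smooth psiV.
Qed.

End compactly_supported_fields.

Section self_couplings.
Context {R : realType} {n : nat} (mu : probability 'rV[R]_n R).
Hypothesis mu_bdd : essbv mu id.
Implicit Type gam : probability ('rV[R]_n * 'rV[R]_n)%type R.

Lemma coupling_fst gam : coupling mu mu gam -> transports gam mu fst.
Proof.
move=> cg; split; first exact: measurable_fst.
by move=> A mA; have [<- _] := cg A mA; rewrite setXT.
Qed.

Lemma coupling_snd gam : coupling mu mu gam -> transports gam mu snd.
Proof.
move=> cg; split; first exact: measurable_snd.
by move=> A mA; have [_ <-] := cg A mA; rewrite setTX.
Qed.

Lemma coupling_essb1 gam f : coupling mu mu gam -> essb mu f ->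
  essb gam (fun z => f z.1).
Proof. by move=> /coupling_fst cg; exact: transports_essb. Qed.

Lemma coupling_essb2 gam f : coupling mu mu gam -> essb mu f ->
  essb gam (fun z => f z.2).
Proof. by move=> /coupling_snd cg; exact: transports_essb. Qed.

Lemma coupling_essbv1 gam (f : 'rV[R]_n -> 'rV[R]_n) : coupling mu mu gam ->
  essbv mu f -> essbv gam (fun z => f z.1).
Proof. by move=> cg ef i; exact: (coupling_essb1 cg (ef i)). Qed.

Lemma coupling_essbv2 gam (f : 'rV[R]_n -> 'rV[R]_n) : coupling mu mu gam ->
  essbv mu f -> essbv gam (fun z => f z.2).
Proof. by move=> cg ef i; exact: (coupling_essb2 cg (ef i)). Qed.

Lemma coupling_disp_essbv gam : coupling mu mu gam -> essbv gam (fun z => z.2 - z.1).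
Proof.
by move=> cg; apply: essbvB; [exact: (coupling_essbv2 cg mu_bdd)|
                              exact: (coupling_essbv1 cg mu_bdd)].
Qed.

Lemma coupling_Rint1 gam f : coupling mu mu gam -> essb mu f ->
  \int[gam]_z f z.1 = \int[mu]_x f x.
Proof. by move=> /coupling_fst cg; exact: transports_Rint. Qed.

Lemma coupling_Rint2 gam f : coupling mu mu gam -> essb mu f ->
  \int[gam]_z f z.2 = \int[mu]_x f x.
Proof. by move=> /coupling_snd cg; exact: transports_Rint. Qed.

Definition disp2 gam : R := \int[gam]_z sqnorm (z.2 - z.1).

Definition disp_corr gam (F : 'rV[R]_n -> 'rV[R]_n) : R :=
  \int[gam]_z dotv (F z.1) (z.2 - z.1).

Lemma disp2_ge0 gam : 0 <= disp2 gam.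
Proof. by apply: Rintegral_ge0 => z _; exact: sqnorm_ge0. Qed.

(* Gradients are almost invisible to a self-coupling: the first-order term of
   the Taylor expansion has zero average since the two marginals agree. *)
Lemma disp_corr_grad eta : Ccoo setT eta ->
  exists2 C, 0 <= C & forall gam, coupling mu mu gam ->
    `|disp_corr gam (grad eta)| <= C * disp2 gam.
Proof.
move=> etaC; have [C C0 taylor] := Ccoo_taylor etaC.
exists C => // gam cg.
have e1 := coupling_essb1 cg (Ccoo_essb mu etaC).
have e2 := coupling_essb2 cg (Ccoo_essb mu etaC).
have ed := coupling_disp_essbv cg.
have eg := essb_dotv (coupling_essbv1 cg (grad_essbv mu etaC)) ed.
have es := essb_sqnorm ed.
have bal : \int[gam]_z (eta z.2 - eta z.1) = 0.
  rewrite RintB// (coupling_Rint1 cg (Ccoo_essb mu etaC)).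
  by rewrite (coupling_Rint2 cg (Ccoo_essb mu etaC)) subrr.
have -> : disp_corr gam (grad eta) =
    \int[gam]_z (dotv (grad eta z.1) (z.2 - z.1) - (eta z.2 - eta z.1)).
  by rewrite RintB ?bal ?subr0//; exact: essbB.
rewrite /disp2 -RintZ//; apply/ler_normlP.
have eB := essbB eg (essbB e2 e1).
split; [rewrite -mulN1r -RintZ//|]; apply: le_Rint => //; try exact: essbZ.
  by move=> z; have := taylor z.1 z.2 => /ler_normlP[_]; lra.
by move=> z; have := taylor z.1 z.2 => /ler_normlP[+ _]; lra.
Qed.

(** Young's inequality is applied to [F - grad eta] only; the gradient is charged to [disp2] by
    [disp_corr_grad]. The constant depends on [eta], but not on the coupling, [eps] or [c]. *)
Lemma disp_corr_le F eta : essbv mu F -> Ccoo setT eta ->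
  exists2 C, 0 <= C & forall gam, coupling mu mu gam ->
    forall eps c, 0 <= eps -> 0 < c ->
    2 * eps * disp_corr gam F <=
      eps ^+ 2 / c * \int[mu]_x sqnorm (F x - grad eta x) +
      (c + 2 * eps * C) * disp2 gam.
Proof.
move=> eF etaC; have [C C0 corr_eta] := disp_corr_grad etaC.
exists C => // gam cg eps c eps0 c0.
have egr := grad_essbv mu etaC.
have ed := coupling_disp_essbv cg.
have eFg := essbvB eF egr.
have e1 := essb_dotv (coupling_essbv1 cg eFg) ed.
have e2 := essb_dotv (coupling_essbv1 cg egr) ed.
have e3 := essb_sqnorm eFg.
have e3' := coupling_essb1 cg e3.
have e4 := essb_sqnorm ed.
have -> : disp_corr gam F =
    \int[gam]_z dotv (F z.1 - grad eta z.1) (z.2 - z.1) + disp_corr gam (grad eta).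
  rewrite /disp_corr -RintD//; apply: eq_Rintegral => z _.
  by rewrite -dotvDl subrK.
have H1 : 2 * eps * \int[gam]_z dotv (F z.1 - grad eta z.1) (z.2 - z.1) <=
   eps ^+ 2 / c * \int[mu]_x sqnorm (F x - grad eta x) + c * disp2 gam.
  rewrite -(coupling_Rint1 cg e3) /disp2 -!RintZ// -RintD; [|exact: essbZ..].
  apply: le_Rint; [exact: essbZ|by apply: essbD; exact: essbZ|].
  by move=> z; exact: dotv_young.
have H2 : 2 * eps * disp_corr gam (grad eta) <= 2 * eps * (C * disp2 gam).
  rewrite ler_wpM2l ?mulr_ge0//; apply: le_trans (ler_norm _) _; exact: corr_eta.
lra.
Qed.

(** * Second-order expansion of the transport cost *)

Section cost_expansion.
Variables (U V : set 'rV[R]_n) (phi psi : 'rV[R]_n -> R).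
Hypotheses (phiC : Ccoo U phi) (psiC : Ccoo V psi).
Let F x := hessian_app psi x (grad phi x).

Lemma second_order_bound : exists2 C, 0 <= C & forall x y,
  `|dotv (grad phi x) (grad psi y - grad psi x) - dotv (F x) (y - x)| <=
    C * sqnorm (y - x).
Proof.
have [M M0 phiM] := Ccoo_grad_bounded phiC.
have H j : exists C, 0 <= C /\ forall x y,
    `|partial j psi y - partial j psi x - dotv (grad (partial j psi) x) (y - x)|
      <= C * sqnorm (y - x).
  by have [C ? ?] := Ccoo_taylor (Ccoo_partial j psiC); exists C.
have [c cP] := choice H.
exists (\sum_j M * c j).
  by apply: sumr_ge0 => j _; rewrite mulr_ge0//; have [] := cP j.
move=> x y; rewrite dotv_hessian_app {1}/dotv -sumrB mulr_suml.
apply: le_trans (ler_norm_sum _ _ _) _; apply: ler_sum => j _.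
rewrite !mxE -mulrBr normrM -mulrA; apply: ler_pM => //; have [_] := cP j; exact.
Qed.

Definition push_cost gam s t : R :=
  \int[gam]_z sqnorm ((z.1 + s *: grad phi z.1) - (z.2 + t *: grad psi z.2)).

Definition base_cost s t : R := \int[mu]_x sqnorm (s *: grad phi x - t *: grad psi x).

Lemma push_cost_essb gam s t : coupling mu mu gam -> essb gam
  (fun z => sqnorm ((z.1 + s *: grad phi z.1) - (z.2 + t *: grad psi z.2))).
Proof.
move=> cg.
have -> : (fun z : 'rV[R]_n * 'rV[R]_n =>
    sqnorm ((z.1 + s *: grad phi z.1) - (z.2 + t *: grad psi z.2))) =
  fun z => sqnorm ((s *: grad phi z.1 - (t *: grad psi z.2)) - (z.2 - z.1)).
  apply/funext => z; congr sqnorm; apply/rowP => i; rewrite !mxE; ring.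
apply: essb_sqnorm; apply: essbvB; last exact: coupling_disp_essbv.
apply: essbvB; apply: essbvZ.
  exact: (coupling_essbv1 cg (grad_essbv mu phiC)).
exact: (coupling_essbv2 cg (grad_essbv mu psiC)).
Qed.

(** The terms linear in the displacement, such as [2 * s * dotv (grad phi x) (y - x)], are not small
    against its square. Taylor expansion trades them for [2 * s * (phi y - phi x)], which integrates
    to 0 since the marginals agree. *)
Lemma push_cost_expansion : exists2 C, 0 <= C &
  forall gam, coupling mu mu gam -> forall s t, 0 <= s <= 1 -> 0 <= t <= 1 ->
  `|push_cost gam s t - base_cost s t - (disp2 gam - 2 * (s * t) * disp_corr gam F)|
    <= C * (s + t) * disp2 gam.
Proof.
have [C1 C10 ta1] := Ccoo_taylor phiC.
have [C2 C20 ta2] := Ccoo_taylor psiC.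
have [C3 C30 ta3] := second_order_bound.
exists (2 * C1 + 2 * C2 + 2 * C3) => [|gam cg s t /andP[s0 s1] /andP[t0 t1]].
  by rewrite !addr_ge0 ?mulr_ge0.
set C := 2 * C1 + _ + _.
(* [a] and [b] gather what depends on one endpoint only; having equal marginals, they integrate to
   [base_cost] together. *)
pose a x := sqnorm (s *: grad phi x) - 2 * (s * t) * dotv (grad phi x) (grad psi x)
  + 2 * s * phi x - 2 * t * psi x.
pose b x := sqnorm (t *: grad psi x) - 2 * s * phi x + 2 * t * psi x.
pose q (z : 'rV[R]_n * 'rV[R]_n) :=
  sqnorm (z.2 - z.1) - 2 * (s * t) * dotv (F z.1) (z.2 - z.1).
pose cost (z : 'rV[R]_n * 'rV[R]_n) :=
  sqnorm ((z.1 + s *: grad phi z.1) - (z.2 + t *: grad psi z.2)).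
have pointwise z : `|cost z - (q z + (a z.1 + b z.2))| <=
    C * (s + t) * sqnorm (z.2 - z.1).
  case: z => x y; rewrite /cost /q /a /b /=.
  have := ta1 x y => /ler_normlP; have := ta2 y x => /ler_normlP.
  have := ta3 x y => /ler_normlP.
  have -> : sqnorm (x - y) = sqnorm (y - x) by rewrite -sqnormN opprB.
  have S0 := sqnorm_ge0 (y - x).
  have -> : sqnorm (x + s *: grad phi x - (y + t *: grad psi y)) =
      sqnorm (y - x) + sqnorm (s *: grad phi x) + sqnorm (t *: grad psi y)
      - 2 * (s * t) * dotv (grad phi x) (grad psi x)
      - 2 * (s * t) * dotv (grad phi x) (grad psi y - grad psi x)
      - 2 * s * dotv (grad phi x) (y - x) - 2 * t * dotv (grad psi y) (x - y).
    exact: sqnorm_pair_displacement.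
  set S := sqnorm (y - x) in S0 *.
  move: (sqnorm (s *: _)) (sqnorm (t *: _)) (dotv (grad phi x) (grad psi x)) => A1 A2 A3.
  set D1 := dotv (grad phi x) (y - x); set D2 := dotv (grad psi y) (x - y).
  set D3 := dotv (grad phi x) (grad psi y - _); set D4 := dotv (F x) _.
  move=> [g1 g2] [h1 h2] [k1 k2].
  have st0 : 0 <= s * t by rewrite mulr_ge0.
  have sts : s * t <= s by rewrite ler_piMr.
  have k1s : s * - (phi y - phi x - D1) <= s * (C1 * S) by rewrite ler_wpM2l.
  have k2s : s * (phi y - phi x - D1) <= s * (C1 * S) by rewrite ler_wpM2l.
  have h1s : t * - (psi x - psi y - D2) <= t * (C2 * S) by rewrite ler_wpM2l.
  have h2s : t * (psi x - psi y - D2) <= t * (C2 * S) by rewrite ler_wpM2l.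
  have g1s : s * t * - (D3 - D4) <= s * t * (C3 * S) by rewrite ler_wpM2l.
  have g2s : s * t * (D3 - D4) <= s * t * (C3 * S) by rewrite ler_wpM2l.
  have gs : s * t * (C3 * S) <= s * (C3 * S) by rewrite ler_wpM2r// mulr_ge0.
  have p1 : 0 <= t * (C1 * S) by rewrite !mulr_ge0.
  have p2 : 0 <= s * (C2 * S) by rewrite !mulr_ge0.
  have p3 : 0 <= t * (C3 * S) by rewrite !mulr_ge0.
  apply/ler_normlP; rewrite /C; split; nra.
have ep := Ccoo_essb mu phiC; have eq := Ccoo_essb mu psiC.
have egp := grad_essbv mu phiC; have egq := grad_essbv mu psiC.
have eF : essbv mu F.
  by move=> i; exact: (Ccoo_essb mu (hessian_app_grad_Ccoo i phiC psiC)).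
have ed := coupling_disp_essbv cg.
have ea : essb mu a.
  apply: essbB; last exact: essbZ.
  apply: essbD; last exact: essbZ.
  apply: essbB; first by apply: essb_sqnorm; exact: essbvZ.
  by apply: essbZ; exact: essb_dotv.
have eb : essb mu b.
  apply: essbD; last exact: essbZ.
  apply: essbB; last exact: essbZ.
  by apply: essb_sqnorm; exact: essbvZ.
have eq1 : essb gam (fun z => sqnorm (z.2 - z.1)) by exact: essb_sqnorm.
have eq2 : essb gam (fun z => dotv (F z.1) (z.2 - z.1)).
  by apply: essb_dotv => //; exact: (coupling_essbv1 cg eF).
have eqq : essb gam q by apply: essbB => //; exact: essbZ.
have ec : essb gam cost by exact: push_cost_essb.
have ea1 := coupling_essb1 cg ea; have eb2 := coupling_essb2 cg eb.
have eab := essbD ea1 eb2.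
have intq : \int[gam]_z (q z + (a z.1 + b z.2)) =
    disp2 gam - 2 * (s * t) * disp_corr gam F + base_cost s t.
  rewrite RintD// RintD// (coupling_Rint1 cg ea) (coupling_Rint2 cg eb) -RintD//.
  rewrite /q RintB//; last exact: essbZ.
  rewrite RintZ//; congr (_ + _); apply: eq_Rintegral => x _.
  rewrite /a /b /sqnorm !(dotvBl, dotvBr, dotvZl, dotvZr) (dotvC (grad psi x)); ring.
have -> : push_cost gam s t - base_cost s t -
    (disp2 gam - 2 * (s * t) * disp_corr gam F) =
    \int[gam]_z (cost z - (q z + (a z.1 + b z.2))).
  rewrite RintB//; last exact: essbD.
  by rewrite intq /push_cost; ring.
have edif : essb gam (fun z => cost z - (q z + (a z.1 + b z.2))).
  by apply: essbB => //; exact: essbD.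
rewrite /disp2 -RintZ//; apply/ler_normlP; split.
  rewrite -mulN1r -RintZ//; apply: le_Rint; [exact: essbZ|exact: essbZ|].
  by move=> z; have := pointwise z => /ler_normlP[+ _]; rewrite mulN1r.
apply: le_Rint => //; first exact: essbZ.
by move=> z; have := pointwise z => /ler_normlP[_].
Qed.

End cost_expansion.

End self_couplings.

(** * Smooth cells *)

(* The cells replace the cubes of a grid of mesh delta: theta is a smooth
   partition of unity on the box [-K, K]^n reproducing affine functions, and
   theta i lives near the centre c i. *)
Record soft_cells {R : realType} {n : nat} (K A delta : R) (I : finType)
  (theta : I -> 'rV[R]_n -> R) (c : I -> 'rV[R]_n) : Prop := {
  cell_Ccoo : forall i, Ccoo setT (theta i);
  cell_ge0 : forall i x, 0 <= theta i x;
  cell_far : forall i (x : 'rV[R]_n) d, A * delta < `|x ord0 d - c i ord0 d| -> theta i x = 0;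
  cell_grad_far : forall i (x : 'rV[R]_n) d e, A * delta < `|x ord0 d - c i ord0 d| ->
    partial e (theta i) x = 0;
  cell_sum : forall x : 'rV[R]_n, (forall d, `|x ord0 d| <= K) -> \sum_i theta i x = 1;
  cell_dsum : forall (x : 'rV[R]_n) d, (forall d, `|x ord0 d| <= K) ->
    \sum_i partial d (theta i) x = 0;
  cell_dcenter : forall (x : 'rV[R]_n) d e, (forall d, `|x ord0 d| <= K) ->
    \sum_i c i ord0 e * partial d (theta i) x = (d == e)%:R;
  cell_grad_sum : forall (x : 'rV[R]_n) d, (forall d, `|x ord0 d| <= K) ->
    \sum_i `|partial d (theta i) x| <= 2 / delta }.

(** * Splines as second differences of the ramp *)

Section spline.
Context {R : realType} (tau sigma : R -> R) (m : R).
Hypotheses (tau_smooth : forall k, Ck1 k tau)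
  (dtau : forall x : R, is_derive x 1 tau (sigma x))
  (sigma_homo : {homo sigma : x y / x <= y})
  (tau0 : forall x, x <= 0 -> tau x = 0) (sigma0 : forall x, x <= 0 -> sigma x = 0)
  (tau1 : forall x, 1 <= x -> tau x = x - m) (sigma1 : forall x, 1 <= x -> sigma x = 1).

Definition bspline (k y : R) : R := tau (y - k + 1) - 2 * tau (y - k) + tau (y - k - 1).
Definition dbspline (k y : R) : R :=
  sigma (y - k + 1) - 2 * sigma (y - k) + sigma (y - k - 1).

Let shift_derive (a x : R) : is_derive x 1 (fun y => tau (y + a)) (sigma (x + a)).
Proof.
have := is_derive_affine 1 a dtau x; rewrite !mul1r.
by have -> : (fun x => tau (1 * x + a)) = (fun y => tau (y + a))
  by apply/funext => y; rewrite mul1r.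
Qed.

Lemma bspline_derive k (x : R) : is_derive x 1 (bspline k) (dbspline k x).
Proof.
have H1 := shift_derive (1 - k) x; have H2 := shift_derive (- k) x.
have H3 := shift_derive (- k - 1) x.
have := is_deriveD (is_deriveB H1 (is_deriveZ 2 H2)) H3.
have -> : (fun y => tau (y + (1 - k))) - 2 \*: (fun y => tau (y + - k)) +
   (fun y => tau (y + (- k - 1))) = bspline k.
  apply/funext => y; rewrite /bspline /= !fctE /GRing.scale /=.
  by congr (tau _ - _ + tau _); ring.
move/is_derive_eq; apply; rewrite /dbspline /GRing.scale /=.
by congr (sigma _ - _ + sigma _); ring.
Qed.

Lemma bspline_smooth k j : Ck1 j (bspline k).
Proof.
have -> : bspline k = fun y =>
    (tau (1 * y + (1 - k)) + (- 2) * tau (1 * y - k)) + tau (1 * y + (- k - 1)).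
  apply/funext => y; rewrite /bspline mulNr.
  by congr (tau _ - 2 * tau _ + tau _); ring.
apply: Ck1D; last exact: Ck1_affine.
apply: Ck1D; first exact: Ck1_affine.
by apply: Ck1M; [exact: Ck1_cst|exact: Ck1_affine].
Qed.

(** Convexity of [tau]: its first differences increase because [sigma] does. *)
Lemma bspline_ge0 k y : 0 <= bspline k y.
Proof.
pose g (x : R) := tau (x + 1) - tau (x + 0).
have dg (x : R) : is_derive x 1 g (sigma (x + 1) - sigma (x + 0)).
  by apply: is_deriveB.
have g_homo : {homo g : x y / x <= y}.
  apply: (derive_ge0_mono dg) => x; rewrite subr_ge0; apply: sigma_homo.
  by rewrite lerD2l.
have /g_homo : y - k - 1 <= y - k by rewrite lerBlDr lerDl.
by rewrite /g /bspline !addr0 subrK; lra.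
Qed.

(** On the left all three arguments lie where [tau] vanishes, on the right where it is affine. The
    ramp itself has length 1, hence the asymmetric range. *)
Lemma bspline_far k y : y <= k - 1 \/ k + 2 <= y -> bspline k y = 0.
Proof.
case=> H; rewrite /bspline.
  by rewrite !tau0; lra.
by rewrite !tau1; lra.
Qed.

Lemma bspline_sum N y : 1 <= y -> y <= N%:R - 1 -> \sum_(k < N) bspline k%:R y = 1.
Proof.
move=> y1 yN.
have -> : \sum_(k < N) bspline k%:R y =
    tau (y + 1) - tau y - tau (y - N%:R + 1) + tau (y - N%:R).
  elim: N {yN} => [|N IH]; first by rewrite big_ord0 !subr0; lra.
  rewrite big_ord_recr /= IH /bspline -[N.+1%:R]natr1.
  have -> : y - (N%:R + 1) + 1 = y - N%:R by ring.
  have -> : y - (N%:R + 1) = y - N%:R - 1 by ring.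
  ring.
rewrite (tau0 (x := y - N%:R + 1)) ?(tau0 (x := y - N%:R)); [|lra..].
by rewrite !tau1; lra.
Qed.

(** Summation by parts; the offset [m] of the ramp survives and is later compensated in the choice
    of the centres. *)
Lemma bspline_center N y : 1 <= y -> y <= N%:R - 1 ->
  \sum_(k < N) k%:R * bspline k%:R y = y - m.
Proof.
move=> y1 yN.
have -> : \sum_(k < N) k%:R * bspline k%:R y =
    tau y - N%:R * tau (y - N%:R + 1) + (N%:R - 1) * tau (y - N%:R).
  elim: N {yN} => [|N IH]; first by rewrite big_ord0 !subr0; lra.
  rewrite big_ord_recr /= IH /bspline -[N.+1%:R]natr1.
  have -> : y - (N%:R + 1) + 1 = y - N%:R by ring.
  have -> : y - (N%:R + 1) = y - N%:R - 1 by ring.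
  ring.
rewrite (tau0 (x := y - N%:R + 1)) ?(tau0 (x := y - N%:R)); [|lra..].
by rewrite !tau1//; lra.
Qed.

(** A second difference of the monotone [sigma] is at most the sum of two nonnegative first
    differences, each telescoping to at most 1. *)
Lemma dbspline_sum N y : \sum_(k < N) `|dbspline k%:R y| <= 2.
Proof.
have s01 x : 0 <= sigma x <= 1.
  apply/andP; split.
    have [x0|x0] := leP x 0; first by rewrite sigma0.
    by rewrite -(sigma0 (lexx 0)) sigma_homo// ltW.
  have [x1|x1] := leP 1 x; first by rewrite sigma1.
  by rewrite -(sigma1 (lexx 1)) sigma_homo// ltW.
have H (k : 'I_N) : `|dbspline k%:R y| <= (sigma (y - k%:R + 1) - sigma (y - k%:R)) +
    (sigma (y - k%:R) - sigma (y - k%:R - 1)).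
  have h1 : sigma (y - k%:R) <= sigma (y - k%:R + 1) by apply: sigma_homo; rewrite lerDl.
  have h2 : sigma (y - k%:R - 1) <= sigma (y - k%:R).
    by apply: sigma_homo; rewrite lerBlDr lerDl.
  by apply/ler_normlP; rewrite /dbspline; split; lra.
apply: le_trans (ler_sum _ (fun k _ => H k)) _.
have -> : \sum_(k < N) ((sigma (y - k%:R + 1) - sigma (y - k%:R)) +
    (sigma (y - k%:R) - sigma (y - k%:R - 1))) =
    sigma (y + 1) - sigma (y - N%:R + 1) + sigma y - sigma (y - N%:R).
  elim: N {H} => [|N IH]; first by rewrite big_ord0 !subr0; lra.
  rewrite big_ord_recr /= IH /dbspline -[N.+1%:R]natr1.
  have -> : y - (N%:R + 1) + 1 = y - N%:R by ring.
  have -> : y - (N%:R + 1) = y - N%:R - 1 by ring.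
  ring.
have /andP[? ?] := s01 (y + 1); have /andP[? ?] := s01 (y - N%:R + 1).
have /andP[? ?] := s01 y; have /andP[? ?] := s01 (y - N%:R); lra.
Qed.

End spline.

Lemma partial_coord {R : realType} {n : nat} (g g' : R -> R) (d e : 'I_n)
  (x : 'rV[R]_n) : (forall y : R, is_derive y 1 g (g' y)) ->
  partial d (fun x => g (x ord0 e)) x = g' (x ord0 e) * (d == e)%:R.
Proof. by move=> dg; apply: partialE; exact: is_derive_coord. Qed.

Lemma soft_cells_exist {R : realType} (n : nat) (K : R) : 0 <= K ->
  exists2 A : R, 0 <= A & forall delta, 0 < delta ->
  exists (I : finType) (theta : I -> 'rV[R]_n -> R) (c : I -> 'rV[R]_n),
    soft_cells K A delta theta c.
Proof.
move=> K0.
have [tau [sigma [m [tauk dtau sigma_homo [tau0 sigma0 tau1 sigma1]]]]] := @smooth_ramp R.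
(* A spline lives where [y - k] is between -1 and 2, and its centre is [k + m] in the rescaled
   variable. *)
exists (2 + `|m|) => [|delta delta0]; first by rewrite addr_ge0.
(* The offset [L] maps the range of radius [K + 1] to [1 <= y], and [N] leaves enough indices on the
   right, as the spline sums require. *)
pose L := K + 1 + delta.
pose N := (Num.bound ((2 * K + 2) / delta)).+3.
pose g (k : 'I_N) (r : R) := bspline tau k%:R (delta^-1 * r + L / delta).
pose g' (k : 'I_N) (r : R) := delta^-1 * dbspline sigma k%:R (delta^-1 * r + L / delta).
(* The shift by [m] cancels the offset of [bspline_center], which makes the coordinates reproduced
   exactly. *)
pose ctr (k : 'I_N) := delta * (k%:R + m) - L.
have dg k (r : R) : is_derive r 1 (g k) (g' k r).
  exact: (is_derive_affine _ _ (bspline_derive dtau k%:R)).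
have gk k j : Ck1 j (g k) by apply: Ck1_affine; exact: bspline_smooth.
have g_ge0 k r : 0 <= g k r by exact: (bspline_ge0 dtau sigma_homo).
have yE r k : r - ctr k = delta * (delta^-1 * r + L / delta - k%:R - m).
  by rewrite /ctr; field; rewrite gt_eqF.
have g_far k r : (2 + `|m|) * delta < `|r - ctr k| -> g k r = 0.
  rewrite yE normrM gtr0_norm// mulrC ltr_pM2l// => H.
  apply: (bspline_far tau0 tau1).
  have := ler_norm m; have := ler_norm (- m); rewrite normrN => m1 m2.
  set y := delta^-1 * r + _ in H *.
  have [y1|y1] := leP y (k%:R - 1); [by left|right].
  rewrite leNgt; apply/negP => y2.
  by move: H; rewrite ltNge => /negP; apply; apply/ler_normlP; split; lra.
have y_range r : `|r| < K + 1 ->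
    1 <= delta^-1 * r + L / delta /\ delta^-1 * r + L / delta <= N%:R - 1.
  move=> /ltr_normlP[r1 r2].
  have -> : delta^-1 * r + L / delta = (r + K + 1) / delta + 1.
    by rewrite /L; field; rewrite gt_eqF.
  split; first by rewrite lerDr divr_ge0 ?(ltW delta0)//; lra.
  have : (r + K + 1) / delta <= (2 * K + 2) / delta.
    by rewrite ler_pM2r ?invr_gt0//; lra.
  have b0 : 0 <= (2 * K + 2) / delta by rewrite divr_ge0 ?(ltW delta0)//; lra.
  have := archi_boundP b0; rewrite /N -!natr1 => ? ?; lra.
have g_sum r : `|r| < K + 1 -> \sum_k g k r = 1.
  by move=> /y_range[y1 y2]; exact: (bspline_sum tau0 tau1 y1 y2).
have g_center r : `|r| < K + 1 -> \sum_k ctr k * g k r = r.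
  move=> rK; have [y1 y2] := y_range _ rK.
  transitivity (delta * (\sum_(k < N) k%:R * g k r) + (delta * m - L) * \sum_k g k r).
    rewrite !mulr_sumr -big_split; apply: eq_bigr => k _ /=; rewrite /ctr; ring.
  have -> : \sum_(k < N) k%:R * g k r = delta^-1 * r + L / delta - m.
    exact: (bspline_center tau0 tau1 y1 y2).
  rewrite g_sum//; field; by rewrite gt_eqF.
have g'_sum r : \sum_(k < N) `|g' k r| <= 2 / delta.
  rewrite /g'; under eq_bigr do rewrite normrM gtr0_norm ?invr_gt0//.
  rewrite -mulr_sumr mulrC ler_pM2r ?invr_gt0//.
  exact: dbspline_sum.
pose theta (i : {ffun 'I_n -> 'I_N}) (x : 'rV[R]_n) := \prod_d g (i d) (x ord0 d).
pose c (i : {ffun 'I_n -> 'I_N}) : 'rV[R]_n := \row_d ctr (i d).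
have theta_smooth i : smooth (theta i).
  by apply: smooth_prod => d k; exact: is_Ck_coord.
have theta_far i (x : 'rV[R]_n) d : (2 + `|m|) * delta < `|x ord0 d - c i ord0 d| -> theta i x = 0.
  by rewrite mxE => H; rewrite /theta (bigD1 d)//= g_far// mul0r.
have thetaE i (x : 'rV[R]_n) d : partial d (theta i) x =
    g' (i d) (x ord0 d) * \prod_(e | e != d) g (i e) (x ord0 e).
  (* Replacing the factor [d] by 1 turns the partial product into a full one that does not depend on
     the coordinate [d]. *)
  pose h e (x : 'rV[R]_n) := if e == d then 1 else g (i e) (x ord0 e).
  have hs e : smooth (h e).
    rewrite /h; case: eqP => _; first exact: smooth_cst.
    by move=> k; exact: is_Ck_coord.
  have hP (x' : 'rV[R]_n) : \prod_(e | e != d) g (i e) (x' ord0 e) = \prod_e h e x'.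
    by rewrite /h big_mkcond; apply: eq_bigr => e _; case: eqP.
  have -> : theta i = fun x => g (i d) (x ord0 d) * \prod_e h e x.
    by apply/funext => x'; rewrite /theta (bigD1 d)//= hP.
  have h0 (r : seq 'I_n) : partial d (fun x => \prod_(e <- r) h e x) x = 0.
    elim: r => [|e r IH].
      by under eq_fun do rewrite big_nil; rewrite partial_cst.
    under eq_fun do rewrite big_cons.
    rewrite partialM ?IH ?mulr0 ?add0r//; last exact: smooth_prod.
    rewrite /h; case: eqP => [_|/eqP ed]; first by rewrite partial_cst mulr0.
    by rewrite (partial_coord _ _ _ (dg (i e))) eq_sym (negbTE ed) !mulr0.
  rewrite partialM ?h0 ?mulr0 ?add0r; last exact: smooth_prod.
    by rewrite (partial_coord _ _ _ (dg (i d))) eqxx mulr1 mulrC hP.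
  by move=> k; exact: is_Ck_coord.
have theta_sum (x : 'rV[R]_n) : (forall d, `|x ord0 d| < K + 1) -> \sum_i theta i x = 1.
  move=> xK; rewrite /theta -(bigA_distr_bigA (fun d k => g k (x ord0 d))).
  by rewrite big1// => d _; exact: g_sum.
have theta_center (x : 'rV[R]_n) e : (forall d, `|x ord0 d| < K + 1) ->
    \sum_i c i ord0 e * theta i x = x ord0 e.
  move=> xK.
  transitivity (\sum_(i : {ffun 'I_n -> 'I_N})
      \prod_d ((if d == e then ctr (i d) else 1) * g (i d) (x ord0 d))).
    apply: eq_bigr => i _; rewrite big_split /= mxE; congr (_ * _).
    by rewrite (bigD1 e)//= eqxx big1 ?mulr1// => d /negbTE ->.
  rewrite -(bigA_distr_bigA (fun d k => (if d == e then ctr k else 1) * g k (x ord0 d))).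
  rewrite (bigD1 e)//= eqxx g_center// big1 ?mulr1// => d /negbTE ->.
  by under eq_bigr do rewrite mul1r; exact: g_sum.
(* The sums are known on an open box, so they can be differentiated at every point of the closed box
   of radius [K]. *)
have near_box (x : 'rV[R]_n) : (forall d, `|x ord0 d| <= K) ->
    nbhs x [set y : 'rV[R]_n | forall d, `|y ord0 d| < K + 1].
  move=> xK.
  have all_d := @filter_forall 'rV[R]_n 'I_n
    (fun d => [set y : 'rV[R]_n | `|y ord0 d| < K + 1]) (nbhs x) _.
  apply: all_d => d.
  have cd : {for x, continuous (fun x : 'rV[R]_n => `|x ord0 d|)}.
    apply: (@continuous_comp _ _ _ (fun x : 'rV[R]_n => x ord0 d) Num.norm).
      exact: coord_continuous.
    exact: norm_continuous.
  have xd : `|x ord0 d| < K + 1 by rewrite (le_lt_trans (xK d))// ltrDl.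
  exact: cd _ (lt_nbhsl xd).
exists {ffun 'I_n -> 'I_N}, theta, c.
have Ccoo_theta i : supp (theta i) `<=`
    [set x : 'rV[R]_n | forall d, x ord0 d \in `[c i ord0 d - (2 + `|m|) * delta, c i ord0 d + (2 + `|m|) * delta]]
    /\ Ccoo setT (theta i).
  set B := [set x | _].
  have cB : compact B.
    pose S d := [set` `[c i ord0 d - (2 + `|m|) * delta, c i ord0 d + (2 + `|m|) * delta]].
    by apply: (@rV_compact R n S) => d; exact: segment_compact.
  have clB : closed B by apply: compact_closed => //; exact: norm_hausdorff.
  have BE x : ~ B x -> theta i x = 0.
    move=> /existsNP[d /negP]; rewrite in_itv /= -ler_distl -ltNge.
    exact: theta_far.
  split; first exact: supp_sub.
  exact: smooth_Ccoo cB clB BE.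
split.
- by move=> i; have [] := Ccoo_theta i.
- by move=> i x; apply: prodr_ge0.
- exact: theta_far.
- move=> i x d e xd; apply: partial_notin_supp => /(proj1 (Ccoo_theta i)) /(_ d).
  by rewrite in_itv /= -ler_distl leNgt xd.
- by move=> x xK; apply: theta_sum => d; rewrite (le_lt_trans (xK d))// ltrDl.
- move=> x d xK; rewrite -partial_sum//; apply: partialE.
  have H := is_derive_cst (1 : R) x (delta_mx ord0 d).
  apply: near_eq_is_derive H; apply: filterS (near_box _ xK) => y yK.
  by rewrite theta_sum.
- move=> x d e xK.
  transitivity (partial d (fun x => \sum_i c i ord0 e * theta i x) x).
    rewrite partial_sum; first by apply: eq_bigr => i _; rewrite partialZ.
    by move=> i; apply: smoothM => //; exact: smooth_cst.
  apply: partialE.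
  have H := @is_derive_coord _ _ id 1 e d x (is_derive_id _ _).
  rewrite mul1r in H.
  apply: near_eq_is_derive H; apply: filterS (near_box _ xK) => y yK.
  by rewrite theta_center.
- move=> x d xK.
  (* Distributing the product over the coordinates leaves one factor bounded by [2 / delta]; each of
     the others sums to 1. *)
  have -> : \sum_i `|partial d (theta i) x| = \sum_(i : {ffun 'I_n -> 'I_N}) \prod_e
     (if e == d then `|g' (i e) (x ord0 e)| else g (i e) (x ord0 e)).
    apply: eq_bigr => i _; rewrite thetaE normrM [RHS](bigD1 d)//= eqxx; congr (_ * _).
    rewrite ger0_norm; last exact: prodr_ge0.
    by apply: eq_bigr => e /negbTE ->.
  rewrite -(bigA_distr_bigA (fun e k => if e == d then `|g' k (x ord0 e)| else g k (x ord0 e))).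
  rewrite (bigD1 d)//= eqxx [X in _ * X]big1 ?mulr1//.
  by move=> e /negbTE ->; apply: g_sum; rewrite (le_lt_trans (xK e))// ltrDl.
Qed.

(** * From a matrix on the cells to a self-coupling *)

Section density.
Context d (T : measurableType d) (R : realType) (Q : probability T R) (q : T -> R).
Hypotheses (eq : essb Q q) (q_ge0 : forall x, 0 <= q x) (q1 : \int[Q]_x q x = 1).

Let dens (A : set T) : \bar R := (\int[Q]_(x in A) (q x)%:E)%E.

Let mq : measurable_fun setT (fun x => (q x)%:E).
Proof. by apply/measurable_EFinP; case: eq. Qed.

Let dens0 : dens set0 = 0%E. Proof. by rewrite /dens integral_set0. Qed.

Let dens_ge0 A : (0 <= dens A)%E.
Proof. by apply: integral_ge0 => x _; rewrite lee_fin. Qed.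

Let dens_sigma_additive : semi_sigma_additive dens.
Proof.
move=> /= F mF tF mUF; rewrite /dens; apply: cvg_toP.
  apply: ereal_nondecreasing_is_cvgn => m n mn.
  by apply: lee_sum_nneg_natr => // k _ _; exact: dens_ge0.
rewrite ge0_integral_bigcup//=.
- exact: measurable_funTS.
- by move=> x _; rewrite lee_fin.
Qed.

Let dens_setT : dens setT = 1%E.
Proof. by rewrite /dens essb_EFin// q1. Qed.

(** The integral formula holds for the Radon-Nikodym derivative of the new measure, which coincides
    with [q] almost everywhere since both integrate to it over measurable sets. *)
Lemma density_probability : exists2 gam : probability T R,
  forall A, measurable A -> gam A = (\int[Q]_(x in A) (q x)%:E)%E &
  forall f : T -> \bar R, measurable_fun setT f -> (forall x, 0 <= f x)%E ->
    (\int[gam]_x f x = \int[Q]_x (f x * (q x)%:E))%E.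
Proof.
pose dm := isMeasure.Build _ _ _ dens dens0 dens_ge0 dens_sigma_additive.
pose nu : {measure set T -> \bar R} := HB.pack dens dm.
pose pm := Measure_isProbability.Build _ _ R nu dens_setT.
pose gam : probability T R := HB.pack dens dm pm.
exists gam => // f mf f0.
have dom : gam `<< Q.
  apply/null_content_dominatesP => A mA QA0.
  rewrite /gam /= /dens; apply: null_set_integral => //.
  exact: measurable_funTS.
rewrite -(Radon_Nikodym_SigmaFinite.change_of_variables dom f0 measurableT mf).
set g := Radon_Nikodym_SigmaFinite.f _ _.
have mg : measurable_fun setT g.
  exact: measurable_int (Radon_Nikodym_SigmaFinite.f_integrable dom).
apply: ae_eq_integral => //; try exact: emeasurable_funM.
have gq : ae_eq Q setT g (fun x => (q x)%:E).
  apply: integral_ae_eq => //; first exact: Radon_Nikodym_SigmaFinite.f_integrable.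
  by move=> E _ mE; rewrite -Radon_Nikodym_SigmaFinite.f_integral.
by apply: filterS gq => x /(_ I) gx _; rewrite gx.
Qed.

Lemma density_Rint : exists2 gam : probability T R,
  forall A, measurable A -> gam A = (\int[Q]_(x in A) (q x)%:E)%E &
  forall f : T -> R, essb Q f -> essb gam f /\
    \int[gam]_x f x = \int[Q]_x (f x * q x).
Proof.
have [gam gamA gamf] := density_probability; exists gam => // f ef.
have gam_ae (S : T -> Prop) : {ae Q, forall x, S x} -> {ae gam, forall x, S x}.
  move=> [N [mN N0 SN]]; exists N; split => //; rewrite gamA//.
  by apply: null_set_integral => //; exact: measurable_funTS.
have [mf [M fM]] := ef.
have egf : essb gam f by split => //; exists M; exact: gam_ae.
split => //.
(* The shift by the essential bound makes [f] nonnegative almost everywhere and the maximum makes it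
   so everywhere, so that the formula for nonnegative integrands applies. *)
pose g x := Num.max (f x + M) 0.
have gE x : `|f x| <= M -> g x = f x + M.
  by move=> /ler_normlP[fM1 _]; rewrite /g max_l//; lra.
have mg : measurable_fun setT g.
  apply: measurable_maxr => //; apply: measurable_funD => //.
have g0 x : 0 <= g x by rewrite /g le_max lexx orbT.
have aeg : {ae Q, forall x, g x = f x + M} by apply: filterS fM => x /gE.
have egam : essb gam (fun x => f x + M) by apply: essbD => //; exact: essb_cst.
have efq : essb Q (fun x => f x * q x) by exact: essbM.
have eMq : essb Q (fun x => M * q x) by exact: essbZ.
suff : \int[gam]_x (f x + M) = \int[Q]_x (f x * q x + M * q x).
  rewrite !RintD//; last exact: essb_cst.
  by rewrite Rint_cst RintZ// q1 mulr1 => /addIr.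
transitivity (\int[gam]_x g x).
  apply: Rint_ae_eq => //; first by case: egam.
  by apply: filterS (gam_ae _ aeg) => x ->.
transitivity (\int[Q]_x (g x * q x)).
  have mgE : measurable_fun setT (fun x => (g x)%:E) by exact/measurable_EFinP.
  have gE0 x : (0 <= (g x)%:E)%E by rewrite lee_fin.
  by rewrite /Rintegral (gamf _ mgE gE0).
apply: Rint_ae_eq.
- by apply: measurable_funM => //; case: eq.
- by case: (essbD efq eMq).
- by apply: filterS aeg => x ->; rewrite mulrDl.
Qed.

End density.

Section soft_coupling.
Context {R : realType} {n : nat} (mu : probability 'rV[R]_n R).
Variables (S : set 'rV[R]_n) (I : finType) (theta : I -> 'rV[R]_n -> R) (p : I -> R)
  (M : I -> I -> R).
Hypotheses (mu_S : {ae mu, forall x, S x})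
  (etheta : forall i, essb mu (theta i)) (theta_ge0 : forall i x, 0 <= theta i x)
  (theta_sum : forall x, S x -> \sum_i theta i x = 1)
  (pE : forall i, p i = \int[mu]_x theta i x)
  (M_ge0 : forall i j, 0 <= M i j) (M_row : forall i, \sum_j M i j = p i)
  (M_col : forall j, \sum_i M i j = p j).

Local Notation Rn := 'rV[R]_n.
Let Q : probability (Rn * Rn)%type R := (mu \x mu)%E.

Let QE A B : measurable A -> measurable B -> Q (A `*` B) = (mu A * mu B)%E.
Proof. by move=> mA mB; rewrite /Q /= product_measure1E. Qed.

Lemma product_coupling : coupling mu mu Q.
Proof.
move=> A mA; rewrite !QE//.
by split; rewrite probability_setT ?mule1 ?mul1e.
Qed.

Let Q_ae : {ae Q, forall z, S z.1 /\ S z.2}.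
Proof.
have h1 := transports_ae (coupling_fst product_coupling) mu_S.
have h2 := transports_ae (coupling_snd product_coupling) mu_S.
by apply: filterS2 h1 h2.
Qed.

Lemma essb_prod (f g : Rn -> R) : essb mu f -> essb mu g ->
  essb Q (fun z => f z.1 * g z.2).
Proof.
by move=> ef eg; apply: essbM; [exact: (coupling_essb1 product_coupling ef)|
                                exact: (coupling_essb2 product_coupling eg)].
Qed.

Lemma Rint_prod (f g : Rn -> R) : essb mu f -> essb mu g ->
  (forall x, 0 <= f x) -> (forall x, 0 <= g x) ->
  \int[Q]_z (f z.1 * g z.2) = \int[mu]_x f x * \int[mu]_x g x.
Proof.
move=> ef eg f0 g0; have [mf _] := ef; have [mg _] := eg.
apply: EFin_inj; rewrite -(essb_EFin (essb_prod ef eg)) EFinM.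
rewrite (fubini_tonelli1 (fun z : Rn * Rn => (f z.1 * g z.2)%:E)).
- rewrite -[X in (_ * X)%E]essb_EFin// -[X in (X * _)%E]essb_EFin//.
  rewrite -ge0_integralZr//; last 3 first.
  + exact/measurable_EFinP.
  + by move=> x _; rewrite lee_fin.
  + by apply: integral_ge0 => x _; rewrite lee_fin.
  apply: eq_integral => x _; rewrite /fubini_F /=.
  under eq_integral do rewrite EFinM.
  rewrite ge0_integralZl//; last 2 first.
  + by move=> y _; rewrite lee_fin.
  + by rewrite lee_fin.
  exact/measurable_EFinP.
- by apply/measurable_EFinP; case: (essb_prod ef eg).
- by move=> z; rewrite lee_fin mulr_ge0.
Qed.

Let m i j : R := M i j / (p i * p j).
Let q (z : Rn * Rn) : R := \sum_i \sum_j m i j * (theta i z.1 * theta j z.2).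

Let p_ge0 i : 0 <= p i.
Proof. by rewrite pE; exact: Rintegral_ge0. Qed.

Let m_ge0 i j : 0 <= m i j.
Proof. by rewrite divr_ge0// mulr_ge0. Qed.

(** If [p i * p j = 0], a vanishing row or column sum of nonnegative entries forces [M i j = 0], so
    the inverse of 0 in [m] is harmless. *)
Let mp i j : m i j * (p i * p j) = M i j.
Proof.
have [p0|p0] := eqVneq (p i * p j) 0; last by rewrite /m divfK.
rewrite p0 mulr0; apply/esym/eqP; rewrite eq_le M_ge0 andbT.
move/eqP: p0; rewrite mulf_eq0 => /orP[/eqP pi0|/eqP pj0].
  by rewrite -pi0 -M_row (bigD1 j)//= lerDl sumr_ge0.
by rewrite -pj0 -M_col (bigD1 i)//= lerDl sumr_ge0.
Qed.

Let q_ge0 z : 0 <= q z.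
Proof.
by apply: sumr_ge0 => i _; apply: sumr_ge0 => j _; rewrite mulr_ge0// mulr_ge0.
Qed.

Let e_ij i j c : essb Q (fun z => c * (theta i z.1 * theta j z.2)).
Proof. by apply: essbZ; exact: essb_prod. Qed.

Let eq : essb Q q.
Proof. by apply: essb_sum => i; apply: essb_sum => j. Qed.

Let int_sum (c : I -> I -> R) :
  \int[Q]_z (\sum_i \sum_j c i j * (theta i z.1 * theta j z.2)) =
  \sum_i \sum_j c i j * (p i * p j).
Proof.
rewrite Rint_sum; last by move=> i; exact: essb_sum.
apply: eq_bigr => i _; rewrite Rint_sum//; apply: eq_bigr => j _.
by rewrite RintZ ?Rint_prod -?pE//; exact: essb_prod.
Qed.

Let p_sum : \sum_i p i = 1.
Proof.
under eq_bigr do rewrite pE; rewrite -Rint_sum// -[RHS](Rint_cst mu 1).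
apply: Rint_ae_eq; [by case: (essb_sum (index_enum _) etheta)|exact: measurable_cst|].
by apply: filterS mu_S => x /theta_sum.
Qed.

Let q1 : \int[Q]_z q z = 1.
Proof.
rewrite /q int_sum -[RHS]p_sum; apply: eq_bigr => i _.
by rewrite -[RHS]M_row; apply: eq_bigr => j _; rewrite mp.
Qed.

Let m_row i : p i * (\sum_j m i j * p j) = p i.
Proof. by rewrite mulr_sumr -[RHS]M_row; apply: eq_bigr => j _; rewrite -mp; ring. Qed.

Let m_col j : p j * (\sum_i m i j * p i) = p j.
Proof. by rewrite mulr_sumr -[RHS]M_col; apply: eq_bigr => i _; rewrite -mp; ring. Qed.

(* If p i = 0 then theta i vanishes almost everywhere, which takes care of the
   junk value of the inverse in m. *)
Let theta_p0 i : p i = 0 -> {ae mu, forall x, theta i x = 0}.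
Proof.
move=> p0; have H : (\int[mu]_x (theta i x)%:E = 0)%E by rewrite essb_EFin// -pE p0.
have [mt _] := etheta i.
have : ae_eq mu setT (fun x => (theta i x)%:E) (cst 0%E).
  apply/(ae_eq_integral_abs mu measurableT); first exact/measurable_EFinP.
  by rewrite -[RHS]H; apply: eq_integral => x _; rewrite gee0_abs// lee_fin.
by apply: filterS => x /(_ Logic.I) [].
Qed.

Let marginal (w : I -> R) : (forall i, p i * w i = p i) ->
  {ae mu, forall x, \sum_i w i * theta i x = 1}.
Proof.
move=> wp.
have H i : {ae mu, forall x, w i * theta i x = theta i x}.
  have [p0|p0] := eqVneq (p i) 0.
    by apply: filterS (theta_p0 p0) => x ->; rewrite mulr0.
  suff -> : w i = 1 by apply: aeW => x; rewrite mul1r.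
  by apply: (mulfI p0); rewrite wp mulr1.
have : {ae mu, forall x, forall i, w i * theta i x = theta i x}.
  exact: filter_forall.
by apply: filterS2 mu_S => x xS Hx; rewrite -(theta_sum xS); apply: eq_bigr.
Qed.

(** Under the density [q], integrating out y leaves [\sum_i w i * theta i x] with
    [w i = \sum_j m i j * p j]. This weight is 1 where [p i] is nonzero, and the other cells are
    negligible, so the marginal is [mu] exactly. Integrals are estimated cell by cell. *)
Lemma soft_coupling : exists2 gam : probability (Rn * Rn)%type R,
  coupling mu mu gam &
  forall (G : Rn * Rn -> R) (g : I -> I -> R), essb Q G ->
    (forall i j x y, S x -> S y -> theta i x != 0 -> theta j y != 0 -> G (x, y) <= g i j) ->
    \int[gam]_z G z <= \sum_i \sum_j M i j * g i j.
Proof.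
have [gam gamA gamf] := density_Rint eq q_ge0 q1; exists gam.
  move=> A mA.
  have mI : essb mu \1_A.
    split; first exact: measurable_indic.
    by exists 1; apply: aeW => x; rewrite indicE; case: (_ \in _); rewrite ?normr1 ?normr0.
  have IA1 : essb Q (fun z => \1_A z.1) by exact: (coupling_essb1 product_coupling mI).
  have IA2 : essb Q (fun z => \1_A z.2) by exact: (coupling_essb2 product_coupling mI).
  have muA : mu A = (\int[mu]_x \1_A x)%:E.
    by rewrite -essb_EFin// integral_indic ?setIT.
  have gamE (B : set (Rn * Rn)) : measurable B -> essb Q \1_B ->
      gam B = (\int[Q]_z (\1_B z * q z))%:E.
    move=> mB eB; have [eB' <-] := gamf _ eB.
    by rewrite -essb_EFin// integral_indic ?setIT.
  have i1 : \1_(A `*` setT) = (fun z : Rn * Rn => \1_A z.1 : R).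
    by apply/funext => z; rewrite !indicE in_setX in_setT andbT.
  have i2 : \1_(setT `*` A) = (fun z : Rn * Rn => \1_A z.2 : R).
    by apply/funext => z; rewrite !indicE in_setX in_setT.
  have indic0 x : 0 <= \1_A x :> R by rewrite indicE ler0n.
  have expand (f g : Rn -> R) : essb mu f -> essb mu g ->
     (forall x, 0 <= f x) -> (forall x, 0 <= g x) ->
     \int[Q]_z (f z.1 * g z.2 * q z) =
      \sum_i \sum_j m i j * (\int[mu]_x (f x * theta i x) * \int[mu]_x (g x * theta j x)).
    move=> ef eg f0 g0.
    transitivity (\int[Q]_z (\sum_i \sum_j
        m i j * ((f z.1 * theta i z.1) * (g z.2 * theta j z.2)))).
      apply: eq_Rintegral => z _; rewrite /q mulr_sumr; apply: eq_bigr => i _.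
      by rewrite mulr_sumr; apply: eq_bigr => j _; ring.
    have ez i j : essb Q (fun z => m i j * ((f z.1 * theta i z.1) * (g z.2 * theta j z.2))).
      apply: essbZ.
      by apply: (@essb_prod (fun x => f x * theta i x) (fun y => g y * theta j y)); exact: essbM.
    rewrite Rint_sum; last by move=> i; exact: essb_sum.
    apply: eq_bigr => i _; rewrite Rint_sum//; apply: eq_bigr => j _.
    rewrite RintZ; last first.
      by apply: (@essb_prod (fun x => f x * theta i x) (fun y => g y * theta j y)); exact: essbM.
    congr (_ * _).
    rewrite (@Rint_prod (fun x => f x * theta i x) (fun y => g y * theta j y))//;
      try exact: essbM.
    - by move=> x; rewrite mulr_ge0.
    - by move=> x; rewrite mulr_ge0.
  have e1 : essb mu (fun=> 1) by exact: essb_cst.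
  have int1 i : \int[mu]_x (1 * theta i x) = p i.
    by rewrite pE; apply: eq_Rintegral => x _; rewrite mul1r.
  have final (w : I -> R) : (forall i, p i * w i = p i) ->
      \sum_i w i * \int[mu]_x (\1_A x * theta i x) = \int[mu]_x \1_A x.
    move=> wp.
    transitivity (\int[mu]_x (\sum_i w i * (\1_A x * theta i x))).
      rewrite Rint_sum; first by apply: eq_bigr => i _; rewrite RintZ//; exact: essbM.
      by move=> i; apply: essbZ; exact: essbM.
    apply: Rint_ae_eq.
    - have : essb mu (fun x => \sum_i w i * (\1_A x * theta i x)).
        by apply: essb_sum => i; apply: essbZ; exact: essbM.
      by case.
    - by case: mI.
    - apply: filterS (marginal wp) => x Hx; rewrite -[RHS]mulr1 -Hx mulr_sumr.
      by apply: eq_bigr => i _; ring.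
  split.
  - rewrite gamE ?i1//; last exact: measurableX.
    rewrite muA; congr EFin.
    transitivity (\int[Q]_z (\1_A z.1 * (fun=> 1) z.2 * q z)).
      by apply: eq_Rintegral => z _; rewrite mulr1.
    rewrite (@expand \1_A (fun=> 1))//.
    rewrite -[RHS](final _ m_row); apply: eq_bigr => i _; rewrite mulr_suml.
    by apply: eq_bigr => j _; rewrite int1; ring.
  - rewrite gamE ?i2//; last exact: measurableX.
    rewrite muA; congr EFin.
    transitivity (\int[Q]_z ((fun=> 1) z.1 * \1_A z.2 * q z)).
      by apply: eq_Rintegral => z _; rewrite mul1r.
    rewrite (@expand (fun=> 1) \1_A)//.
    rewrite -[RHS](final _ m_col) exchange_big; apply: eq_bigr => j _ /=.
    by rewrite mulr_suml; apply: eq_bigr => i _; rewrite int1; ring.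
move=> G g eG Gg; have [_ ->] := gamf _ eG.
have -> : \sum_i \sum_j M i j * g i j =
    \int[Q]_z (\sum_i \sum_j (m i j * g i j) * (theta i z.1 * theta j z.2)).
  rewrite int_sum; apply: eq_bigr => i _; apply: eq_bigr => j _.
  by rewrite -mp; ring.
apply: le_Rint_ae.
- exact: essbM.
- by apply: essb_sum => i; apply: essb_sum => j.
- apply: filterS Q_ae => -[x y] /= [xS yS]; rewrite /q mulr_sumr.
  apply: ler_sum => i _; rewrite mulr_sumr; apply: ler_sum => j _ /=.
  have [t0|t0] := eqVneq (theta i x) 0; first by rewrite t0 !(mul0r, mulr0).
  have [t1|t1] := eqVneq (theta j y) 0; first by rewrite t1 !(mul0r, mulr0).
  have := Gg i j x y xS yS t0 t1 => H.
  have w0 : 0 <= m i j * (theta i x * theta j y) by rewrite mulr_ge0// mulr_ge0.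
  by have := ler_wpM2r w0 H; lra.
Qed.

End soft_coupling.

(** * Circulating self-couplings *)

Section projection.
Context {R : realType} {n : nat} (mu : probability 'rV[R]_n R).
Local Notation Rn := 'rV[R]_n.
Implicit Types (G H u v : Rn -> Rn) (f g eta : Rn -> R).

Definition L2dot u v : R := \int[mu]_x dotv (u x) (v x).
Local Notation ip := L2dot.

Let ipBl u v w : essbv mu u -> essbv mu v -> essbv mu w ->
  ip (fun x => u x - v x) w = ip u w - ip v w.
Proof.
move=> eu ev ew; rewrite /L2dot -RintB; [|exact: essb_dotv..].
by apply: eq_Rintegral => x _; rewrite dotvBl.
Qed.

Let ipBr u v w : essbv mu u -> essbv mu v -> essbv mu w ->
  ip w (fun x => u x - v x) = ip w u - ip w v.
Proof.
move=> eu ev ew; rewrite /L2dot -RintB; [|exact: essb_dotv..].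
by apply: eq_Rintegral => x _; rewrite dotvBr.
Qed.

Let ipZl (c : R) u w : essbv mu u -> essbv mu w ->
  ip (fun x => c *: u x) w = c * ip u w.
Proof.
move=> eu ew; rewrite /L2dot -RintZ; last exact: essb_dotv.
by apply: eq_Rintegral => x _; rewrite dotvZl.
Qed.

Let ip_eq0 u v : essbv mu u -> essbv mu v -> ip v v = 0 -> ip u v = 0.
Proof.
move=> eu ev v0; set b := ip u v; set A := ip u u.
have A0 : 0 <= A by apply: Rintegral_ge0 => x _; exact: sqnorm_ge0.
have H (eps : R) : 2 * eps * b <= eps ^+ 2 * A.
  rewrite /b /A /L2dot -RintZ; last exact: essb_dotv.
  have -> : eps ^+ 2 * \int[mu]_x dotv (u x) (u x) = \int[mu]_x (eps ^+ 2 / 1 * sqnorm (u x) + 1 * sqnorm (v x)).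
    rewrite RintD; [|by apply: essbZ; exact: essb_sqnorm..].
    rewrite !RintZ; [|exact: essb_sqnorm..].
    have -> : \int[mu]_x sqnorm (v x) = 0 by exact: v0.
    by rewrite mulr0 addr0 divr1.
  apply: le_Rint => [||x]; last exact: dotv_young.
    by apply: essbZ; exact: essb_dotv.
  by apply: essbD; apply: essbZ; exact: essb_sqnorm.
have A1 : 0 < A + 1 by rewrite ltr_wpDl.
apply/eqP/negPn/negP => b0.
have b2 : 0 < b ^+ 2 by rewrite exprn_even_gt0.
(* If [b] were nonzero, this value of eps would give [2 * (A + 1) <= A]. *)
have := H (b / (A + 1)); rewrite -(ler_pM2r (exprn_gt0 2 A1)).
have -> : 2 * (b / (A + 1)) * b * (A + 1) ^+ 2 = 2 * (b ^+ 2) * (A + 1).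
  by field; rewrite gt_eqF.
have -> : (b / (A + 1)) ^+ 2 * A * (A + 1) ^+ 2 = b ^+ 2 * A.
  by field; rewrite gt_eqF.
nra.
Qed.

Lemma gradDZ (c : R) f g x : smooth f -> smooth g ->
  grad (fun x => f x + c * g x) x = grad f x + c *: grad g x.
Proof.
move=> fs gs; apply/rowP => i; rewrite !mxE partialD ?partialZ//.
by apply: smoothM => //; exact: smooth_cst.
Qed.

(** Gram-Schmidt along the list: [zeta] projects the new gradient on the previous ones. The last
    clause says by duality that [grad eta] lies in the span; applied to the residual itself, it
    gives orthogonality to [grad eta]. *)
Lemma grad_projection (J : eqType) (g : J -> Rn -> R) (r : seq J) G :
  (forall j, Ccoo setT (g j)) -> essbv mu G ->
  exists eta, [/\ Ccoo setT eta,
    {in r, forall j, ip (fun x => G x - grad eta x) (grad (g j)) = 0} &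
    forall H, essbv mu H -> {in r, forall j, ip H (grad (g j)) = 0} ->
      ip H (grad eta) = 0].
Proof.
move=> gC; elim: r G => [|j r IH] G eG.
  exists (fun=> 0); split; [exact: Ccoo0|by move=> j; rewrite in_nil|move=> H eH _].
  rewrite /L2dot -[RHS](Rint_cst mu 0); apply: eq_Rintegral => x _.
  rewrite /dotv big1// => i _; by rewrite mxE partial_cst mulr0.
have egj := grad_essbv mu (gC j).
have [eta1 [eta1C G_orth eta1_span]] := IH G eG.
have [zeta [zetaC gj_orth zeta_span]] := IH _ egj.
have ee1 := grad_essbv mu eta1C; have ez := grad_essbv mu zetaC.
pose G' x := G x - grad eta1 x; pose u x := grad (g j) x - grad zeta x.
have eG' : essbv mu G' by exact: essbvB.
have eu : essbv mu u by exact: essbvB.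
have split_gj H : essbv mu H -> {in r, forall k, ip H (grad (g k)) = 0} ->
    ip H (grad (g j)) = ip H u.
  by move=> eH Hr; rewrite (ipBr egj ez eH) (zeta_span H eH Hr) subr0.
(* If the new gradient adds no direction up to a null set, [eta1] already serves; otherwise [lam]
   may divide by [ip u u]. *)
have [a0|a0] := eqVneq (ip u u) 0.
  exists eta1; split; [exact: eta1C|move=> k|move=> H eH Hr].
    rewrite inE => /predU1P[->|kr]; last exact: G_orth.
    by rewrite (split_gj _ eG' G_orth) (ip_eq0 eG' eu a0).
  by apply: (eta1_span H eH) => k kr; apply: Hr; rewrite inE kr orbT.
pose lam := ip G' u / ip u u.
pose eta x := eta1 x + lam * (g j x + (-1) * zeta x).
have g'C : Ccoo setT (fun x => g j x + (-1) * zeta x).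
  by apply: CcooD => //; apply: CcooMl => //; exact: smooth_cst.
have etaC : Ccoo setT eta.
  by apply: CcooD => //; apply: CcooMl => //; exact: smooth_cst.
have gradE x : grad eta x = grad eta1 x + lam *: u x.
  rewrite gradDZ; [|exact: Ccoo_smooth eta1C|exact: Ccoo_smooth g'C].
  rewrite gradDZ; [|exact: Ccoo_smooth (gC j)|exact: Ccoo_smooth zetaC].
  by rewrite scaleN1r.
have resE : (fun x => G x - grad eta x) = (fun x => G' x - lam *: u x).
  by apply/funext => x; rewrite gradE opprD addrA.
have eres : essbv mu (fun x => G' x - lam *: u x) by apply: essbvB => //; exact: essbvZ.
have elu : essbv mu (fun x => lam *: u x) by exact: essbvZ.
have res_r : {in r, forall k, ip (fun x => G' x - lam *: u x) (grad (g k)) = 0}.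
  move=> k kr; have egk := grad_essbv mu (gC k).
  by rewrite (ipBl eG' elu egk) (ipZl lam eu egk) (G_orth k kr) (gj_orth k kr) mulr0 subr0.
exists eta; split; [exact: etaC|move=> k|move=> H eH Hr].
  rewrite resE inE => /predU1P[->|kr]; last exact: res_r.
  rewrite (split_gj _ eres res_r) (ipBl eG' elu eu) (ipZl lam eu eu).
  by rewrite /lam divfK// subrr.
have Hr' : {in r, forall k, ip H (grad (g k)) = 0}.
  by move=> k kr; apply: Hr; rewrite inE kr orbT.
have eNlu : essbv mu (fun x => (- lam) *: u x) by exact: essbvZ.
have -> : ip H (grad eta) = ip H (fun x => grad eta1 x - (- lam) *: u x).
  by congr ip; apply/funext => x; rewrite gradE scaleNr opprK.
rewrite (ipBr ee1 eNlu eH) (eta1_span H eH Hr') sub0r.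
have ipC v w : ip v w = ip w v by apply: eq_Rintegral => x _; rewrite dotvC.
rewrite ipC (ipZl _ eu eH) ipC -(split_gj _ eH Hr').
by rewrite Hr ?inE ?eqxx// mulr0 oppr0.
Qed.

End projection.

(** * The jump chain on the cells and bounds uniform in their size *)

Section cells.
Context {R : realType} {n : nat} (mu : probability 'rV[R]_n R).
Local Notation Rn := 'rV[R]_n.
Variables (K A delta : R) (I : finType) (theta : I -> Rn -> R) (c : I -> Rn).
Variables (F : Rn -> Rn) (Lip Mf : R).
Let box : set Rn := [set x | forall d, `|x ord0 d| <= K].
Hypotheses (mu_box : {ae mu, forall x, box x})
  (K_ge0 : 0 <= K) (A_ge0 : 0 <= A) (delta_gt0 : 0 < delta) (delta_le1 : delta <= 1)
  (cells : soft_cells K A delta theta c)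
  (FC : forall d, Ccoo setT (fun x => F x ord0 d))
  (Lip_ge0 : 0 <= Lip)
  (F_lip : forall d x y, `|F y ord0 d - F x ord0 d| <= Lip * l1norm (y - x))
  (F_bdd : forall d x, `|F x ord0 d| <= Mf).
Variable eta : Rn -> R.
Let Z x := F x - grad eta x.
Hypotheses (etaC : Ccoo setT eta)
  (Z_cells : forall i j, L2dot mu Z (grad (fun x => theta i x * theta j x)) = 0)
  (Z_eta : L2dot mu Z (grad eta) = 0).

Let F2 : R := \int[mu]_x sqnorm (F x).
Let z2 : R := \int[mu]_x sqnorm (Z x).

Let eF : essbv mu F. Proof. by move=> d; exact: Ccoo_essb (FC d). Qed.
Let eZ : essbv mu Z. Proof. by apply: essbvB => //; exact: grad_essbv etaC. Qed.
Let eth i : essb mu (theta i). Proof. exact: Ccoo_essb (cell_Ccoo cells i). Qed.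
Let egth i : essbv mu (grad (theta i)). Proof. exact: grad_essbv (cell_Ccoo cells i). Qed.
Let th_smooth i : smooth (theta i). Proof. exact: Ccoo_smooth (cell_Ccoo cells i). Qed.

Let F2_ge0 : 0 <= F2.
Proof. by apply: Rintegral_ge0 => x _; exact: sqnorm_ge0. Qed.

Lemma residual_dot : \int[mu]_x dotv (F x) (Z x) = z2.
Proof.
have egr := grad_essbv mu etaC.
have e1 := essb_sqnorm eZ; have e2 := essb_dotv eZ egr.
have -> : \int[mu]_x dotv (F x) (Z x) = \int[mu]_x (sqnorm (Z x) + dotv (Z x) (grad eta x)).
  apply: eq_Rintegral => x _; rewrite (dotvC (F x)) /sqnorm -dotvDr.
  by rewrite /Z subrK.
by rewrite (RintD e1 e2) -/(L2dot mu Z (grad eta)) Z_eta addr0.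
Qed.

(** Pythagoras. [Z] varies with the cells while [F] does not, so this keeps the later constants
    independent of [delta]. *)
Lemma residual_le : z2 <= F2.
Proof.
have egr := grad_essbv mu etaC.
have e1 := essb_sqnorm eZ; have e2 := essb_dotv eZ egr; have e3 := essb_sqnorm egr.
have e4 := essbZ 2 e2.
have -> : F2 = \int[mu]_x ((sqnorm (Z x) + 2 * dotv (Z x) (grad eta x)) + sqnorm (grad eta x)).
  by apply: eq_Rintegral => x _; rewrite -sqnormD /Z subrK.
rewrite (RintD (essbD e1 e4) e3) (RintD e1 e4) (RintZ 2 e2).
rewrite -/(L2dot mu Z (grad eta)) Z_eta mulr0 addr0 lerDl.
by apply: Rintegral_ge0 => x _; exact: sqnorm_ge0.
Qed.

Let p i : R := \int[mu]_x theta i x.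
Let B i j : R := \int[mu]_x (theta i x * dotv (Z x) (grad (theta j) x)).

Let eZg j : essb mu (fun x => dotv (Z x) (grad (theta j) x)).
Proof. exact: essb_dotv. Qed.
Let eB i j : essb mu (fun x => theta i x * dotv (Z x) (grad (theta j) x)).
Proof. exact: essbM. Qed.

Let p_ge0 i : 0 <= p i.
Proof. by apply: Rintegral_ge0 => x _; exact: (cell_ge0 cells). Qed.

(** The product rule: the sum of the two entries is [Z] tested against the gradient of
    [theta i * theta j]. This is why the projection is made on the products rather than on the
    single cell functions. *)
Let B_anti i j : B i j = - B j i.
Proof.
apply/eqP; rewrite -subr_eq0 opprK; apply/eqP.
rewrite /B -(RintD (eB i j) (eB j i)) -[RHS](Z_cells i j).
apply: eq_Rintegral => x _.
have -> : grad (fun x => theta i x * theta j x) x =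
    theta i x *: grad (theta j) x + theta j x *: grad (theta i) x.
  by apply/rowP => d; rewrite !mxE partialM.
by rewrite dotvDr !dotvZr.
Qed.

Let B_row i : \sum_j B i j = 0.
Proof.
rewrite /B -Rint_sum; last exact: eB.
rewrite -[RHS](Rint_cst mu 0); apply: Rint_ae_eq.
- by case: (essb_sum (index_enum _) (eB i)).
- exact: measurable_cst.
apply: filterS mu_box => x xb; rewrite -mulr_sumr.
suff -> : \sum_j dotv (Z x) (grad (theta j) x) = 0 by rewrite mulr0.
rewrite /dotv exchange_big big1// => d _; rewrite -mulr_sumr.
under eq_bigr do rewrite mxE.
by rewrite (cell_dsum cells d xb) mulr0.
Qed.

Let B_p0 i j : p i = 0 -> B i j = 0.
Proof.
move=> p0; have [M M0 thM] := Ccoo_bounded (cell_Ccoo cells i).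
have H := Rint_cauchy_schwarz (eth i) (eZg j).
(* [theta i ^+ 2] is at most [M * theta i], so it has zero integral and Cauchy-Schwarz kills
   [B i j]. *)
have t2 : \int[mu]_x (theta i x ^+ 2) <= 0.
  apply: (@le_trans _ _ (\int[mu]_x (M * theta i x))).
    apply: le_Rint; [exact: (essbM (eth i) (eth i))|exact: essbZ|].
    move=> x; rewrite expr2 ler_wpM2r ?(cell_ge0 cells)//.
    by apply: le_trans (thM x); exact: ler_norm.
  by rewrite (RintZ M (eth i)) -/(p i) p0 mulr0.
have b0 : 0 <= \int[mu]_x (dotv (Z x) (grad (theta j) x) ^+ 2).
  by apply: Rintegral_ge0 => x _; exact: sqr_ge0.
apply/eqP; rewrite -sqrf_eq0 eq_le sqr_ge0 andbT; apply: le_trans H _.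
by rewrite mulr_le0_ge0.
Qed.

(** Functions on the cells are turned back into functions on the space; the chain drift then becomes
    an integral against [Z], with L2 bounds that do not degenerate as the cells shrink. *)
Let interp (u : I -> R) x := \sum_i u i * theta i x.
Let dinterp (f : I -> R) x : Rn := \sum_j f j *: grad (theta j) x.

Let e_interp u : essb mu (interp u).
Proof. by apply: essb_sum => i; exact: essbZ. Qed.

Let e_dinterp f : essbv mu (dinterp f).
Proof.
move=> d.
have -> : (fun x => dinterp f x ord0 d) = fun x => \sum_j f j * grad (theta j) x ord0 d.
  by apply/funext => x; rewrite summxE; apply: eq_bigr => j _; rewrite mxE.
by apply: essb_sum => j; apply: essbZ; exact: egth.
Qed.

Let e_Zd f : essb mu (fun x => dotv (Z x) (dinterp f x)).
Proof. exact: essb_dotv. Qed.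

Let driftE u f : chain_drift B u f = \int[mu]_x (interp u x * dotv (Z x) (dinterp f x)).
Proof.
have -> : (fun x => interp u x * dotv (Z x) (dinterp f x)) =
    fun x => \sum_i \sum_j (u i * f j) * (theta i x * dotv (Z x) (grad (theta j) x)).
  apply/funext => x.
  have -> : dotv (Z x) (dinterp f x) = \sum_j f j * dotv (Z x) (grad (theta j) x).
    rewrite /dinterp; elim: (index_enum I) => [|j r IH].
      by rewrite !big_nil -(scale0r 0) dotvZr mul0r.
    by rewrite !big_cons dotvDr dotvZr IH.
  rewrite /interp mulr_suml; apply: eq_bigr => i _.
  rewrite mulr_sumr; apply: eq_bigr => j _; ring.
rewrite Rint_sum; last by move=> i; apply: essb_sum => j; exact: essbZ.
apply: eq_bigr => i _; rewrite Rint_sum; last by move=> j; exact: essbZ.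
by apply: eq_bigr => j _; rewrite (RintZ _ (eB i j)) -/(B i j) mulrC.
Qed.

(** Jensen's inequality at each point of the box, with the weights [theta i x]. *)
Let interp_sqr u : \int[mu]_x (interp u x ^+ 2) <= chain_dot p u u.
Proof.
have -> : chain_dot p u u = \int[mu]_x (\sum_i (u i * u i) * theta i x).
  rewrite Rint_sum; last by move=> i; exact: essbZ.
  by apply: eq_bigr => i _; rewrite (RintZ _ (eth i)) -/(p i) mulrC.
apply: le_Rint_ae.
- exact: (essbM (e_interp u) (e_interp u)).
- by apply: essb_sum => i; exact: essbZ.
apply: filterS mu_box => x xb.
have := sqr_sum_le u (fun i => cell_ge0 cells i x).
rewrite (cell_sum cells xb) mul1r /interp.
under [X in X ^+ 2 <= _]eq_bigr do rewrite mulrC.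
by under [X in _ <= X -> _]eq_bigr do rewrite mulrC expr2.
Qed.

Let drift_sqr v f a2 : \int[mu]_x (dotv (Z x) (dinterp f x) ^+ 2) <= a2 ->
  chain_drift B v f ^+ 2 <= a2 * chain_dot p v v.
Proof.
move=> fa; rewrite driftE.
apply: le_trans (Rint_cauchy_schwarz (e_interp v) (e_Zd f)) _.
rewrite mulrC; apply: ler_pM.
- by apply: Rintegral_ge0 => x _; exact: sqr_ge0.
- by apply: Rintegral_ge0 => x _; exact: sqr_ge0.
- exact: fa.
- exact: interp_sqr.
Qed.

Let pos e : I -> R := fun i => c i ord0 e.
Let val d : I -> R := fun i => F (c i) ord0 d.

(** The interpolated coordinate function is the coordinate function, so its gradient is a unit
    vector. Hence the drift of the chain in direction e is exactly that of [Z]. *)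
Let dinterp_pos e x : box x -> dotv (Z x) (dinterp (pos e) x) = Z x ord0 e.
Proof.
move=> xb; rewrite /dotv (bigD1 e)//= big1 => [|d de].
  rewrite summxE addr0.
  under eq_bigr do rewrite !mxE.
  by rewrite (cell_dcenter cells e e xb) eqxx mulr1.
rewrite summxE.
under eq_bigr do rewrite !mxE.
by rewrite (cell_dcenter cells d e xb) (negbTE de) mulr0.
Qed.

Let eZd d : essb mu (fun x => Z x ord0 d). Proof. exact: eZ. Qed.

Let drift_pos u e : chain_drift B u (pos e) = \int[mu]_x (interp u x * Z x ord0 e).
Proof.
rewrite driftE; apply: Rint_ae_eq.
- by case: (essbM (e_interp u) (e_Zd (pos e))).
- by case: (essbM (e_interp u) (eZd e)).
by apply: filterS mu_box => x xb; rewrite dinterp_pos.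
Qed.

Let speed e : R := Num.sqrt (\int[mu]_x (Z x ord0 e ^+ 2)).

Let eZ2 e : essb mu (fun x => Z x ord0 e ^+ 2).
Proof. exact: (essbM (eZd e) (eZd e)). Qed.

Let speed_sqr e : speed e ^+ 2 = \int[mu]_x (Z x ord0 e ^+ 2).
Proof. by rewrite sqr_sqrtr//; apply: Rintegral_ge0 => x _; exact: sqr_ge0. Qed.

Let speed_ge0 e : 0 <= speed e. Proof. exact: sqrtr_ge0. Qed.

Let speed_sum : \sum_e speed e ^+ 2 = z2.
Proof.
under eq_bigr do rewrite speed_sqr.
by rewrite -(Rint_sum (index_enum _) eZ2).
Qed.

Let speed_le e : speed e <= F2 + 1.
Proof.
have H : speed e ^+ 2 <= z2.
  by rewrite -speed_sum (bigD1 e)//= lerDl; apply: sumr_ge0 => i _; exact: sqr_ge0.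
have := residual_le; have := speed_ge0 e; nra.
Qed.

Let drift_pos_sqr v e : chain_drift B v (pos e) ^+ 2 <= speed e ^+ 2 * chain_dot p v v.
Proof.
apply: drift_sqr; rewrite speed_sqr; apply: le_Rint_ae.
- exact: (essbM (e_Zd (pos e)) (e_Zd (pos e))).
- exact: eZ2.
by apply: filterS mu_box => x xb; rewrite dinterp_pos.
Qed.

Let near_center i x d : theta i x != 0 -> `|x ord0 d - c i ord0 d| <= A * delta.
Proof.
by move=> t0; rewrite leNgt; apply/negP => /(cell_far cells) t; rewrite t eqxx in t0.
Qed.

Let grad_near_center i x d e : partial e (theta i) x != 0 ->
  `|x ord0 d - c i ord0 d| <= A * delta.
Proof.
move=> t0; rewrite leNgt; apply/negP => /(cell_grad_far cells e) t.
by rewrite t eqxx in t0.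
Qed.

Let l1norm_le (v : Rn) b : (forall d, `|v ord0 d| <= b) -> l1norm v <= n%:R * b.
Proof.
move=> vb; apply: (le_trans (ler_sum _ (fun d _ => vb d))).
by rewrite sumr_const card_ord mulr_natl.
Qed.

Let near_l1norm i x : theta i x != 0 -> l1norm (c i - x) <= n%:R * (A * delta).
Proof.
by move=> t0; apply: l1norm_le => d; rewrite !mxE distrC; exact: near_center.
Qed.

Let grad_near_l1norm i x e : partial e (theta i) x != 0 ->
  l1norm (c i - x) <= n%:R * (A * delta).
Proof.
by move=> t0; apply: l1norm_le => d; rewrite !mxE distrC; exact: grad_near_center t0.
Qed.

Let CD : R := 2 * n%:R * A * Lip.
Let CD_ge0 : 0 <= CD. Proof. by rewrite !mulr_ge0. Qed.

(** As the gradients sum to 0, [F x] may be subtracted from the values; differences of order [delta]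
    then meet gradients whose sum is of order [delta^-1]. *)
Let dinterp_val d e x : box x -> `|dinterp (val d) x ord0 e| <= CD.
Proof.
move=> xb; rewrite summxE.
have -> : \sum_j (val d j *: grad (theta j) x) ord0 e =
    \sum_j (val d j - F x ord0 d) * partial e (theta j) x.
  transitivity (\sum_j val d j * partial e (theta j) x -
      F x ord0 d * \sum_j partial e (theta j) x).
    rewrite (cell_dsum cells e xb) mulr0 subr0.
    by apply: eq_bigr => j _; rewrite !mxE.
  by rewrite mulr_sumr -sumrB; apply: eq_bigr => j _; rewrite mulrBl.
apply: le_trans (ler_norm_sum _ _ _) _.
apply: (@le_trans _ _ (\sum_j (Lip * (n%:R * (A * delta))) * `|partial e (theta j) x|)).
  apply: ler_sum => j _; rewrite normrM.
  have [->|t0] := eqVneq (partial e (theta j) x) 0; first by rewrite normr0 !mulr0.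
  apply: ler_wpM2r => //; apply: le_trans (F_lip _ _ _) _.
  by apply: ler_wpM2l => //; exact: grad_near_l1norm t0.
rewrite -mulr_sumr.
have W0 : 0 <= Lip * (n%:R * (A * delta)) by rewrite !mulr_ge0// ltW.
apply: le_trans (ler_wpM2l W0 (cell_grad_sum cells e xb)) _.
rewrite le_eqVlt; apply/orP; left; apply/eqP; rewrite /CD; field.
by rewrite gt_eqF.
Qed.

(** [n%:R * F2 + 1] stands in for the square root of [n%:R * F2], which it dominates. *)
Let b : R := CD * (n%:R * F2 + 1).
Let b_ge0 : 0 <= b.
Proof. by rewrite mulr_ge0// addr_ge0// mulr_ge0. Qed.

Let drift_val_sqr v d : chain_drift B v (val d) ^+ 2 <= b ^+ 2 * chain_dot p v v.
Proof.
apply: drift_sqr.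
have ez := essb_sqnorm eZ.
apply: (@le_trans _ _ (\int[mu]_x ((CD ^+ 2 * n%:R) * sqnorm (Z x)))).
  apply: le_Rint_ae.
  - exact: (essbM (e_Zd (val d)) (e_Zd (val d))).
  - exact: essbZ.
  apply: filterS mu_box => x xb.
  have H : `|dotv (Z x) (dinterp (val d) x)| <= CD * l1norm (Z x).
    by rewrite dotvC; apply: dotv_le_l1norm => e; exact: dinterp_val.
  rewrite -real_normK ?num_real// -mulrA.
  apply: le_trans (ler_wpM2l (sqr_ge0 CD) (sqr_l1norm_le (Z x))).
  by rewrite -exprMn ler_sqr ?nnegrE ?mulr_ge0 ?l1norm_ge0.
rewrite (RintZ _ ez) -/z2.
have -> : CD ^+ 2 * n%:R * z2 = CD ^+ 2 * (n%:R * z2) by ring.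
have -> : b ^+ 2 = CD ^+ 2 * (n%:R * F2 + 1) ^+ 2 by rewrite /b; ring.
apply: ler_wpM2l; first exact: sqr_ge0.
apply: (@le_trans _ _ (n%:R * F2)).
  by rewrite ler_wpM2l//; exact: residual_le.
have : 0 <= n%:R * F2 by rewrite mulr_ge0.
move: (n%:R * F2) => t t0; nra.
Qed.

Let Ce : R := 8 * n%:R ^+ 2 * A ^+ 2 * (n%:R + F2).

Let l1norm_Z x : l1norm (Z x) <= n%:R + sqnorm (Z x).
Proof.
rewrite /l1norm /sqnorm /dotv -[n in n%:R]card_ord -sumr_const -big_split.
apply: ler_sum => d _ /=; have := sqr_ge0 (`|Z x ord0 d| - 1).
have -> : Z x ord0 d * Z x ord0 d = `|Z x ord0 d| ^+ 2 by rewrite real_normK ?num_real.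
have := normr_ge0 (Z x ord0 d); move: `|_| => t; nra.
Qed.

Let e_l1norm_Z : essb mu (fun x => l1norm (Z x)).
Proof.
apply: essb_sum => d; have [mZ [M ZM]] := eZd d; split.
  by apply: measurableT_comp.
by exists M; apply: filterS ZM => x; rewrite normr_id.
Qed.

Let int_l1norm_Z : \int[mu]_x l1norm (Z x) <= n%:R + F2.
Proof.
apply: (@le_trans _ _ (\int[mu]_x (n%:R + sqnorm (Z x)))).
  by apply: le_Rint => //; apply: essbD; [exact: essb_cst|exact: essb_sqnorm].
rewrite RintD ?Rint_cst; [|exact: essb_cst|exact: essb_sqnorm].
by rewrite lerD2l; exact: residual_le.
Qed.

(** Jumps only link nearby cells: where [theta i] and a derivative of [theta j] are both nonzero,
    the centres are O(delta) apart. Squared differences of order [delta ^+ 2] against gradients of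
    total size [2 / delta] leave one factor [delta]. *)
Let energy_le (f : I -> R) (Lf : R) : 0 <= Lf ->
  (forall i j, `|f i - f j| <= Lf * l1norm (c i - c j)) ->
  chain_energy B f f <= Lf ^+ 2 * Ce * delta.
Proof.
move=> Lf0 fL; pose W := Lf * (2 * (n%:R * (A * delta))).
have W0 : 0 <= W by rewrite !mulr_ge0// ltW.
pose T i j x := theta i x * (\sum_d `|Z x ord0 d| * `|partial d (theta j) x|).
have eT i j : essb mu (T i j).
  apply: essbM => //; apply: essb_sum => d; apply: essbM.
    have [mZ [M ZM]] := eZd d; split; first exact: measurableT_comp.
    by exists M; apply: filterS ZM => x; rewrite normr_id.
  have [mg [M gM]] := Ccoo_essb mu (Ccoo_partial d (cell_Ccoo cells j)).
  split; first exact: measurableT_comp.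
  by exists M; apply: filterS gM => x; rewrite normr_id.
have BT i j : `|B i j| <= \int[mu]_x T i j x.
  have pt x : `|theta i x * dotv (Z x) (grad (theta j) x)| <= T i j x.
    rewrite normrM ger0_norm ?(cell_ge0 cells)//; apply: ler_wpM2l.
      exact: (cell_ge0 cells).
    apply: le_trans (ler_norm_sum _ _ _) _; apply: ler_sum => d _.
    by rewrite [grad (theta j) x _ _]mxE normrM.
  apply/ler_normlP; split.
    rewrite -mulN1r -(RintZ (-1) (eB i j)); apply: le_Rint => //; first exact: essbZ.
    by move=> x; rewrite mulN1r; have := pt x => /ler_normlP[].
  by apply: le_Rint => // x; have := pt x => /ler_normlP[].
have eTf i j : essb mu (fun x => ((f i - f j) * (f i - f j)) * T i j x) by exact: essbZ.
apply: (@le_trans _ _ (\int[mu]_x (\sum_i \sum_j ((f i - f j) * (f i - f j)) * T i j x))).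
  rewrite Rint_sum; last by move=> i; exact: essb_sum.
  apply: ler_sum => i _; rewrite Rint_sum//; apply: ler_sum => j _.
  rewrite (RintZ _ (eT i j)) mulrC; apply: ler_wpM2l; last exact: BT.
  by rewrite -expr2 sqr_ge0.
apply: (@le_trans _ _ (\int[mu]_x ((W ^+ 2 * (2 / delta)) * l1norm (Z x)))).
  apply: le_Rint_ae; [by apply: essb_sum => i; exact: essb_sum|exact: essbZ|].
  apply: filterS mu_box => x xb.
  apply: (@le_trans _ _ (\sum_i \sum_j W ^+ 2 * T i j x)).
    apply: ler_sum => i _; apply: ler_sum => j _.
    rewrite /T; have [->|t0] := eqVneq (theta i x) 0; first by rewrite !(mul0r, mulr0).
    rewrite !mulr_sumr; apply: ler_sum => d _.
    have [->|g0] := eqVneq (partial d (theta j) x) 0.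
      by rewrite normr0 !mulr0.
    apply: ler_wpM2r.
      by rewrite !mulr_ge0 ?(cell_ge0 cells).
    rewrite -expr2 -real_normK ?num_real// ler_sqr ?nnegrE//.
    apply: le_trans (fL _ _) _; rewrite /W; apply: ler_wpM2l => //.
    have -> : c i - c j = (c i - x) - (c j - x) by rewrite opprB addrA subrK.
    have := near_l1norm t0; have := grad_near_l1norm g0.
    have : l1norm (c i - x - (c j - x)) <= l1norm (c i - x) + l1norm (c j - x).
      rewrite /l1norm -big_split; apply: ler_sum => e _ /=.
      by rewrite [(c i - x - (c j - x)) _ _]mxE [(- (c j - x)) _ _]mxE; exact: ler_normB.
    lra.
  have -> : \sum_i \sum_j W ^+ 2 * T i j x =
      W ^+ 2 * ((\sum_i theta i x) *
        \sum_d `|Z x ord0 d| * \sum_j `|partial d (theta j) x|).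
    rewrite mulr_suml mulr_sumr; apply: eq_bigr => i _.
    rewrite -mulr_sumr; congr (_ * _); rewrite /T -mulr_sumr; congr (_ * _).
    by rewrite exchange_big; apply: eq_bigr => d _; rewrite mulr_sumr.
  rewrite (cell_sum cells xb) mul1r -mulrA; apply: ler_wpM2l; first exact: sqr_ge0.
  rewrite /l1norm mulr_sumr; apply: ler_sum => d _; rewrite mulrC; apply: ler_wpM2r => //.
  exact: (cell_grad_sum cells).
rewrite (RintZ _ e_l1norm_Z).
have -> : Lf ^+ 2 * Ce * delta = W ^+ 2 * (2 / delta) * (n%:R + F2).
  by rewrite /Ce /W; field; rewrite gt_eqF.
apply: ler_wpM2l; last exact: int_l1norm_Z.
by rewrite mulr_ge0 ?sqr_ge0// divr_ge0// ltW.
Qed.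

Let pos_dot e : chain_dot p (pos e) (pos e) <= (K + A) ^+ 2.
Proof.
have H i : p i * (pos e i * pos e i) <= p i * (K + A) ^+ 2.
  rewrite /p mulrC [leRHS]mulrC -!(RintZ _ (eth i)); apply: le_Rint_ae.
  - exact: essbZ.
  - exact: essbZ.
  apply: filterS mu_box => x xb.
  have [->|t0] := eqVneq (theta i x) 0; first by rewrite !mulr0.
  apply: ler_wpM2r; first exact: (cell_ge0 cells).
  rewrite -expr2 -real_normK ?num_real// ler_sqr ?nnegrE ?addr_ge0//.
  have := near_center e t0; have := xb e; rewrite /pos.
  have : A * delta <= A by rewrite ler_piMr.
  have := ler_normD (c i ord0 e - x ord0 e) (x ord0 e); rewrite subrK distrC; lra.
apply: le_trans (ler_sum _ (fun i _ => H i)) _; rewrite -mulr_suml.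
suff -> : \sum_i p i = 1 by rewrite mul1r.
rewrite /p -(Rint_sum (index_enum _) eth) -[RHS](Rint_cst mu 1).
apply: Rint_ae_eq; [by case: (essb_sum (index_enum _) eth)|exact: measurable_cst|].
by apply: filterS mu_box => x /(cell_sum cells).
Qed.

(** The stability condition involves finitely many cells, so one number of steps serves all; a cell
    of zero mass has zero rates. *)
Let time_steps (eps : R) : 0 < eps -> exists N : nat,
  forall i, 2 * (eps / N.+1%:R) * (\sum_j (`|B i j| + B i j)) <= p i.
Proof.
move=> eps0; pose J i := \sum_j (`|B i j| + B i j).
have J0 i : 0 <= J i.
  by apply: sumr_ge0 => j _; have := ler_norm (- B i j); rewrite normrN; lra.
pose X := \sum_i (2 * eps * J i / p i).
have X0 i : 0 <= 2 * eps * J i / p i by rewrite divr_ge0// !mulr_ge0// ltW.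
have Xge0 : 0 <= X by exact: sumr_ge0.
exists (Num.bound X) => i; rewrite -/(J i).
have [p0|pn0] := eqVneq (p i) 0.
  rewrite p0 /J big1 ?mulr0// => j _; by rewrite B_p0// normr0 addr0.
have pp : 0 < p i by rewrite lt_neqAle eq_sym pn0 p_ge0.
have XN := archi_boundP Xge0.
have Xi : 2 * eps * J i / p i <= X.
  by rewrite /X (bigD1 i)//= lerDl; apply: sumr_ge0 => j _; exact: X0.
have N0 : 0 < (Num.bound X).+1%:R :> R by rewrite ltr0n.
have -> : 2 * (eps / (Num.bound X).+1%:R) * J i =
    (2 * eps * J i / p i) * p i / (Num.bound X).+1%:R.
  by field; rewrite pn0 gt_eqF.
rewrite ler_pdivrMr// mulrC ler_pM2l//.
rewrite -natr1; apply: le_trans Xi _; lra.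
Qed.

Lemma cells_matrix (eps kappa r : R) : 0 < eps -> 0 < kappa -> 0 <= r ->
  2 * kappa * (K + A) ^+ 2 + kappa^-1 * eps * ((1 + Lip ^+ 2) * Ce * delta) <= r ^+ 2 ->
  exists M : I -> I -> R,
  [/\ forall i j, 0 <= M i j, forall i, \sum_j M i j = p i,
      forall j, \sum_i M i j = p j,
      forall e, \sum_i \sum_j M i j * (pos e j - pos e i) ^+ 2 <= (r + speed e * eps) ^+ 2 &
      forall d, eps * chain_drift B (val d) (pos d) -
          (r ^+ 2 + eps * (b * (r + speed d * eps))) <=
        \sum_i \sum_j M i j * (val d i * (pos d j - pos d i))].
Proof.
move=> eps0 kappa0 r0 rP.
have [N hN] := time_steps eps0; set h := eps / N.+1%:R in hN.
have N0 : 0 < N.+1%:R :> R by rewrite ltr0n.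
have h0 : 0 <= h by rewrite divr_ge0// ltW.
have hNE : h * N.+1%:R = eps by rewrite /h divfK// gt_eqF.
have [M [M0 Mrow Mcol MP]] := chain_kernel p_ge0 B_anti B_row B_p0 h0 hN N.+1.
have Ce0 : 0 <= Ce by rewrite !mulr_ge0 ?sqr_ge0// addr_ge0.
have Ced0 : 0 <= Ce * delta by rewrite mulr_ge0// ltW.
have ki0 : 0 < kappa^-1 by rewrite invr_gt0.
have ke0 : 0 <= kappa^-1 * eps by rewrite mulr_ge0// ltW.
(* One condition on [r] covers both observables: the Lipschitz constant is 1 for [pos] and [Lip] for
   [val], whence the factor [1 + Lip ^+ 2]. *)
have rbound f (Lf : R) (e : 'I_n) : Lf ^+ 2 <= 1 + Lip ^+ 2 ->
    chain_energy B f f <= Lf ^+ 2 * Ce * delta ->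
    2 * kappa * chain_dot p (pos e) (pos e) + kappa^-1 * (h * N.+1%:R) * chain_energy B f f
    <= r ^+ 2.
  move=> LfL fE; apply: le_trans rP; rewrite hNE; apply: lerD.
    by apply: ler_wpM2l; [rewrite mulr_ge0// ltW|exact: pos_dot].
  apply: ler_wpM2l => //; apply: le_trans fE _.
  by rewrite -[leLHS]mulrA -[leRHS]mulrA; exact: ler_wpM2r.
have pos_energy e : chain_energy B (pos e) (pos e) <= 1 ^+ 2 * Ce * delta.
  apply: energy_le => // i j; rewrite mul1r /l1norm (bigD1 e)//= !mxE lerDl.
  exact: sumr_ge0.
have val_energy d : chain_energy B (val d) (val d) <= Lip ^+ 2 * Ce * delta.
  by apply: energy_le => // i j; exact: F_lip.
have r1 e := rbound _ 1 e (eq_ind_r (fun t => t <= _) (ler_wpDr (sqr_ge0 Lip) (lexx 1)) (expr1n _ 2)) (pos_energy e).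
have r2 d := rbound _ Lip d (ler_wpDl ler01 (lexx _)) (val_energy d).
have Mdot g f : \sum_i \sum_j M i j * (g i * f j) =
    chain_dot p g (iter N.+1 (chain_step p B h) f).
  apply: eq_bigr => i _; rewrite mulrCA -MP mulr_sumr.
  by apply: eq_bigr => j _; ring.
have Mdiag1 g : \sum_i \sum_j M i j * g i = \sum_i p i * g i.
  by apply: eq_bigr => i _; rewrite -mulr_suml Mrow.
have Mdiag2 g : \sum_i \sum_j M i j * g j = \sum_i p i * g i.
  by rewrite exchange_big; apply: eq_bigr => j _; rewrite -mulr_suml Mcol.
exists M; split => // [e|d].
  have := chain_displacement p_ge0 B_anti B_row B_p0 h0 hN (speed_ge0 e) r0 kappa0
    (fun v => drift_pos_sqr v e) (r1 e).
  rewrite hNE; apply: le_trans.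
  rewrite -Mdot.
  have -> : \sum_i \sum_j M i j * (pos e j - pos e i) ^+ 2 =
     \sum_i \sum_j M i j * (pos e j * pos e j) + \sum_i \sum_j M i j * (pos e i * pos e i)
     - 2 * \sum_i \sum_j M i j * (pos e i * pos e j).
    rewrite mulr_sumr -big_split -sumrB; apply: eq_bigr => i _ /=.
    rewrite mulr_sumr -big_split -sumrB; apply: eq_bigr => j _ /=; ring.
  rewrite (Mdiag1 (fun i => pos e i * pos e i)) (Mdiag2 (fun i => pos e i * pos e i)).
  rewrite /chain_dot; lra.
have := chain_correlation p_ge0 B_anti B_row B_p0 h0 hN (speed_ge0 d) r0 kappa0
    (fun v => drift_pos_sqr v d) (r1 d) b_ge0 (fun v => drift_val_sqr v d) (r2 d).
rewrite hNE -Mdot.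
have -> : \sum_i \sum_j M i j * (val d i * (pos d j - pos d i)) =
   \sum_i \sum_j M i j * (val d i * pos d j) - \sum_i \sum_j M i j * (val d i * pos d i).
  rewrite -sumrB; apply: eq_bigr => i _; rewrite -sumrB; apply: eq_bigr => j _; ring.
rewrite (Mdiag1 (fun i => val d i * pos d i)) -/(chain_dot p (val d) (pos d)).
by move=> /ler_normlP[H1 H2]; lra.
Qed.

Let val_interp d x : box x -> `|interp (val d) x - F x ord0 d| <= Lip * (n%:R * (A * delta)).
Proof.
move=> xb; have -> : interp (val d) x - F x ord0 d =
    \sum_i (val d i - F x ord0 d) * theta i x.
  rewrite -[X in _ - X]mulr1 -(cell_sum cells xb) mulr_sumr -sumrB.
  by apply: eq_bigr => i _; rewrite mulrBl.
apply: le_trans (ler_norm_sum _ _ _) _.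
apply: (@le_trans _ _ (\sum_i (Lip * (n%:R * (A * delta))) * theta i x)).
  apply: ler_sum => i _; rewrite normrM [X in _ * X]ger0_norm ?(cell_ge0 cells)//.
  have [->|t0] := eqVneq (theta i x) 0; first by rewrite !mulr0.
  apply: ler_wpM2r; first exact: (cell_ge0 cells).
  by apply: le_trans (F_lip _ _ _) _; apply: ler_wpM2l => //; exact: near_l1norm.
by rewrite -mulr_sumr (cell_sum cells xb) mulr1.
Qed.

(** The total drift is the integral of the interpolated [F] against [Z]. Interpolation moves [F] by
    O(delta), and [F] against [Z] gives [z2] by orthogonality of the residual to [grad eta]. *)
Lemma drift_total : z2 - Lip * (n%:R * (A * delta)) * (n%:R + F2) <=
  \sum_d chain_drift B (val d) (pos d).
Proof.
set W := Lip * _; have W0 : 0 <= W by rewrite !mulr_ge0// ltW.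
have -> : \sum_d chain_drift B (val d) (pos d) =
    \int[mu]_x (\sum_d interp (val d) x * Z x ord0 d).
  rewrite Rint_sum; last by move=> d; exact: (essbM (e_interp _) (eZd d)).
  by apply: eq_bigr => d _; rewrite drift_pos.
have eFZ := essb_dotv eF eZ.
apply: (@le_trans _ _ (\int[mu]_x (dotv (F x) (Z x) - W * l1norm (Z x)))).
  rewrite (RintB eFZ (essbZ W e_l1norm_Z)) (RintZ _ e_l1norm_Z) residual_dot lerD2l lerN2.
  by apply: ler_wpM2l => //; exact: int_l1norm_Z.
apply: le_Rint_ae.
- by apply: essbB => //; exact: essbZ.
- by apply: essb_sum => d; exact: (essbM (e_interp _) (eZd d)).
apply: filterS mu_box => x xb; rewrite /dotv /l1norm mulr_sumr -sumrB.
apply: ler_sum => d _; rewrite lerBlDl -lerBlDr -mulrBl.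
apply: le_trans (ler_norm _) _; rewrite normrM; apply: ler_wpM2r => //.
by rewrite distrC; exact: val_interp.
Qed.

Lemma cells_coupling (eps kappa r : R) : 0 < eps <= 1 -> 0 < kappa -> 0 <= r <= 1 ->
  2 * kappa * (K + A) ^+ 2 + kappa^-1 * eps * ((1 + Lip ^+ 2) * Ce * delta) <= r ^+ 2 ->
  exists2 gam : probability (Rn * Rn)%type R, coupling mu mu gam &
    disp2 gam <= eps ^+ 2 * z2 + n%:R * (r * (2 * F2 + 3) + 2 * A * (4 * K + 2 * A) * delta)
    /\ eps * z2 - n%:R * b * (F2 + 1) * eps ^+ 2
       - (n%:R * (r * (1 + b) + (2 * K * Lip * n%:R * A + 2 * A * Mf) * delta)
          + Lip * (n%:R * (A * delta)) * (n%:R + F2)) <= disp_corr gam F.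
Proof.
move=> /andP[eps0 eps1] kappa0 /andP[r0 r1] rP.
have [M [M0 Mrow Mcol Mpos Mval]] := cells_matrix eps0 kappa0 r0 rP.
have [gam gamC gamP] := soft_coupling mu_box eth (cell_ge0 cells)
  (fun x xb => cell_sum cells xb) (fun i => erefl) M0 Mrow Mcol.
exists gam => //.
have mu_id : essbv mu id.
  move=> d; split; first exact: measurable_coord.
  by exists K; apply: filterS mu_box => x; exact.
have Mtot : \sum_i \sum_j M i j = 1.
  under eq_bigr do rewrite Mrow.
  rewrite /p -(Rint_sum (index_enum _) eth) -[RHS](Rint_cst mu 1).
  apply: Rint_ae_eq; [by case: (essb_sum (index_enum _) eth)|exact: measurable_cst|].
  by apply: filterS mu_box => x /(cell_sum cells).
have ed := coupling_disp_essbv mu_id (product_coupling mu).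
have Ad : A * delta <= A by rewrite ler_piMr.
have Ad0 : 0 <= A * delta by rewrite mulr_ge0// ltW.
have geom i j x y d : box x -> box y -> theta i x != 0 -> theta j y != 0 ->
   [/\ `|(y ord0 d - x ord0 d) - (pos d j - pos d i)| <= 2 * (A * delta),
       `|y ord0 d - x ord0 d| <= 2 * K & `|pos d j - pos d i| <= 2 * K + 2 * A].
  move=> xb yb t0 t1; have := near_center d t0; have := near_center d t1.
  have := xb d; have := yb d; rewrite /pos.
  move=> /ler_normlP[? ?] /ler_normlP[? ?] /ler_normlP[? ?] /ler_normlP[? ?].
  by split; apply/ler_normlP; split; lra.
split.
  set E1 := 2 * A * (4 * K + 2 * A) * delta.
  have bnd i j x y : box x -> box y -> theta i x != 0 -> theta j y != 0 ->
      sqnorm (y - x) <= \sum_d ((pos d j - pos d i) ^+ 2 + E1).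
    move=> xb yb t0 t1; apply: ler_sum => d _; rewrite !mxE.
    have [] := geom i j x y d xb yb t0 t1.
    move: (y ord0 d - x ord0 d) (pos d j - pos d i) => u v H1 H2 H3.
    (* Difference of squares: [u - v] is of the size of a cell, while [u + v] is bounded by the size
       of the box. *)
    have : (u - v) * (u + v) <= 2 * (A * delta) * (4 * K + 2 * A).
      apply: le_trans (ler_norm _) _; rewrite normrM; apply: ler_pM => //.
      by apply: le_trans (ler_normD _ _) _; lra.
    rewrite /E1; lra.
  have := gamP (fun z => sqnorm (z.2 - z.1)) (fun i j => \sum_d ((pos d j - pos d i) ^+ 2 + E1))
    (essb_sqnorm ed) bnd.
  move=> H; apply: le_trans H _.
  have -> : \sum_i \sum_j M i j * (\sum_d ((pos d j - pos d i) ^+ 2 + E1)) =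
      \sum_d (\sum_i \sum_j M i j * (pos d j - pos d i) ^+ 2 + E1).
    transitivity (\sum_d \sum_i \sum_j M i j * ((pos d j - pos d i) ^+ 2 + E1)).
      under eq_bigr do under eq_bigr do rewrite mulr_sumr.
      under eq_bigr do rewrite exchange_big.
      by rewrite exchange_big.
    apply: eq_bigr => d _; rewrite -[X in _ + X]mul1r -Mtot.
    rewrite mulr_suml -big_split; apply: eq_bigr => i _ /=.
    by rewrite mulr_suml -big_split; apply: eq_bigr => j _ /=; rewrite mulrDr.
  apply: (@le_trans _ _ (\sum_(d < n) (eps ^+ 2 * speed d ^+ 2 + (r * (2 * F2 + 3) + E1)))).
    apply: ler_sum => d _; have := Mpos d; have := speed_ge0 d; have := speed_le d.
    move: (\sum_i _) (speed d) => X s s1 s0 H.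
    have rr : r ^+ 2 <= r by rewrite expr2 ler_piMr.
    have rs : r * (s * eps) <= r * (F2 + 1).
      by apply: ler_wpM2l => //; apply: le_trans s1; rewrite ler_piMr.
    nra.
  rewrite big_split /= -mulr_sumr speed_sum sumr_const card_ord.
  by rewrite -[(r * _ + E1) *+ n]mulr_natl.
set E2 := (2 * K * Lip * n%:R * A + 2 * A * Mf) * delta.
(* [soft_coupling] yields upper bounds, so the lower bound on the correlation is obtained for its
   negative. *)
have bnd i j x y : box x -> box y -> theta i x != 0 -> theta j y != 0 ->
    -1 * dotv (F x) (y - x) <= \sum_d (E2 - val d i * (pos d j - pos d i)).
  move=> xb yb t0 t1; rewrite /dotv mulr_sumr; apply: ler_sum => d _; rewrite !mxE.
  have [] := geom i j x y d xb yb t0 t1.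
  have HF : `|F x ord0 d - val d i| <= Lip * (n%:R * (A * delta)).
    rewrite distrC; apply: le_trans (F_lip _ _ _) _; apply: ler_wpM2l => //.
    exact: near_l1norm.
  have HM : `|val d i| <= Mf by exact: F_bdd.
  move: (y ord0 d - x ord0 d) (pos d j - pos d i) (F x ord0 d) (val d i) HF HM
    => u v f g HF HM H1 H2 H3.
  (* [f * u - g * v] is split as [(f - g) * u + g * (u - v)], with one small factor in each
     summand. *)
  have q1 : - ((f - g) * u) <= Lip * (n%:R * (A * delta)) * (2 * K).
    apply: le_trans (ler_norm _) _; rewrite normrN normrM; exact: ler_pM.
  have q2 : - (g * (u - v)) <= Mf * (2 * (A * delta)).
    apply: le_trans (ler_norm _) _; rewrite normrN normrM; exact: ler_pM.
  rewrite /E2; lra.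
have e1 : essb (mu \x mu)%E (fun z : Rn * Rn => dotv (F z.1) (z.2 - z.1)).
  by apply: essb_dotv => //; exact: (coupling_essbv1 (product_coupling mu) eF).
have e2 : essb gam (fun z : Rn * Rn => dotv (F z.1) (z.2 - z.1)).
  apply: essb_dotv; first exact: (coupling_essbv1 gamC eF).
  exact: coupling_disp_essbv.
have := gamP (fun z => -1 * dotv (F z.1) (z.2 - z.1))
  (fun i j => \sum_d (E2 - val d i * (pos d j - pos d i))) (essbZ (-1) e1) bnd.
rewrite (RintZ _ e2) -/(disp_corr gam F) mulN1r.
have -> : \sum_i \sum_j M i j * (\sum_d (E2 - val d i * (pos d j - pos d i))) =
    \sum_d (E2 - \sum_i \sum_j M i j * (val d i * (pos d j - pos d i))).
  transitivity (\sum_d \sum_i \sum_j M i j * (E2 - val d i * (pos d j - pos d i))).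
    under eq_bigr do under eq_bigr do rewrite mulr_sumr.
    under eq_bigr do rewrite exchange_big.
    by rewrite exchange_big.
  apply: eq_bigr => d _; rewrite -[X in X - _]mul1r -Mtot.
  rewrite mulr_suml -sumrB; apply: eq_bigr => i _ /=.
  by rewrite mulr_suml -sumrB; apply: eq_bigr => j _ /=; rewrite mulrBr.
move=> H.
have H2 : \sum_(d < n) (E2 - \sum_i \sum_j M i j * (val d i * (pos d j - pos d i))) <=
    \sum_(d < n) (E2 + r * (1 + b) + b * (F2 + 1) * eps ^+ 2 -
       eps * chain_drift B (val d) (pos d)).
  apply: ler_sum => d _; have := Mval d; have := speed_ge0 d; have := speed_le d.
  move: (\sum_i _) (chain_drift _ _ _) (speed d) => X Y s s1 s0 HX.
  have rr : r ^+ 2 <= r by rewrite expr2 ler_piMr.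
  have br : eps * (b * r) <= b * r by rewrite ler_piMl// mulr_ge0.
  have bs : eps ^+ 2 * b * s <= eps ^+ 2 * b * (F2 + 1).
    by apply: ler_wpM2l => //; rewrite mulr_ge0// sqr_ge0.
  nra.
have := le_trans H H2; rewrite big_split /= sumr_const card_ord sumrN -mulr_sumr.
rewrite -[(E2 + _ + _) *+ n]mulr_natl => H3.
have Hd := drift_total; set W := Lip * _ * _ in Hd *.
have W0 : 0 <= W by rewrite !mulr_ge0 ?addr_ge0// ltW.
have H4 : eps * (z2 - W) <= eps * \sum_d chain_drift B (val d) (pos d).
  by apply: ler_wpM2l => //; exact: ltW.
have H5 : eps * W <= W by rewrite ler_piMl.
lra.
Qed.

End cells.

Lemma Ccoo_field_bounds {R : realType} {n : nat} (F : 'rV[R]_n -> 'rV[R]_n) :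
  (forall d, Ccoo setT (fun x => F x ord0 d)) ->
  exists Lip Mf : R, [/\ 0 <= Lip, 0 <= Mf,
    forall d x y, `|F y ord0 d - F x ord0 d| <= Lip * l1norm (y - x) &
    forall d x, `|F x ord0 d| <= Mf].
Proof.
move=> FC.
have HL d : exists C, 0 <= C /\ forall x y, `|F y ord0 d - F x ord0 d| <= C * l1norm (y - x).
  by have [C ? ?] := Ccoo_lipschitz (FC d); exists C.
have HM d : exists C, 0 <= C /\ forall x, `|F x ord0 d| <= C.
  by have [C ? ?] := Ccoo_bounded (FC d); exists C.
have [cl clP] := choice HL; have [cm cmP] := choice HM.
exists (\sum_d cl d), (\sum_d cm d); split.
- by apply: sumr_ge0 => d _; have [] := clP d.
- by apply: sumr_ge0 => d _; have [] := cmP d.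
- move=> d x y; have [_ /(_ x y) H] := clP d; apply: le_trans H _.
  apply: ler_wpM2r; first exact: l1norm_ge0.
  by rewrite (bigD1 d)//= lerDl; apply: sumr_ge0 => e _; have [] := clP e.
- move=> d x; have [_ /(_ x) H] := cmP d; apply: le_trans H _.
  by rewrite (bigD1 d)//= lerDl; apply: sumr_ge0 => e _; have [] := cmP e.
Qed.

(** [C] stems from the change of the drift along the displacement and does not involve the mesh. It
    therefore depends neither on [eps] nor on [tol], and [tol] can be sent to 0 with [eps] fixed. *)
Lemma circulating_coupling {R : realType} {n : nat} (mu : probability 'rV[R]_n R)
  (K : R) (F : 'rV[R]_n -> 'rV[R]_n) : 0 <= K ->
  {ae mu, forall x : 'rV[R]_n, forall d, `|x ord0 d| <= K} ->
  (forall d, Ccoo setT (fun x => F x ord0 d)) ->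
  exists2 C, 0 <= C & forall eps tol, 0 < eps <= 1 -> 0 < tol ->
    exists (gam : probability ('rV[R]_n * 'rV[R]_n)%type R) (eta : 'rV[R]_n -> R),
    [/\ coupling mu mu gam, Ccoo setT eta,
      disp2 gam <= eps ^+ 2 * \int[mu]_x sqnorm (F x - grad eta x) + tol &
      eps * \int[mu]_x sqnorm (F x - grad eta x) - C * eps ^+ 2 - tol <=
        disp_corr gam F].
Proof.
move=> K0 mu_box FC.
have [Lip [Mf [Lip0 Mf0 F_lip F_bdd]]] := Ccoo_field_bounds FC.
have [A A0 cellsP] := @soft_cells_exist R n K K0.
have eF : essbv mu F by move=> d; exact: Ccoo_essb (FC d).
set F2 := \int[mu]_x sqnorm (F x).
have F20 : 0 <= F2 by apply: Rintegral_ge0 => x _; exact: sqnorm_ge0.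
pose b := 2 * n%:R * A * Lip * (n%:R * F2 + 1).
have n0 : 0 <= n%:R :> R by [].
have b0 : 0 <= b by rewrite !mulr_ge0// addr_ge0// mulr_ge0.
exists (n%:R * b * (F2 + 1)) => [|eps tol epsP tol0].
  by rewrite mulr_ge0 ?addr_ge0// mulr_ge0.
have /andP[eps0 eps1] := epsP.
pose X := n%:R * (2 * F2 + 3) + n%:R * (1 + b).
pose Y1 := n%:R * (2 * A * (4 * K + 2 * A)).
pose Y2 := n%:R * (2 * K * Lip * n%:R * A + 2 * A * Mf) + Lip * (n%:R * A) * (n%:R + F2).
pose H := (K + A) ^+ 2.
pose G := (1 + Lip ^+ 2) * (8 * n%:R ^+ 2 * A ^+ 2 * (n%:R + F2)).
have L20 : 0 <= Lip ^+ 2 := sqr_ge0 Lip.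
have X10 : 0 <= n%:R * (2 * F2 + 3) by rewrite mulr_ge0//; lra.
have X20 : 0 <= n%:R * (1 + b) by rewrite mulr_ge0//; lra.
have X0 : 0 <= X by exact: addr_ge0.
have Y10 : 0 <= Y1 by rewrite !mulr_ge0// addr_ge0// mulr_ge0.
have Y20 : 0 <= Y2.
  by rewrite addr_ge0// !mulr_ge0// addr_ge0// !mulr_ge0.
have H0 : 0 <= H := sqr_ge0 _.
have G0 : 0 <= G by rewrite mulr_ge0 ?addr_ge0// !mulr_ge0 ?sqr_ge0// addr_ge0.
(* Half of the tolerance goes to the terms linear in [r], the other half to those linear in
   [delta]. *)
pose r := Num.min 1 (tol / (2 * (X + 1))).
have r0 : 0 < r by rewrite lt_min ltr01 divr_gt0// mulr_gt0//; lra.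
have r1 : r <= 1 by rewrite ge_min lexx.
have rX : r * (X + 1) <= tol / 2.
  have : r <= tol / (2 * (X + 1)) by rewrite ge_min lexx orbT.
  have XX : 0 < X + 1 by lra.
  by rewrite invfM mulrA ler_pdivlMr.
(* Makes the part of the error paid by dissipation at most [r ^+ 2 / 2]. *)
pose kappa := r ^+ 2 / (4 * (H + 1)).
have H1 : 0 < H + 1 by lra.
have kappa0 : 0 < kappa by rewrite divr_gt0 ?exprn_gt0// mulr_gt0.
have kH : 2 * kappa * H <= r ^+ 2 / 2.
  have -> : 2 * kappa * H = (r ^+ 2 / 2) * (H / (H + 1)).
    by rewrite /kappa; field; rewrite gt_eqF.
  apply: ler_piMr; first by rewrite divr_ge0// sqr_ge0.
  by rewrite ler_pdivrMr// mul1r lerDl.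
(* Chosen last: the third entry brings the energy term below [r ^+ 2 / 2] in spite of the factor
   [kappa^-1]. *)
pose delta := Num.min 1 (Num.min (tol / (2 * (Y1 + Y2 + 1))) (r ^+ 2 * kappa / (2 * (G + 1)))).
have YY : 0 < Y1 + Y2 + 1 by lra.
have GG : 0 < G + 1 by lra.
have delta0 : 0 < delta.
  have r2 : 0 < r ^+ 2 by exact: exprn_gt0.
  rewrite !lt_min ltr01 /=; apply/andP; split; apply: divr_gt0; first exact: tol0.
  - exact: mulr_gt0.
  - exact: mulr_gt0.
  - exact: mulr_gt0.
have delta1 : delta <= 1 by rewrite ge_min lexx.
have dY : delta * (Y1 + Y2 + 1) <= tol / 2.
  have : delta <= tol / (2 * (Y1 + Y2 + 1)) by rewrite !ge_min lexx orbT.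
  by rewrite invfM mulrA ler_pdivlMr.
have dG : kappa^-1 * (delta * (G + 1)) <= r ^+ 2 / 2.
  have dd : delta <= r ^+ 2 * kappa / (2 * (G + 1)) by rewrite !ge_min lexx !orbT.
  apply: (@le_trans _ _ (kappa^-1 * (r ^+ 2 * kappa / (2 * (G + 1)) * (G + 1)))).
    by rewrite ler_wpM2l ?invr_ge0 ?(ltW kappa0)// ler_wpM2r// ltW.
  rewrite le_eqVlt; apply/orP; left; apply/eqP; field.
  by rewrite !gt_eqF.
have [I [theta [c cells]]] := cellsP delta delta0.
have gC (ij : I * I) : Ccoo setT (fun x => theta ij.1 x * theta ij.2 x).
  apply: CcooMl; last exact: (cell_Ccoo cells).
  exact: Ccoo_smooth (cell_Ccoo cells _).
have [eta [etaC Z_cells eta_span]] := grad_projection (enum {: I * I}) gC eF.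
have eZ : essbv mu (fun x => F x - grad eta x).
  by apply: essbvB => //; exact: grad_essbv etaC.
have Zc i j : L2dot mu (fun x => F x - grad eta x)
    (grad (fun x => theta i x * theta j x)) = 0.
  by apply: (Z_cells (i, j)); rewrite mem_enum.
have Ze : L2dot mu (fun x => F x - grad eta x) (grad eta) = 0.
  exact: (eta_span _ eZ Z_cells).
have rP : 2 * kappa * (K + A) ^+ 2 + kappa^-1 * eps *
    ((1 + Lip ^+ 2) * (8 * n%:R ^+ 2 * A ^+ 2 * (n%:R + F2)) * delta) <= r ^+ 2.
  rewrite -/H -/G.
  have k0 : 0 <= kappa^-1 by rewrite invr_ge0 ltW.
  have q1 : kappa^-1 * eps * (G * delta) <= kappa^-1 * (delta * (G + 1)).
    rewrite -mulrA; apply: ler_wpM2l => //.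
    apply: (@le_trans _ _ (1 * (G * delta))).
      by apply: ler_wpM2r => //; rewrite mulr_ge0// ltW.
    by rewrite mul1r mulrC; apply: ler_wpM2l; [exact: ltW|rewrite lerDl].
  lra.
have r01 : 0 <= r <= 1 by rewrite (ltW r0) r1.
have [gam gamC [Hd Hc]] := cells_coupling mu_box K0 A0 delta0 delta1 cells FC Lip0
  F_lip F_bdd etaC Zc Ze epsP kappa0 r01 rP.
exists gam, eta; split => //.
  apply: le_trans Hd _; rewrite lerD2l -/F2.
  have e1 : n%:R * (r * (2 * F2 + 3) + 2 * A * (4 * K + 2 * A) * delta) =
     r * (n%:R * (2 * F2 + 3)) + delta * Y1 by rewrite /Y1; ring.
  rewrite e1.
  have q1 : r * (n%:R * (2 * F2 + 3)) <= r * (X + 1).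
    by apply: ler_wpM2l; [exact: ltW|rewrite /X; lra].
  have q2 : delta * Y1 <= delta * (Y1 + Y2 + 1).
    by apply: ler_wpM2l; [exact: ltW|lra].
  lra.
apply: le_trans Hc; rewrite -/F2 -/b.
have e1 : n%:R * (r * (1 + b) + (2 * K * Lip * n%:R * A + 2 * A * Mf) * delta) +
     Lip * (n%:R * (A * delta)) * (n%:R + F2) = r * (n%:R * (1 + b)) + delta * Y2.
  by rewrite /Y2; ring.
have q1 : r * (n%:R * (1 + b)) <= r * (X + 1).
  by apply: ler_wpM2l; [exact: ltW|rewrite /X; lra].
have q2 : delta * Y2 <= delta * (Y1 + Y2 + 1).
  by apply: ler_wpM2l; [exact: ltW|lra].
lra.
Qed.

(** * Reduction to self-couplings *)

Section perturbation_of_identity.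
Context {R : realType} {n : nat}.
Local Notation Rn := 'rV[R]_n.
Implicit Types (x y v : Rn).

Lemma normv_le v (b : R) : 0 <= b -> (forall i, `|v ord0 i| <= b) -> `|v| <= b.
Proof.
move=> b0 vb; rewrite [leLHS]/Num.norm /= mx_normrE; apply/bigmax_leP; split => // -[i j] _ /=.
by rewrite ord1.
Qed.

Lemma coord_le_normv v i : `|v ord0 i| <= `|v|.
Proof.
rewrite [leRHS]/Num.norm /= mx_normrE.
exact: (le_bigmax _ (fun ij : 'I_1 * 'I_n => `|v ij.1 ij.2|) (ord0, i)).
Qed.

(** The equation [x + G x = y] is a fixed point problem for the contraction [y - G x]. As [1 - L] is
    at least 1/2, the inverse is 2-Lipschitz, hence continuous and measurable. *)
Lemma perturbed_id_inverse (G : Rn -> Rn) (L : R) : 0 <= L <= 1 / 2 ->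
  (forall x y, `|G x - G y| <= L * `|x - y|) ->
  exists T : Rn -> Rn,
    [/\ measurable_fun setT T, forall y, T y + G (T y) = y &
        forall x, T (x + G x) = x].
Proof.
move=> /andP[L0 L1] GL.
pose X : completeNormedModType R :=
  HB.pack_for (completeNormedModType R) 'rV[R]_n (NormedModule.on 'rV[R]_n) (Complete.on 'rV[R]_n).
have surj y : exists x, x + G x = y.
  pose f : X -> X := fun x => y - G x.
  have ff : set_fun [set: X] [set: X] f by [].
  pose f' : {fun [set: X] >-> [set: X]} := HB.pack f (isFun.Build _ _ _ _ f ff).
  have cf : is_contraction f'.
    exists (NngNum L0); split => /=; first by lra.
    move=> -[x1 x2] _ /=.
    have -> : f x1 - f x2 = - (G x1 - G x2) by rewrite /f; apply/rowP => i; rewrite !mxE; ring.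
    by rewrite normrN; exact: GL.
  have [|p _ pE] := banach_fixed_point cf closedT; first by exists 0.
  by exists p; apply/eqP; rewrite {1}pE /= /f subrK.
have inj x1 x2 : `|x1 - x2| <= 2 * `|(x1 + G x1) - (x2 + G x2)|.
  have -> : (x1 + G x1) - (x2 + G x2) = (x1 - x2) + (G x1 - G x2).
    by rewrite opprD addrACA.
  have := lerB_normD (x1 - x2) (G x1 - G x2); have := GL x1 x2.
  have := normr_ge0 (x1 - x2); move: `|_ + _| `|G _ - _| `|x1 - x2| => a b c; nra.
have [T TP] := choice surj.
exists T; split => [|//|x]; last first.
- apply/eqP; rewrite -subr_eq0 -normr_le0.
  by apply: le_trans (inj _ _) _; rewrite TP subrr normr0 mulr0.
apply: continuous_measurable_rV_rV => y.
apply: (iffRL (@cvgrPdist_lt _ Rn Rn (nbhs y) (nbhs_filter y) T (T y))) => e e0.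
have e2 : 0 < e / 2 by rewrite divr_gt0.
apply: filterS (nbhsx_ballx y (e / 2) e2) => z; rewrite -ball_normE /= => yz.
by apply: le_lt_trans (inj _ _) _; rewrite !TP mulrC -ltr_pdivlMr.
Qed.

Lemma Ccoo_perturbed_id_inverse (U : set Rn) (phi : Rn -> R) : Ccoo U phi ->
  exists2 s0 : R, 0 < s0 & forall s, 0 <= s <= s0 ->
  exists T : Rn -> Rn,
    [/\ measurable_fun setT T, forall y, T y + s *: grad phi (T y) = y &
        forall x, T (x + s *: grad phi x) = x].
Proof.
move=> phiC; have [C C0 gL] := Ccoo_grad_lipschitz phiC.
have Q0 : 0 < 2 * (C * n%:R + 1) by rewrite mulr_gt0// ltr_wpDl// mulr_ge0.
exists (2 * (C * n%:R + 1))^-1; first by rewrite invr_gt0.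
move=> s /andP[s0 s1].
have sQ : s * (2 * (C * n%:R + 1)) <= 1 by rewrite -ler_pdivlMr// div1r.
apply: (@perturbed_id_inverse (fun x => s *: grad phi x) (s * (C * n%:R))).
  by rewrite !mulr_ge0//=; nra.
move=> x y; rewrite -scalerBr normrZ ger0_norm// -mulrA ler_wpM2l//.
apply: normv_le => [|i]; first by rewrite !mulr_ge0.
rewrite !mxE; apply: le_trans (gL i y x) _; rewrite -mulrA ler_wpM2l//.
apply: (le_trans (ler_sum _ (fun i _ => coord_le_normv (x - y) i))).
by rewrite sumr_const card_ord mulr_natl.
Qed.

End perturbation_of_identity.

Section pushforward_probability.
Context d d' (T : measurableType d) (T' : measurableType d') (R : realType).

Lemma pushforward_probability (P : probability T R) (h : T -> T') :
  measurable_fun setT h ->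
  exists P' : probability T' R, forall A, P' A = P (h @^-1` A).
Proof.
move=> mh; pose h' : {mfun T >-> T'} := HB.pack h (isMeasurableFun.Build _ _ _ _ h mh).
by exists (distribution P h').
Qed.

End pushforward_probability.

Section transport_reduction.
Context {R : realType} {n : nat} (mu : probability 'rV[R]_n R).
Local Notation Rn := 'rV[R]_n.
Variables (U V : set Rn) (phi psi : Rn -> R).
Hypotheses (mu_bdd : essbv mu id) (phiC : Ccoo U phi) (psiC : Ccoo V psi).

Let S (f : Rn -> R) (s : R) x := x + s *: grad f x.

Let mS W f s : Ccoo W f -> measurable_fun setT (S f s).
Proof.
move=> fW; apply: measurable_fun_rV => i.
under eq_fun do rewrite /S !mxE.
apply: measurable_funD; first exact: measurable_coord.
apply: measurable_funM; first exact: measurable_cst.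
apply: continuous_measurable_rV; apply: smooth_continuous.
exact: Ccoo_smooth (Ccoo_partial i fW).
Qed.

Let m_pair (f g : Rn -> Rn) : measurable_fun setT f -> measurable_fun setT g ->
  measurable_fun setT (fun z : Rn * Rn => (f z.1, g z.2)).
Proof.
move=> mf mg; apply: measurable_fun_pair.
  exact: measurableT_comp mf measurable_fst.
exact: measurableT_comp mg measurable_snd.
Qed.

Let m_cost : measurable_fun setT (fun z : Rn * Rn => (sqnorm (z.1 - z.2))%:E).
Proof.
apply/measurable_EFinP; rewrite /sqnorm /dotv; apply: measurable_sum => i.
under eq_fun do rewrite !mxE.
have m : measurable_fun setT (fun z : Rn * Rn => z.1 ord0 i - z.2 ord0 i).
  apply: measurable_funB.
    exact: measurableT_comp (measurable_coord i) measurable_fst.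
  exact: measurableT_comp (measurable_coord i) measurable_snd.
exact: measurable_funM.
Qed.

Let cost_ge0 (z : Rn * Rn) : (0 <= (sqnorm (z.1 - z.2))%:E)%E.
Proof. by rewrite lee_fin sqnorm_ge0. Qed.

(** For small [s] and [t] both maps are bijections with measurable inverses, so couplings of the
    images correspond to self-couplings of [mu]. The infimum is described by its two defining
    bounds, which keeps later estimates among real numbers. *)
Lemma wasserstein2_self_couplings : exists2 s0 : R, 0 < s0 &
  forall s t, 0 <= s <= s0 -> 0 <= t <= s0 ->
  let w := fine (wasserstein2 (exp_map mu (fun x => s *: grad phi x))
                              (exp_map mu (fun x => t *: grad psi x))) ^+ 2 in
  (forall gam, coupling mu mu gam -> w <= push_cost phi psi gam s t) /\
  (forall v, (forall gam, coupling mu mu gam -> v <= push_cost phi psi gam s t) -> v <= w).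
Proof.
have [s1 s10 inv1] := Ccoo_perturbed_id_inverse phiC.
have [s2 s20 inv2] := Ccoo_perturbed_id_inverse psiC.
exists (Num.min s1 s2); first by rewrite lt_min s10.
move=> s t /andP[s_ge0 ss] /andP[t_ge0 ts].
have [S1 [mS1 S1K K1S]] : exists T : Rn -> Rn,
    [/\ measurable_fun setT T, forall y, T y + s *: grad phi (T y) = y &
        forall x, T (x + s *: grad phi x) = x].
  by apply: inv1; rewrite s_ge0 (le_trans ss)// ge_min lexx.
have [S2 [mS2 S2K K2S]] : exists T : Rn -> Rn,
    [/\ measurable_fun setT T, forall y, T y + t *: grad psi (T y) = y &
        forall x, T (x + t *: grad psi x) = x].
  by apply: inv2; rewrite t_ge0 (le_trans ts)// ge_min lexx orbT.
set mus := exp_map mu _; set nut := exp_map mu _.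
pose C := [set (\int[pi]_z (sqnorm (z.1 - z.2))%:E)%E | pi in coupling mus nut].
have mSs := mS s phiC; have mSt := mS t psiC.
have CP gam : coupling mu mu gam -> C (push_cost phi psi gam s t)%:E.
  move=> cg; have mh := m_pair mSs mSt.
  have [pi piE] := pushforward_probability gam mh.
  have tr : transports gam pi (fun z : Rn * Rn => (S phi s z.1, S psi t z.2)).
    by split => // A mA; rewrite piE.
  exists pi.
    move=> A mA; rewrite !piE.
    have mA1 : measurable (S phi s @^-1` A) by rewrite -[X in measurable X]setTI; exact: mSs.
    have mA2 : measurable (S psi t @^-1` A) by rewrite -[X in measurable X]setTI; exact: mSt.
    have [g1 _] := cg _ mA1; have [_ g2] := cg _ mA2.
    split.
      transitivity (mu (S phi s @^-1` A)); last by [].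
      by rewrite -g1; congr (gam _); apply/seteqP; split => z.
    transitivity (mu (S psi t @^-1` A)); last by [].
    by rewrite -g2; congr (gam _); apply/seteqP; split => z.
  rewrite (transports_ge0 tr m_cost cost_ge0).
  have ec := push_cost_essb mu_bdd phiC psiC s t cg.
  by rewrite -(essb_EFin ec).
have PC x : C x -> exists2 gam, coupling mu mu gam & x = (push_cost phi psi gam s t)%:E.
  move=> [pi pic <-]; have mh := m_pair mS1 mS2.
  have [gam gamE] := pushforward_probability pi mh.
  have cg : coupling mu mu gam.
    move=> A mA; rewrite !gamE.
    have mA1 : measurable (S1 @^-1` A) by rewrite -[X in measurable X]setTI; exact: mS1.
    have mA2 : measurable (S2 @^-1` A) by rewrite -[X in measurable X]setTI; exact: mS2.
    split.
      have -> : (fun z : Rn * Rn => (S1 z.1, S2 z.2)) @^-1` (A `*` setT) = (S1 @^-1` A) `*` setT.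
        by apply/seteqP; split => z.
      rewrite (pic _ mA1).1 /mus /exp_map /pushforward; congr (mu _).
      by apply/seteqP; split => x1 /=; rewrite K1S.
    have -> : (fun z : Rn * Rn => (S1 z.1, S2 z.2)) @^-1` (setT `*` A) = setT `*` (S2 @^-1` A).
      by apply/seteqP; split => z.
    rewrite (pic _ mA2).2 /nut /exp_map /pushforward; congr (mu _).
    by apply/seteqP; split => x1 /=; rewrite K2S.
  exists gam => //.
  have tr : transports pi gam (fun z : Rn * Rn => (S1 z.1, S2 z.2)).
    by split => // A mA; rewrite gamE.
  have ec := push_cost_essb mu_bdd phiC psiC s t cg.
  rewrite -(essb_EFin ec) (transports_ge0 tr).
  - by apply: eq_integral => z _ /=; rewrite S1K S2K.
  - by apply/measurable_EFinP; case: ec.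
  - by move=> z; rewrite lee_fin sqnorm_ge0.
have c0 := product_coupling mu.
have inf0 : (0 <= ereal_inf C)%E.
  apply/ereal_infP => x /PC[gam _ ->]; rewrite lee_fin.
  by apply: Rintegral_ge0 => z _; exact: sqnorm_ge0.
have inf_le gam : coupling mu mu gam -> (ereal_inf C <= (push_cost phi psi gam s t)%:E)%E.
  by move=> /CP; exact: ereal_inf_lbound.
(* The infimum lies between 0 and the cost of the product coupling, so [fine] and the square root
   lose nothing. *)
have [r rE r0] : exists2 r : R, ereal_inf C = r%:E & 0 <= r.
  have := inf0; have := inf_le _ c0; case: (ereal_inf C) => [r| |] //.
  by rewrite lee_fin => _ r0; exists r.
have -> : fine (wasserstein2 mus nut) ^+ 2 = r.
  by rewrite /wasserstein2 -/C rE /= sqr_sqrtr.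
split => [gam cg|v vle].
  by rewrite -lee_fin -rE; exact: inf_le.
rewrite -lee_fin -rE; apply/ereal_infP => x /PC[gam cg ->].
by rewrite lee_fin; exact: vle.
Qed.

End transport_reduction.

(** * The curvature *)

Lemma density_bounded_support {R : realType} {n : nat} (mu : probability 'rV[R]_n R)
  (rho : 'rV[R]_n -> R) : Ccoo setT rho -> has_density mu rho ->
  exists2 K : R, 0 <= K & {ae mu, forall x : 'rV[R]_n, forall d, `|x ord0 d| <= K}.
Proof.
move=> [_ rhoc _] mu_rho.
have [M [_ suppM]] := compact_bounded rhoc.
exists (`|M| + 1); first by rewrite addr_ge0.
have open_N : open (~` supp rho) by apply: closed_openC; exact: closed_closure.
have mN := open_measurable_rV open_N.
exists (~` supp rho); split => //.
  rewrite mu_rho//; under eq_integral => x.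
    by rewrite inE => /Ccoo_eq0 ->; over.
  by rewrite integral0.
move=> x /= Hx sx; apply: Hx => d; apply: le_trans (coord_le_normv x d) _.
apply: (suppM (`|M| + 1)) => //.
by rewrite (le_lt_trans (ler_norm M))// ltrDl.
Qed.

Section curvature.
Context {R : realType} {n : nat} (mu : probability 'rV[R]_n R).
Local Notation Rn := 'rV[R]_n.
Variables (K : R) (U V : set Rn) (phi psi : Rn -> R).
Hypotheses (K_ge0 : 0 <= K)
  (mu_box : {ae mu, forall x : Rn, forall d, `|x ord0 d| <= K})
  (phiC : Ccoo U phi) (psiC : Ccoo V psi).

Let F x := hessian_app psi x (grad phi x).
Let resid eta : R := \int[mu]_x sqnorm (F x - grad eta x).
Let Iset : set R := [set resid eta | eta in Ccoo setT].
Let w (s t : R) := fine (wasserstein2 (exp_map mu (fun x => s *: grad phi x))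
                                      (exp_map mu (fun x => t *: grad psi x))) ^+ 2.
Let D s t : R := base_cost mu phi psi s t - w s t.

Let resid_ge0 eta : 0 <= resid eta.
Proof. by apply: Rintegral_ge0 => x _; exact: sqnorm_ge0. Qed.

Let has_inf_Iset : has_inf Iset.
Proof.
split; first by exists (resid (fun=> 0)); exists (fun=> 0) => //; exact: Ccoo0.
by exists 0 => _ [eta _ <-].
Qed.

Let inf_le eta : Ccoo setT eta -> inf Iset <= resid eta.
Proof. by move=> etaC; apply: ge_inf; [exact: has_inf_Iset.2|exists eta]. Qed.

Let inf_ge0 : 0 <= inf Iset.
Proof. by apply: lb_le_inf; [exact: has_inf_Iset.1|move=> _ [eta _ <-]]. Qed.

Lemma essbv_id : essbv mu id.
Proof.
move=> d; split; first exact: measurable_coord.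
by exists K; apply: filterS mu_box => x; exact.
Qed.

Let FC d : Ccoo setT (fun x => F x ord0 d).
Proof. exact: hessian_app_grad_Ccoo phiC psiC. Qed.

Let eF : essbv mu F. Proof. by move=> d; exact: Ccoo_essb (FC d). Qed.

Lemma cost_gap_upper eta : Ccoo setT eta -> exists2 k : R, 0 < k &
  exists2 C, 0 <= C & forall s t, 0 < s < k -> 0 < t < k ->
    C * (s + t) <= 1 / 2 ->
    D s t <= (s * t) ^+ 2 * (resid eta / (1 - C * (s + t))).
Proof.
move=> etaC.
have [C0 C00 expansion] := push_cost_expansion essbv_id phiC psiC.
have [C1 C10 corr_le] := disp_corr_le essbv_id eF etaC.
have [s0 s00 W2] := wasserstein2_self_couplings essbv_id phiC psiC.
exists (Num.min 1 s0); first by rewrite lt_min ltr01.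
exists (C0 + 2 * C1); first by rewrite addr_ge0// mulr_ge0.
move=> s t /andP[s_gt0 sk] /andP[t_gt0 tk] st_small.
have s1 : s <= 1 by apply: ltW (lt_le_trans sk _); rewrite ge_min lexx.
have t1 : t <= 1 by apply: ltW (lt_le_trans tk _); rewrite ge_min lexx.
have ss0 : s <= s0 by apply: ltW (lt_le_trans sk _); rewrite ge_min lexx orbT.
have ts0 : t <= s0 by apply: ltW (lt_le_trans tk _); rewrite ge_min lexx orbT.
have s_ge0 := ltW s_gt0; have t_ge0 := ltW t_gt0.
have eps0 : 0 <= s * t by rewrite mulr_ge0.
have eps_le : s * t <= s + t by nra.
have [_ w_ge] := W2 s t (introT andP (conj s_ge0 ss0)) (introT andP (conj t_ge0 ts0)).
(* This weight in Young's inequality, together with the errors of the expansion and of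
   [disp_corr_le], uses at most the available [disp2 gam], whose coefficient then is nonnegative. *)
set c := 1 - (C0 + 2 * C1) * (s + t).
have c0 : 0 < c by rewrite /c; lra.
rewrite /D lerBlDl -lerBlDr; apply: w_ge => gam cg.
have := expansion gam cg s t; rewrite s_ge0 s1 t_ge0 t1 => /(_ erefl erefl)/ler_normlP[H1 _].
have H2 := corr_le gam cg (s * t) c eps0 c0.
have d2 := disp2_ge0 gam.
have H3 : (s * t) * (C1 * disp2 gam) <= (s + t) * (C1 * disp2 gam).
  by rewrite ler_wpM2r// mulr_ge0.
move: H2; rewrite -/(resid eta).
have -> : (s * t) ^+ 2 / c * resid eta = (s * t) ^+ 2 * (resid eta / c) by ring.
rewrite {2}/c; move: (_ ^+ 2 * (resid eta / c)) => X H2; lra.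
Qed.

(** A circulating self-coupling of time [s * t] gains twice [(s * t) ^+ 2 * resid eta] and spends it
    once. Its [eta] depends on the cells, so only [inf Iset] can remain in the bound. *)
Lemma cost_gap_lower : exists2 k : R, 0 < k &
  exists2 C, 0 <= C & forall s t, 0 < s < k -> 0 < t < k ->
    C * (s + t) <= 1 ->
    (s * t) ^+ 2 * (inf Iset * (1 - C * (s + t)) - C * (s + t)) <= D s t.
Proof.
have [C0 C00 expansion] := push_cost_expansion essbv_id phiC psiC.
have [C1 C10 circ] := circulating_coupling K_ge0 mu_box FC.
have [s0 s00 W2] := wasserstein2_self_couplings essbv_id phiC psiC.
exists (Num.min 1 s0); first by rewrite lt_min ltr01.
exists (C0 + 2 * C1); first by rewrite addr_ge0// mulr_ge0.
move=> s t /andP[s_gt0 sk] /andP[t_gt0 tk] st_small.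
have s1 : s <= 1 by apply: ltW (lt_le_trans sk _); rewrite ge_min lexx.
have t1 : t <= 1 by apply: ltW (lt_le_trans tk _); rewrite ge_min lexx.
have ss0 : s <= s0 by apply: ltW (lt_le_trans sk _); rewrite ge_min lexx orbT.
have ts0 : t <= s0 by apply: ltW (lt_le_trans tk _); rewrite ge_min lexx orbT.
have s_ge0 := ltW s_gt0; have t_ge0 := ltW t_gt0.
have eps0 : 0 < s * t by rewrite mulr_gt0.
have eps_le : s * t <= s + t by nra.
have eps1 : s * t <= 1 by nra.
have [w_le _] := W2 s t (introT andP (conj s_ge0 ss0)) (introT andP (conj t_ge0 ts0)).
have C0st : C0 * (s + t) <= 1.
  have : 0 <= C1 * (s + t) by rewrite mulr_ge0// addr_ge0.
  move: st_small; rewrite mulrDl; lra.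
have C0st0 : 0 <= C0 * (s + t) by rewrite mulr_ge0// addr_ge0.
(* With [s] and [t] fixed the tolerance is arbitrary; this is where the mesh tends to 0. *)
apply/ler_addgt0Pl => e e0.
have [gam [eta [cg etaC d2 dc]]] :=
  circ (s * t) (e / 4) (introT andP (conj eps0 eps1)) (divr_gt0 e0 (ltr0n _ 4)).
have := expansion gam cg s t; rewrite s_ge0 s1 t_ge0 t1 => /(_ erefl erefl)/ler_normlP[_ H1].
have wle := w_le gam cg; rewrite -/(w s t) in wle.
rewrite -/(resid eta) in d2 dc.
have infr := inf_le etaC.
have h1 : (1 + C0 * (s + t)) * disp2 gam <=
    (1 + C0 * (s + t)) * ((s * t) ^+ 2 * resid eta + e / 4).
  by rewrite ler_wpM2l// addr_ge0.
have h2 : 2 * (s * t) * (s * t * resid eta - C1 * (s * t) ^+ 2 - e / 4) <=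
    2 * (s * t) * disp_corr gam F.
  by rewrite ler_wpM2l// mulr_ge0// ltW.
have h3 : (s * t) ^+ 2 * ((1 - C0 * (s + t)) * inf Iset) <=
   (s * t) ^+ 2 * ((1 - C0 * (s + t)) * resid eta).
  by rewrite ler_wpM2l ?sqr_ge0// ler_wpM2l//; lra.
have h4 : (s * t) ^+ 2 * (C1 * (s * t)) <= (s * t) ^+ 2 * (C1 * (s + t)).
  by rewrite ler_wpM2l ?sqr_ge0// ler_wpM2l.
have h5 : (s * t) * e <= 1 * e by rewrite ler_wpM2r// ltW.
have h6 : C0 * (s + t) * e <= 1 * e by rewrite ler_wpM2r// ltW.
have h7 : 0 <= (s * t) ^+ 2 * (C0 * (s + t)) by rewrite mulr_ge0// sqr_ge0.
have h8 : 0 <= (s * t) ^+ 2 * (C1 * (s + t)).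
  by rewrite mulr_ge0 ?sqr_ge0// mulr_ge0// addr_ge0.
have h9 : 0 <= (s * t) ^+ 2 * (C1 * (s + t)) * inf Iset by rewrite mulr_ge0.
rewrite /D; nra.
Qed.

Lemma cost_gap_limit (e : R) : 0 < e -> exists2 k : R, 0 < k &
  forall s t, 0 < s < k -> 0 < t < k -> `|D s t / (s * t) ^+ 2 - inf Iset| <= e.
Proof.
move=> e0.
have e2 : 0 < e / 2 by rewrite divr_gt0.
(* The near-minimizer is fixed before [s] and [t], since the constant of the upper bound depends on
   it. *)
have [_ [eta etaC <-] resid_lt] := inf_adherent e2 has_inf_Iset.
have [k1 k10 [C1 C10 up]] := cost_gap_upper etaC.
have [k2 k20 [C2 C20 lo]] := cost_gap_lower.
set J := inf Iset in resid_lt lo *.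
have r0 := resid_ge0 eta; set r := resid eta in resid_lt r0 up.
(* One constant dominating [C1], [C2], [C1 * r] and [C2 * (J + 1)], the coefficients of [s + t] in
   the two bounds. *)
pose X := (C1 + C2) * (r + J + 1) + 1.
have X0 : 0 < X by rewrite ltr_wpDl// mulr_ge0 ?addr_ge0.
have J0 : 0 <= J := inf_ge0.
have p1 := mulr_ge0 C10 r0; have p2 := mulr_ge0 C20 r0.
have p3 := mulr_ge0 C10 J0; have p4 := mulr_ge0 C20 J0.
have CX1 : C1 <= X by rewrite /X; lra.
have CX2 : C2 <= X by rewrite /X; lra.
have C1r : C1 * r <= X by rewrite /X; lra.
have C2J : C2 * (J + 1) <= X by rewrite /X; lra.
pose k := Num.min (Num.min k1 k2) (Num.min (1 / (4 * X)) (e / (8 * X))).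
have k0 : 0 < k by rewrite !lt_min k10 k20 !divr_gt0// mulr_gt0.
exists k => // s t /andP[s0 sk] /andP[t0 tk].
have kk1 : k <= k1 by rewrite /k !ge_min lexx.
have kk2 : k <= k2 by rewrite /k !ge_min lexx orbT.
have kX : k * (4 * X) <= 1.
  rewrite -ler_pdivlMr ?mulr_gt0//; by rewrite /k !ge_min lexx !orbT.
have keX : k * (8 * X) <= e.
  rewrite -ler_pdivlMr ?mulr_gt0//; by rewrite /k !ge_min lexx !orbT.
have s1 : 0 < s < k1 by rewrite s0 (lt_le_trans sk).
have t1 : 0 < t < k1 by rewrite t0 (lt_le_trans tk).
have s2 : 0 < s < k2 by rewrite s0 (lt_le_trans sk).
have t2 : 0 < t < k2 by rewrite t0 (lt_le_trans tk).
set sg := s + t; have sg0 : 0 < sg by exact: addr_gt0.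
have sgk : sg <= 2 * k by rewrite /sg; lra.
have bound c : 0 <= c -> c <= X -> c * sg <= 1 / 2 /\ c * sg <= e / 4.
  move=> c0 cX; have H : c * sg <= X * (2 * k) by rewrite ler_pM// ltW.
  by split; lra.
have st2 : 0 < (s * t) ^+ 2 by rewrite exprn_gt0// mulr_gt0.
have [b1 _] := bound _ C10 CX1.
have [b2 _] := bound _ C20 CX2.
have [_ b3] := bound _ (mulr_ge0 C10 r0) C1r.
have [_ b4] := bound _ (mulr_ge0 C20 (addr_ge0 inf_ge0 ler01)) C2J.
have U1 := up s t s1 t1 b1.
have L1 := lo s t s2 t2 (le_trans b2 (ltac:(lra) : 1 / 2 <= 1 :> R)).
have c0 : 0 < 1 - C1 * sg by lra.
have r_le : r / (1 - C1 * sg) <= r + e / 2.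
  rewrite ler_pdivrMr//.
  have H : 0 <= e / 2 * (1 / 2 - C1 * sg) by rewrite mulr_ge0//; lra.
  lra.
apply/ler_normlP; split.
  rewrite opprB lerBlDr -lerBlDl ler_pdivlMr// mulrC.
  apply: le_trans L1; rewrite ler_wpM2l ?(ltW st2)// -/sg; lra.
rewrite lerBlDl ler_pdivrMr// mulrC.
apply: le_trans U1 _; rewrite ler_wpM2l ?(ltW st2)// -/sg; lra.
Qed.

Lemma sec_quotient_cvg (s t : R^nat) :
  (forall j, 0 < s j) -> (forall j, 0 < t j) ->
  s @ \oo --> (0 : R) -> t @ \oo --> (0 : R) ->
  sec_quotient mu (grad phi) (grad psi) (s j) (t j) @[j --> \oo] -->
    3 / Lambda mu (grad phi) (grad psi) * inf Iset.
Proof.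
move=> s0 t0 s_lim t_lim; set L := Lambda _ _ _.
have -> : (fun j => sec_quotient mu (grad phi) (grad psi) (s j) (t j)) =
    fun j => 3 / L * (D (s j) (t j) / (s j * t j) ^+ 2).
  apply/funext => j.
  have -> : sec_quotient mu (grad phi) (grad psi) (s j) (t j) =
      3 / (L * s j ^+ 2 * t j ^+ 2) * D (s j) (t j) by [].
  by rewrite exprMn !invfM; ring.
apply: cvgMr.
apply/cvgrPdist_le => e e0; have [k k0 kP] := cost_gap_limit e0.
have s_small : \forall j \near \oo, s j < k by exact: (cvgr_lt _ s_lim).
have t_small : \forall j \near \oo, t j < k by exact: (cvgr_lt _ t_lim).
by apply: filterS2 s_small t_small => j sj tj; rewrite distrC kP ?s0 ?t0.
Qed.

End curvature.

Theorem theorem3p24 (R : realType) (n : nat) (mu : probability 'rV[R]_n R)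
  (rho phi psi : 'rV[R]_n -> R) :
  Ccoo setT rho ->
  has_density mu rho ->
  Ccoo [set x | 0 < rho x] phi ->
  Ccoo [set x | 0 < rho x] psi ->
  0 < Lambda mu (grad phi) (grad psi) ->
  is_Sec mu (grad phi) (grad psi)
    (3 / Lambda mu (grad phi) (grad psi) *
     inf [set \int[mu]_x sqnorm (hessian_app psi x (grad phi x) - grad eta x)
         | eta in Ccoo setT]).
Proof.
move=> rhoC mu_rho phiC psiC L0.
have [K K0 mu_box] := density_bounded_support rhoC mu_rho.
have L2 f : Ccoo [set x | 0 < rho x] f -> L2_field mu (grad f).
  move=> fC; have eg := grad_essbv mu fC; split.
    by apply: measurable_fun_rV => i; case: (eg i).
  by rewrite (essb_EFin (essb_sqnorm eg)) ltry.
split => //; [|exact: L2|exact: L2|].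
  by rewrite /finite_second_moment (essb_EFin (essb_sqnorm (essbv_id mu_box))) ltry.
by move=> s t s0 t0 s_lim t_lim _; exact: (sec_quotient_cvg K0 mu_box phiC psiC).
Qed.
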